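(* Let $\Sigma\subset\mathbb{R}^d$ be a compact $C^2$ hypersurface that does not lie in a hyperplane, with surface measure $d\sigma$. Then there is a constant $c>0$, independent of $R$, such that for every $R\ge 1$ there exist a nonzero $f\in L^2(\Sigma;d\sigma)$ and a nonnegative weight $w:\mathbb{R}^d\to[0,\infty)$ with $0<\sup_{\ell}\int_\ell w<\infty$ such that $$\int_{B_R(0)}|\mathcal{E}f(x)|^2\,w(x)\,dx\;\ge\; c\,\log R\;\|f\|_{L^2(\Sigma;d\sigma)}^2\;\sup_{\ell\subset\mathbb{R}^d\text{ a line}}\int_\ell w .$$
   Context: The extension operator $\mathcal{E}$ associated with $\Sigma$ is $\mathcal{E}f(x)=\int_\Sigma e^{-2\pi i\langle x,\varsigma\rangle}f(\varsigma)\,d\sigma(\varsigma)$ for $f\in L^1(\Sigma;d\sigma)$, $x\in\mathbb{R}^d$. $B_R(0)$ is the ball of radius $R$ centred at the origin. For a line $\ell$, $\int_\ell w$ is the integral of $w$ along $\ell$ with respect to arc length.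
   Formalization: Here d ≥ 2 and some connected component of Σ, not merely Σ as a whole, is required not to lie in a hyperplane; for two discs in parallel hyperplanes, or two points when d = 1, the claimed log R lower bound fails. *)

(* Defs.v *)
From HB Require Import structures.
From mathcomp Require Import all_boot all_order all_algebra.
From mathcomp Require Import all_classical all_reals all_analysis.
From mathcomp Require Import measurable_realfun complex.
Set Implicit Arguments.
Unset Strict Implicit.
Unset Printing Implicit Defensive.
Import Order.TTheory GRing.Theory Num.Theory.
Import numFieldNormedType.Exports.
Local Open Scope classical_set_scope.
Local Open Scope ring_scope.

(* The sigma-algebra generated by the coordinates, as for [n.-tuple T] in
   mathcomp-analysis; it is the Borel sigma-algebra of R^n. *)
Definition rV_display : measure_display. Proof. exact: default_measure_display. Qed.

Section measurable_rV.
Variables (R : realType) (n : nat).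

Definition coord_rV (i : 'I_n) (x : 'rV[R]_n) : measurableTypeR R := x ord0 i.

Let rV_set0 : g_sigma_preimage coord_rV set0.
Proof. exact: sigma_algebra0. Qed.
Let rV_setC A : g_sigma_preimage coord_rV A -> g_sigma_preimage coord_rV (~` A).
Proof. exact: sigma_algebraC. Qed.
Let rV_bigcup (F : (set 'rV[R]_n)^nat) :
  (forall i, g_sigma_preimage coord_rV (F i)) ->
  g_sigma_preimage coord_rV (\bigcup_i F i).
Proof. exact: sigma_algebra_bigcup. Qed.

HB.instance Definition _ := @isMeasurable.Build rV_display 'rV[R]_n
  (g_sigma_preimage coord_rV) rV_set0 rV_setC rV_bigcup.
End measurable_rV.

Lemma measurable_coord_rV (R : realType) n (i : 'I_n) :
  measurable_fun [set: 'rV[R]_n] (fun x => x ord0 i : R).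
Proof.
move=> _ Y mY; rewrite setTI; apply: sub_sigma_algebra => /=.
rewrite -bigcup_seq/=; exists i => /=; first by rewrite mem_index_enum.
by exists Y => //; rewrite setTI.
Qed.

Lemma measurable_fun_rVP (R : realType) n d (T : measurableType d)
    (f : T -> 'rV[R]_n) :
  (forall i, measurable_fun [set: T] (fun t => f t ord0 i : R)) ->
  measurable_fun [set: T] f.
Proof.
move=> mf.
have mC : g_sigma_preimage (fun i t => f t ord0 i : measurableTypeR R)
   `<=` (measurable : set (set T)).
  apply: smallest_sub; first exact: sigma_algebra_measurable.
  move=> A; rewrite -bigcup_seq => -[i _ [B mB <-]]; exact: mf.
move=> _ A mA; apply: mC.
by rewrite (g_sigma_preimage_comp (@coord_rV R n) f); exists A.
Qed.

Section lebesgue_rV.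
Variable R : realType.

Definition rV_cons n (p : measurableTypeR R * 'rV[R]_n) : 'rV[R]_n.+1 :=
  row_mx (const_mx p.1 : 'rV_1) p.2.

Lemma rV_cons0 n (p : measurableTypeR R * 'rV[R]_n) : rV_cons p ord0 ord0 = p.1.
Proof.
have -> : ord0 = lshift n (ord0 : 'I_1) :> 'I_n.+1 by apply/val_inj.
by rewrite /rV_cons (@row_mxEl _ 1 1 n) mxE.
Qed.

Lemma rV_consS n (p : measurableTypeR R * 'rV[R]_n) i :
  rV_cons p ord0 (lift ord0 i) = p.2 ord0 i.
Proof.
have -> : lift ord0 i = rshift 1 i :> 'I_n.+1 by apply/val_inj.
by rewrite /rV_cons (@row_mxEr _ 1 1 n).
Qed.

Lemma measurable_rV_cons n : measurable_fun setT (@rV_cons n).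
Proof.
apply: measurable_fun_rVP => i; case: (unliftP ord0 i) => [j|] ->.
  under eq_fun do rewrite rV_consS.
  exact: (measurableT_comp (measurable_coord_rV j) measurable_snd).
by under eq_fun do rewrite rV_cons0; exact: measurable_fst.
Qed.

Section lebesgue_cons.
Variables (n : nat) (mu : {sigma_finite_measure set 'rV[R]_n -> \bar R}).

(* [lebesgue_rV] is the n-fold product of the one-dimensional Lebesgue measure,
   transported along R * R^n -> R^(n+1). *)
Definition lebesgue_cons : set 'rV[R]_n.+1 -> \bar R :=
  pushforward (lebesgue_measure \x mu)%E (@rV_cons n).

Let measurable_pre A : measurable A -> measurable (@rV_cons n @^-1` A).
Proof. by move=> mA; rewrite -[X in measurable X]setTI; exact: measurable_rV_cons. Qed.

Let lebesgue_cons0 : lebesgue_cons set0 = 0%E.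
Proof. by rewrite /lebesgue_cons /pushforward preimage_set0 measure0. Qed.

Let lebesgue_cons_ge0 A : (0 <= lebesgue_cons A)%E.
Proof. by rewrite /lebesgue_cons /pushforward; exact: measure_ge0. Qed.

Let lebesgue_cons_sigma_additive : semi_sigma_additive lebesgue_cons.
Proof.
move=> F mF tF mUF; rewrite /lebesgue_cons /pushforward preimage_bigcup.
apply: measure_semi_sigma_additive.
- by move=> k; exact: measurable_pre.
- apply/trivIsetP => /= i j _ _ ij; rewrite -preimage_setI.
  by move/trivIsetP : tF => /(_ _ _ _ _ ij) ->//; rewrite preimage_set0.
- by rewrite -preimage_bigcup; exact: measurable_pre.
Qed.

HB.instance Definition _ := isMeasure.Build _ _ _ lebesgue_cons
  lebesgue_cons0 lebesgue_cons_ge0 lebesgue_cons_sigma_additive.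

Let lebesgue_cons_sigma_finite : sigma_finite setT lebesgue_cons.
Proof.
pose uncons (x : 'rV[R]_n.+1) : measurableTypeR R * 'rV[R]_n :=
  (x ord0 ord0, \row_i x ord0 (lift ord0 i)).
have consK : cancel (@rV_cons n) uncons.
  move=> [t x]; rewrite /uncons rV_cons0; congr pair.
  by apply/rowP => i; rewrite mxE rV_consS.
have muncons : measurable_fun setT uncons.
  apply: measurable_fun_pair => /=; first exact: measurable_coord_rV.
  apply: measurable_fun_rVP => i; under eq_fun do rewrite mxE.
  exact: measurable_coord_rV.
have /sigma_finiteP[F [TF ndF Foo]] := sigma_finiteT (@lebesgue_measure R).
have /sigma_finiteP[G [TG ndG Goo]] := sigma_finiteT mu.
exists (fun k => uncons @^-1` (F k `*` G k)).
  apply/seteqP; split=> // x _.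
  have [k _ Fk] : (\bigcup_k F k) (uncons x).1 by rewrite -TF.
  have [l _ Gl] : (\bigcup_k G k) (uncons x).2 by rewrite -TG.
  exists (maxn k l) => //; split.
    by move: Fk; exact/subsetPset/ndF/leq_maxl.
  by move: Gl; exact/subsetPset/ndG/leq_maxr.
move=> k; have [mFk Fkoo] := Foo k; have [mGk Gkoo] := Goo k; split.
  by rewrite -[X in measurable X]setTI; apply: muncons => //; exact: measurableX.
rewrite /lebesgue_cons /pushforward -comp_preimage.
rewrite (_ : uncons \o _ = id) ?preimage_id; last exact/funext.
by rewrite product_measure1E// lte_mul_pinfty// ge0_fin_numE.
Qed.

HB.instance Definition _ := Measure_isSigmaFinite.Build _ _ _ lebesgue_cons
  lebesgue_cons_sigma_finite.
End lebesgue_cons.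

Fixpoint lebesgue_rV n : {sigma_finite_measure set 'rV[R]_n -> \bar R} :=
  match n with
  | 0 => dirac (0 : 'rV[R]_0)
  | n.+1 => lebesgue_cons (lebesgue_rV n)
  end.

Lemma measurable_box n (a b : 'rV[R]_n) :
  measurable [set x : 'rV[R]_n | forall i, a ord0 i <= x ord0 i <= b ord0 i].
Proof.
rewrite (_ : mkset _ = \bigcap_(i in [set: 'I_n])
    (fun x : 'rV[R]_n => x ord0 i : R) @^-1` `[a ord0 i, b ord0 i]).
  apply: fin_bigcap_measurable => // i _.
  by rewrite -[X in measurable X]setTI; exact: measurable_coord_rV.
by apply/seteqP; split=> x /= xab i; [move=> _|have := xab i I];
  rewrite /= in_itv/=.
Qed.

Lemma lebesgue_rV_box n (a b : 'rV[R]_n) :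
  (forall i, a ord0 i <= b ord0 i) ->
  lebesgue_rV n [set x : 'rV[R]_n | forall i, a ord0 i <= x ord0 i <= b ord0 i] =
    (\prod_(i < n) (b ord0 i - a ord0 i))%:E.
Proof.
elim: n a b => [|n ih] a b ab.
  by rewrite big_ord0 /= diracE mem_set// => -[].
pose tl (x : 'rV[R]_n.+1) : 'rV[R]_n := \row_i x ord0 (lift ord0 i).
rewrite /= /lebesgue_cons /pushforward.
pose B : set (measurableTypeR R * 'rV[R]_n) :=
  `[a ord0 ord0, b ord0 ord0]%classic `*`
    [set x : 'rV[R]_n | forall i, tl a ord0 i <= x ord0 i <= tl b ord0 i].
rewrite [X in product_measure1 _ _ X](_ : _ = B); last first.
  apply/seteqP; split=> -[t x]; rewrite /B /=.
    move=> abx; split; first by have := abx ord0; rewrite rV_cons0 /= in_itv.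
    by move=> i; have := abx (lift ord0 i); rewrite rV_consS !mxE.
  rewrite /= in_itv/= => -[tab xab] i; case: (unliftP ord0 i) => [j|] ->.
    by have := xab j; rewrite rV_consS !mxE.
  by rewrite rV_cons0.
rewrite /B product_measure1E//; last exact: measurable_box.
rewrite ih; last by move=> i; rewrite !mxE.
rewrite big_ord_recl EFinM; congr (_ * _)%E; last first.
  by congr EFin; apply: eq_bigr => i _; rewrite !mxE.
apply: etrans (lebesgue_measure_itv `[a ord0 ord0, b ord0 ord0]) _.
rewrite /= lte_fin; case: ltP => // ba; rewrite EFinB.
by rewrite (le_anti (introT andP (conj (ab ord0) ba))) subee.
Qed.
End lebesgue_rV.

Section hausdorff.
Variable R : realType.
Local Open Scope ereal_scope.

Definition dotv n (x y : 'rV[R]_n) : R := (\sum_i x ord0 i * y ord0 i)%R.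

(* The library norm on ['rV[R]_n] is the sup norm; [enorm] is the Euclidean
   one. *)
Definition enorm n (x : 'rV[R]_n) : R := Num.sqrt (dotv x x).

Definition diam n (A : set 'rV[R]_n) : \bar R :=
  ereal_sup [set (enorm (x - y))%:E | x in A & y in A].

Definition ball_volume s : R := fine (lebesgue_rV R s [set x | enorm x <= 1]%R).

(* [ball_volume s * (diam A / 2) ^ s] is the volume of the s-dimensional ball of
   diameter [diam A]; with this normalisation [hausdorff s] agrees with the
   area on C^1 submanifolds of dimension s. *)
Definition hausdorff_cost s n (A : set 'rV[R]_n) : \bar R :=
  if `[< A = set0 >] then 0
  else (ball_volume s * (fine (diam A) / 2) ^+ s)%:E.

Definition hausdorff_pre s (delta : R) n (A : set 'rV[R]_n) : \bar R :=
  ereal_inf [set \sum_(k <oo) hausdorff_cost s (F k) | F in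
    [set F : (set 'rV[R]_n)^nat |
      (forall k, diam (F k) <= delta%:E) /\ A `<=` \bigcup_k F k]].

Definition hausdorff s n (A : set 'rV[R]_n) : \bar R :=
  ereal_sup [set hausdorff_pre s delta A | delta in [set delta | 0 < delta]%R].

Lemma enorm_coord n (x : 'rV[R]_n) i : (`|x ord0 i| <= enorm x)%R.
Proof.
rewrite -sqrtr_sqr ler_wsqrtr// /dotv (bigD1 i)//= -expr2 lerDl.
by apply: sumr_ge0 => j _; rewrite -expr2 sqr_ge0.
Qed.

Section fixed.
Variables (s n : nat).
Implicit Types A B X : set 'rV[R]_n.

Lemma hausdorff_cost0 : hausdorff_cost s (set0 : set 'rV[R]_n) = 0.
Proof. by rewrite /hausdorff_cost; case: asboolP. Qed.

Lemma hausdorff_cost_ge0 A : 0 <= hausdorff_cost s A.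
Proof.
rewrite /hausdorff_cost; case: asboolP => // /eqP/set0P[x Ax].
rewrite lee_fin mulr_ge0 ?fine_ge0// exprn_ge0// divr_ge0// fine_ge0//.
by apply: ereal_sup_ubound; exists x => //; exists x => //;
  rewrite subrr /enorm /dotv big1 ?sqrtr0// => i _; rewrite mxE mul0r.
Qed.
Hint Resolve hausdorff_cost_ge0 : core.

Lemma diam0 : diam (set0 : set 'rV[R]_n) = -oo.
Proof.
rewrite /diam (_ : image2 _ _ _ = set0) ?ereal_sup0//.
by apply/seteqP; split=> // y [x []].
Qed.

Lemma le_hausdorff_pre delta A B :
  A `<=` B -> hausdorff_pre s delta A <= hausdorff_pre s delta B.
Proof.
move=> AB; apply: ereal_inf_le_tmp => _ [F [dF BF] <-].
by exists F => //; split => //; exact: subset_trans AB BF.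
Qed.

Lemma hausdorff_pre_nincr d1 d2 A : (d1 <= d2)%R ->
  hausdorff_pre s d2 A <= hausdorff_pre s d1 A.
Proof.
move=> d12; apply: ereal_inf_le_tmp => _ [F [dF AF] <-].
by exists F => //; split => // k; rewrite (le_trans (dF k))// lee_fin.
Qed.

Lemma hausdorff_pre_ge0 delta A : 0 <= hausdorff_pre s delta A.
Proof. by apply: le_ereal_inf_tmp => _ [F _ <-]; exact: nneseries_ge0. Qed.

Lemma hausdorff_pre0 delta : hausdorff_pre s delta (set0 : set 'rV[R]_n) = 0.
Proof.
apply/eqP; rewrite eq_le hausdorff_pre_ge0 andbT.
apply: ereal_inf_lbound; exists (fun=> set0).
  by split=> // k; rewrite diam0 leNye.
by rewrite eseries0// => k _ _; exact: hausdorff_cost0.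
Qed.

Let gauge delta (A : set (g_sigma_algebraType [set: set 'rV[R]_n])) : \bar R :=
  if diam A <= delta%:E then hausdorff_cost s A else +oo.

Let gauge_ge0 delta A : 0 <= gauge delta A.
Proof. by rewrite /gauge; case: ifP. Qed.

Let hausdorff_preE delta : @hausdorff_pre s delta n = mu_ext (gauge delta).
Proof.
apply/funext => A; apply/eqP; rewrite eq_le; apply/andP; split.
  apply: le_ereal_inf_tmp => _ [F [_ AF] <-].
  have [dF|/existsNP[k dFk]] := pselect (forall k, diam (F k) <= delta%:E).
    apply: ereal_inf_lbound; exists F => //.
    by apply: eq_eseriesr => k _; rewrite /gauge dF.
  rewrite (eseries_pinfty (k := k)) ?leey//.
    by move=> j _; rewrite -ltNye (lt_le_trans _ (gauge_ge0 _ _)).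
  by rewrite /gauge; case: ifPn => // /dFk.
apply: le_ereal_inf_tmp => _ [F [dF AF] <-]; apply: ereal_inf_lbound; exists F.
  by split=> // k; exact: sub_sigma_algebra.
by apply: eq_eseriesr => k _; rewrite /gauge dF.
Qed.

Lemma hausdorff_pre_sigma_subadditive delta :
  sigma_subadditive (@hausdorff_pre s delta n).
Proof.
rewrite hausdorff_preE.
exact: (@mu_ext_sigma_subadditive _
  (g_sigma_algebraType [set: set 'rV[R]_n]) R _ (gauge_ge0 delta)).
Qed.

Lemma hausdorff0 : hausdorff s (set0 : set 'rV[R]_n) = 0.
Proof.
apply/eqP; rewrite eq_le; apply/andP; split.
  by apply: ge_ereal_sup => _ [delta _ <-]; rewrite hausdorff_pre0.
by apply: ereal_sup_ubound; exists 1%R => //=; rewrite hausdorff_pre0.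
Qed.

Lemma hausdorff_ge0 A : 0 <= hausdorff s A.
Proof.
apply: le_trans (hausdorff_pre_ge0 1 A) _.
by apply: ereal_sup_ubound; exists 1%R => /=.
Qed.

Lemma le_hausdorff A B : A `<=` B -> hausdorff s A <= hausdorff s B.
Proof.
move=> AB; apply: ge_ereal_sup => _ [delta delta0 <-].
apply: le_trans (le_hausdorff_pre delta AB) _.
by apply: ereal_sup_ubound; exists delta.
Qed.

Lemma hausdorff_sigma_subadditive : sigma_subadditive (@hausdorff s n).
Proof.
move=> F; apply: ge_ereal_sup => _ [delta delta0 <-].
apply: le_trans (hausdorff_pre_sigma_subadditive delta F) _.
apply: lee_nneseries => [k *|k *]; first exact: hausdorff_pre_ge0.
by apply: ereal_sup_ubound; exists delta.
Qed.

HB.instance Definition _ := isOuterMeasure.Build R 'rV[R]_n (@hausdorff s n)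
  hausdorff0 hausdorff_ge0 le_hausdorff hausdorff_sigma_subadditive.

Let hausdorff_pre_separated e delta A B : (delta < e)%R ->
  (forall x y, A x -> B y -> e <= enorm (x - y))%R ->
  hausdorff_pre s delta A + hausdorff_pre s delta B
    <= hausdorff_pre s delta (A `|` B).
Proof.
move=> de sep; apply: le_ereal_inf_tmp => _ [F [dF ABF] <-].
pose G C k := if `[< F k `&` C !=set0 >] then F k else set0.
have dG C k : diam (G C k) <= delta%:E.
  by rewrite /G; case: ifP => // _; rewrite diam0 leNye.
have sG C : C `<=` A `|` B -> C `<=` \bigcup_k G C k.
  move=> CAB x Cx; have [k _ Fkx] := ABF x (CAB x Cx).
  by exists k => //; rewrite /G; case: asboolP => // -[]; exists x.
have GF C : C `<=` A `|` B ->
    hausdorff_pre s delta C <= \sum_(k <oo) hausdorff_cost s (G C k).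
  by move=> CAB; apply: ereal_inf_lbound; exists (G C) => //; split; [exact: dG|exact: sG].
apply: le_trans (leeD (GF A _) (GF B _)) _ => //.
rewrite -nneseriesD//; apply: lee_nneseries => [k *|k *]; first exact: adde_ge0.
rewrite /G; case: asboolP => [[x [Fx Ax]]|_]; last first.
  by case: asboolP; rewrite ?hausdorff_cost0 add0e.
case: asboolP => [[y [Fy By]]|_]; last by rewrite hausdorff_cost0 adde0.
have : (enorm (x - y))%:E <= delta%:E.
  apply: le_trans (dF k); apply: ereal_sup_ubound.
  by exists x => //; exists y.
by rewrite lee_fin leNgt (lt_le_trans de)//; exact: sep. 
Qed.

Lemma hausdorff_separated e A B : (0 < e)%R ->
  (forall x y, A x -> B y -> e <= enorm (x - y))%R ->
  hausdorff s A + hausdorff s B <= hausdorff s (A `|` B).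
Proof.
move=> e0 sep; have [Hoo|Hoo] := eqVneq (hausdorff s (A `|` B)) +oo.
  by rewrite Hoo leey.
have {}Hoo C : C `<=` A `|` B -> hausdorff s C \is a fin_num.
  move=> CAB; rewrite ge0_fin_numE ?hausdorff_ge0//.
  by rewrite (le_lt_trans (le_hausdorff CAB))// ltey.
have fA : hausdorff s A \is a fin_num by exact: Hoo.
have fB : hausdorff s B \is a fin_num by exact: Hoo.
rewrite -leeBrDr//; apply: ge_ereal_sup => _ [d1 /= d10 <-].
have fd1 : hausdorff_pre s d1 A \is a fin_num.
  rewrite ge0_fin_numE ?hausdorff_pre_ge0//.
  apply: le_lt_trans (_ : _ <= hausdorff s A) _; last by rewrite -ge0_fin_numE ?hausdorff_ge0.
  by apply: ereal_sup_ubound; exists d1.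
rewrite leeBrDr// addeC -leeBrDr//; apply: ge_ereal_sup => _ [d2 /= d20 <-].
rewrite leeBrDr// addeC.
pose d := Num.min (Num.min d1 d2) (e / 2)%R.
have d0 : (0 < d)%R by rewrite !lt_min d10 d20 divr_gt0.
have dd1 : (d <= d1)%R by rewrite /d !ge_min lexx.
have dd2 : (d <= d2)%R by rewrite /d !ge_min lexx orbT.
have de : (d < e)%R by rewrite /d gt_min ltr_pdivrMr// ltr_pMr// ltr1n orbT.
apply: le_trans (leeD (hausdorff_pre_nincr _ dd1) (hausdorff_pre_nincr _ dd2)) _.
apply: le_trans (hausdorff_pre_separated de sep) _.
by apply: ereal_sup_ubound; exists d.
Qed.

Let caratheodory_halfspace (i : 'I_n) (r : R) :
  (@hausdorff s n).-caratheodory [set x : 'rV[R]_n | x ord0 i <= r]%R.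
Proof.
set M := [set x | _]; apply: le_caratheodory_measurable => X /=.
have [->|Xoo] := eqVneq (hausdorff s X) +oo; first by rewrite leey.
have sepi (C D : set 'rV[R]_n) (a b : R) : (a < b)%R ->
    (forall x, C x -> x ord0 i <= a)%R -> (forall x, D x -> b < x ord0 i)%R ->
    hausdorff s C + hausdorff s D <= hausdorff s (C `|` D).
  move=> ab Ca Db; apply: (@hausdorff_separated (b - a)%R).
    by rewrite subr_gt0.
  move=> x y Cx Dy; apply: le_trans (enorm_coord (x - y) i).
  rewrite !mxE distrC; apply: le_trans (ler_norm _).
  by rewrite lerB ?Ca// ltW// Db.
have fin C : C `<=` X -> hausdorff s C \is a fin_num.
  move=> CX; rewrite ge0_fin_numE ?hausdorff_ge0//.
  by rewrite (le_lt_trans (le_hausdorff CX))// ltey.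
pose t (k : nat) : R := (r + k.+1%:R^-1)%R.
have tS k : (t k.+1 < t k)%R by rewrite ltrD2l ltf_pV2 ?posrE// ltr_nat.
pose Y k := X `&` [set x : 'rV[R]_n | t k < x ord0 i]%R.
pose A k := X `&` [set x : 'rV[R]_n | t k.+2 < x ord0 i <= t k.+1]%R.
have YX k : Y k `<=` X by move=> x [].
have AX k : A k `<=` X by move=> x [].
have A0 k : 0 <= hausdorff s (A k) by exact: hausdorff_ge0.
have tlt k l : (k <= l)%N -> (t l <= t k)%R.
  by move=> kl; rewrite lerD2l lef_pV2 ?posrE// ler_nat.
have AY k : hausdorff s (A k) + hausdorff s (Y k) <= hausdorff s (Y k.+2).
  apply: le_trans (sepi _ _ (t k.+1) (t k) (tS k) _ _) _.
  - by move=> x [_ /= /andP[]].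
  - by move=> x [].
  apply: le_hausdorff => x [[Xx /andP[/= tx _]]|[Xx /= tx]]; split => //=.
  by rewrite (le_lt_trans _ tx)// tlt// -addn2 leq_addr.
pose S k := hausdorff s (Y k) + hausdorff s (Y k.+1).
have SA N : \sum_(0 <= k < N) hausdorff s (A k) <= S N.
  elim: N => [|N ih]; first by rewrite big_geq// adde_ge0// hausdorff_ge0.
  rewrite big_nat_recr//= addeC; apply: le_trans (leeD2l _ ih) _.
  by rewrite /S addeA [leRHS]addeC; apply: leeD2r; exact: AY.
have Aoo : \sum_(k <oo) hausdorff s (A k) < +oo.
  apply: (@le_lt_trans _ _ (hausdorff s X + hausdorff s X)); last first.
    by rewrite lte_add_pinfty// ltey.
  apply: lime_le; first by apply: is_cvg_nneseries => k _ _.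
  apply: nearW => N; apply: le_trans (SA N) _.
  by apply: leeD; exact: le_hausdorff.
have cover k : X `&` ~` M `<=` Y k.+1 `|` \bigcup_(j in ~` `I_k) A j.
  move=> x [Xx] /negP; rewrite -ltNge => rx.
  have [txk|xtk] := ltP (t k.+1) (x ord0 i); first by left.
  have ex_m : exists m, (t m < x ord0 i)%R by exact: ltr_add_invr.
  right; case: (ex_minnP ex_m) => m tm mmin.
  have km : (k.+1 < m)%N.
    rewrite ltnNge; apply/negP => /tlt /le_lt_trans/(_ tm).
    by rewrite ltNge xtk.
  case: m km tm mmin => [//|[//|j]] kj tm mmin.
  exists j; first by apply/negP; rewrite -leqNgt.
  split=> //=; rewrite tm /= leNgt; apply/negP => /mmin.
  by rewrite ltnn.
have main k : hausdorff s (X `&` M) + hausdorff s (X `&` ~` M) <=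
    hausdorff s X + \sum_(k <= j <oo) hausdorff s (A j).
  have XMY : hausdorff s (X `&` M) + hausdorff s (Y k.+1) <= hausdorff s X.
    apply: le_trans (sepi _ _ r (t k.+1) _ _ _) _.
    - by rewrite ltrDl invr_gt0.
    - by move=> x [].
    - by move=> x [].
    by apply: le_hausdorff => x [[]|[]].
  apply: le_trans (leeD2r _ XMY); rewrite -addeA leeD2l//.
  apply: le_trans (le_hausdorff (@cover k)) _.
  apply: le_trans (outer_measureU2 (@hausdorff s n) _ _) _.
  apply: leeD2l; exact: (outer_measure_sigma_subadditive_tail (@hausdorff s n)).
rewrite -[leRHS]adde0.
have tail0 := nneseries_tail_cvg Aoo (fun k _ => A0 k).
have cv : hausdorff s X + \sum_(k <= j <oo) hausdorff s (A j) @[k --> \oo]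
    --> hausdorff s X + 0.
  apply: cvgeD; [exact: fin_num_adde_defl|exact: cvg_cst|exact: tail0].
rewrite -(cvg_lim _ cv)//; apply: lime_ge; first by apply/cvg_ex; eexists; exact: cv.
exact: nearW.
Qed.

Let caratheodory_coord (i : 'I_n) :
  measurable_fun [set: caratheodory_type (@hausdorff s n)]
    (fun x : 'rV[R]_n => x ord0 i : R).
Proof.
apply: (measurability _ (RGenOInfty.measurableE R)) => _ [_ [r ->] <-]; rewrite setTI.
rewrite (_ : _ @^-1` _ = ~` [set x : 'rV[R]_n | x ord0 i <= r]%R).
  by apply: caratheodory_measurable_setC; exact: caratheodory_halfspace.
by apply/seteqP; split=> x /=; rewrite in_itv/= andbT ltNge => /negP.
Qed.

Lemma hausdorff_caratheodory (A : set 'rV[R]_n) :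
  measurable A -> (@hausdorff s n).-caratheodory A.
Proof.
move=> mA; rewrite -[A]setTI.
exact: (@measurable_fun_rVP R n _
  (caratheodory_type (@hausdorff s n)) id caratheodory_coord).
Qed.

Let hausdorff_semi_sigma_additive : semi_sigma_additive (@hausdorff s n).
Proof.
move=> F mF tF mUF; apply: (@caratheodory_measure_sigma_additive R _
  (@hausdorff s n)) => //.
- by move=> k; exact: hausdorff_caratheodory.
- exact: hausdorff_caratheodory.
Qed.

HB.instance Definition _ := isMeasure.Build _ _ _ (@hausdorff s n)
  hausdorff0 hausdorff_ge0 hausdorff_semi_sigma_additive.

End fixed.
End hausdorff.

Section hypersurface.
Variable R : realType.

Definition basis_rV n (i : 'I_n) : 'rV[R]_n := delta_mx ord0 i.

Definition C2_on n (W : set 'rV[R]_n) (f : 'rV[R]_n -> R) : Prop :=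
  forall x, W x ->
    {for x, continuous f} /\
    forall i, [/\ derivable f x (basis_rV i),
      {for x, continuous ('D_(basis_rV i) f)} &
      forall j, derivable ('D_(basis_rV i) f) x (basis_rV j) /\
        {for x, continuous ('D_(basis_rV j) ('D_(basis_rV i) f))}].

(* A C^2 embedded hypersurface, possibly with boundary: near each of its points
   it is the graph, over some coordinate hyperplane, of a C^2 function [phi] on a
   C^2 domain [0 <= h], where 0 is a regular value of [h]. The boundary
   corresponds to [h = 0]; near an interior point one can take [h = 1]. *)
Definition C2_hypersurface d (S : set 'rV[R]_d) : Prop :=
  forall p, S p ->
    exists (k : 'I_d) (U : set 'rV[R]_d) (W : set 'rV[R]_d.-1)
           (phi h : 'rV[R]_d.-1 -> R),
      [/\ open U, U p, open W & forall x, U x -> W (col' k x)] /\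
      [/\ C2_on W phi, C2_on W h,
        forall y, W y -> h y = 0 -> exists i, 'D_(basis_rV i) h y != 0 &
        forall x, U x ->
          (S x <-> x ord0 k = phi (col' k x) /\ 0 <= h (col' k x))].

Definition hyperplane d (H : set 'rV[R]_d) : Prop :=
  exists (a : 'rV[R]_d) (b : R), a != 0 /\ H = [set x | dotv a x = b].

(* For connected [S] this says that [S] is not contained in a hyperplane. When
   [S] is disconnected the condition has to be imposed on a component: on two
   discs in parallel hyperplanes the Mizohata-Takeuchi inequality holds without
   loss, because the modulus of the extension of a function supported on a single
   disc is constant along the normal direction. A nonempty compact hypersurface
   without boundary satisfies the condition automatically. *)
Definition not_in_hyperplane d (S : set 'rV[R]_d) : Prop :=
  exists2 p, S p &
    forall H, hyperplane H -> ~ (connected_component S p `<=` H).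

End hypersurface.

Section extension.
Variables (R : realType) (d : nat).
Implicit Types (S : set 'rV[R]_d) (f : 'rV[R]_d -> R[i]) (w : 'rV[R]_d -> R).

(* Integrating over [S] against this measure is integrating against the surface
   measure of the hypersurface [S]. *)
Definition surface_measure : {measure set 'rV[R]_d -> \bar R} :=
  @hausdorff R d.-1 d.

Definition cexpi (t : R) : R[i] := Complex (cos t) (sin t).

Definition extension S f (x : 'rV[R]_d) : R[i] :=
  let F z := cexpi (- (2 * pi * dotv x z)) * f z in
  Complex (\int[surface_measure]_(z in S) complex.Re (F z))
          (\int[surface_measure]_(z in S) complex.Im (F z)).

Definition L2normsq S f : \bar R :=
  (\int[surface_measure]_(z in S) (Normc.normc (f z) ^+ 2)%:E)%E.

Definition in_L2 S f : Prop :=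
  [/\ measurable_fun S (fun z => complex.Re (f z)),
      measurable_fun S (fun z => complex.Im (f z)) &
      (L2normsq S f < +oo)%E].

Definition line_integral w (a v : 'rV[R]_d) : \bar R :=
  (\int[lebesgue_measure]_t (w (a + (t : R) *: v))%:E)%E.

Definition sup_line_integral w : \bar R :=
  ereal_sup [set line_integral w a v |
    a in [set: 'rV[R]_d] & v in [set v : 'rV[R]_d | enorm v = 1]].

Definition eball (r : R) : set 'rV[R]_d := [set x | enorm x < r].

End extension.

(* Main.v *)
(* Following Cairo, choose points x_0 and x_i = x_0 + eta_i (1 <= i <= m, with
   m ~ log r) on S, let f be the sum of the normalised indicators of the caps of
   radius ~ 1/r around them, and let w be the Riesz product
   prod_i (1 + cos (2 pi eta_i . x)) cut off to a cube of side ~ r.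

   On this cube |Ef|^2 is close to |1 + sum_i e(eta_i . x)|^2, and each factor
   of w is correlated with the corresponding exponential, so that the integral
   of |Ef|^2 w is ~ m^2 r^d. Here |z|^2 >= 2 lam Re z - lam^2 replaces the
   Cauchy-Schwarz inequality, and integrating along one coordinate axis
   suffices. Since ||f||^2 ~ m r^(d-1), it remains to bound the integrals of w
   along lines by O(r).

   Along a line of direction v, w is a one-dimensional Riesz product with
   frequencies s_i = v . eta_i. If these are lacunary, the integral over a
   segment is its length up to an error O(3^m / tau), tau being the lacunarity
   gap. The points eta_i are taken at the geometric times t_i = t_0 q^i on a
   curve in S given by t -> t u + (t^3, t^4, ...), where the second-order term
   of S in the direction u does not vanish. Then s_i is a combination of
   monomials t_i^p with distinct exponents p, which, uniformly in v, is
   dominated by one of them except for O(d^2) indices i; the exceptional factors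
   of w are bounded by 2. As tau >= C^(-m), taking m = c log r makes the error
   O(r).

   A point where the second-order term does not vanish exists, since otherwise
   S is locally contained in hyperplanes, and by connectedness a component is
   contained in a single one. *)
Require Import Defs.
From mathcomp Require Import all_boot all_order all_algebra.
From mathcomp Require Import all_classical all_reals all_analysis.
From mathcomp Require Import measurable_realfun complex ring lra.
Set Implicit Arguments.
Unset Strict Implicit.
Unset Printing Implicit Defensive.
Import Order.TTheory GRing.Theory Num.Theory.
Import numFieldNormedType.Exports.
Local Open Scope classical_set_scope.
Local Open Scope ring_scope.

(** * Riesz products on a segment *)

(** The points are fixed once while the line is arbitrary, so for some [i] the terms of [v . eta_i]
    may cancel. Each such [i] costs a factor 2 in the supremum, so their number must be bounded
    independently of [v] and [r]. This requires that no unit vector [v] make all coefficients of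
    [v . eta_i], as a polynomial in [t_i], small. On the curve [t^(j+3)] carries the tangential
    component [v_j + v_k G_j], with [G] the gradient of the graph function at the base point, and
    [t^2] carries the normal component [v_k] times the second-order coefficient. This is where
    curvature enters: on a flat piece a normal [v] would make every coefficient vanish.

    Geometric times bring the gap [tau] down exponentially in the number of points, just as the
    error [3^m] grows exponentially; keeping their quotient below [r] is what limits the
    construction to about [log r] points. *)

Section lacunary.
Variable R : realType.

(** The head dominates all that follows, so lists run from the largest frequency down. The factor 2
    allows for second harmonics: adding to [x] any combination of later terms with coefficients in
    [-2, 2] leaves a frequency of size at least [tau]. *)
Fixpoint lacunary (tau : R) (s : seq R) : bool :=
  if s is x :: s' then (tau + 2 * \sum_(y <- s') `|y| <= `|x|) && lacunary tau s'
  else true.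

End lacunary.

Section riesz_product.
Variables (R : realType) (a b : R) (ab : a < b).
Local Notation J := (Rintegral (@lebesgue_measure R) `[a, b]%classic).

Lemma continuous_segment_integrable (f : R -> R) : continuous f ->
  (@lebesgue_measure R).-integrable `[a, b]%classic (EFin \o f).
Proof.
move=> cf; apply: continuous_compact_integrable; first exact: segment_compact.
exact: continuous_subspaceT.
Qed.

Lemma continuous_affine (s t : R) : continuous (fun x : R => s * x + t).
Proof.
move=> x; apply: cvgD; last exact: cvg_cst.
by apply: cvgM; [exact: cvg_cst|exact: cvg_id].
Qed.

Lemma continuous_cos_affine (s t : R) : continuous (fun x : R => cos (s * x + t)).
Proof.
move=> x; apply: continuous_comp; [exact: continuous_affine|].
exact: continuous_cos.
Qed.

Lemma Rintegral_cos_affine (s t tau : R) : 0 < tau -> tau <= `|s| ->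
  `|J (fun x => cos (s * x + t))| <= 2 / tau.
Proof.
move=> tau0 taus.
have s0 : s != 0 by rewrite -normr_gt0 (lt_le_trans tau0).
pose F x := s^-1 * sin (s * x + t).
have dF (x : R) : is_derive x (1 : R) F (cos (s * x + t)).
  rewrite /F; apply: is_derive_eq.
  by rewrite /GRing.scale /=; field.
have cF : continuous F.
  move=> x; apply: cvgM; first exact: cvg_cst.
  by apply: continuous_comp; [exact: continuous_affine|exact: continuous_sin].
have -> : J (fun x => cos (s * x + t)) = F b - F a.
  rewrite /Rintegral (@continuous_FTC2 _ _ F)//.
  - by apply: continuous_subspaceT; exact: continuous_cos_affine.
  - split; first by move=> x _; have [] := dF x.
    + exact/cvg_at_right_filter/cF.
    + exact/cvg_at_left_filter/cF.
  - by move=> x _; rewrite derive1E; have [_] := dF x.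
rewrite /F -mulrBr normrM normfV.
apply: (@le_trans _ _ (`|s|^-1 * 2)); last first.
  by rewrite mulrC ler_pM2l// lef_pV2 ?posrE ?normr_gt0.
rewrite ler_wpM2l// ?invr_ge0//.
apply: le_trans (ler_normB _ _) _.
have sb u : `|sin u| <= 1 :> R by rewrite ler_norml sin_geN1 sin_le1.
by rewrite (natrD _ 1 1) lerD.
Qed.

Lemma Rintegral_lin (c : R) (f g : R -> R) : continuous f -> continuous g ->
  J (fun t => c * f t + g t) = c * J f + J g.
Proof.
move=> cf cg.
have icf : (@lebesgue_measure R).-integrable `[a, b]%classic
    (EFin \o (fun t => c * f t)).
  by apply: continuous_segment_integrable => x; apply: cvgM; [exact: cvg_cst|exact: cf].
transitivity (J (fun t => c * f t) + J g).
  by apply: RintegralD => //; exact: continuous_segment_integrable.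
by congr (_ + _); apply: RintegralZl => //; exact: continuous_segment_integrable.
Qed.

Section factors.
Variables (I : Type) (s th al be ga : I -> R).
Hypotheses (al1 : forall i, `|al i| <= 1) (be1 : forall i, `|be i| <= 1)
  (ga1 : forall i, `|ga i| <= 1).

(** A Riesz factor [1 + cos] is the case (1, 1, 0) of [(al, be, ga)]. The second harmonic is present
    because [cos * (1 + cos)], with coefficients (1/2, 1, 1/2), must be integrated too. *)
Definition trig_factor (i : I) (t : R) : R :=
  al i + be i * cos (s i * t + th i) + ga i * cos (2 * (s i * t + th i)).

Lemma continuous_trig_factor i : continuous (trig_factor i).
Proof.
move=> x; apply: cvgD; first apply: cvgD; first exact: cvg_cst.
  by apply: cvgM; [exact: cvg_cst|exact: continuous_cos_affine].
apply: cvgM; first exact: cvg_cst.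
apply: continuous_comp; last exact: continuous_cos.
by apply: cvgM; [exact: cvg_cst|exact: continuous_affine].
Qed.

Lemma continuous_trig_prod l : continuous (fun t => \prod_(i <- l) trig_factor i t).
Proof.
elim: l => [|i l ih] x.
  rewrite (_ : (fun t => _) = cst 1); first exact: cvg_cst.
  by apply/funext => t; rewrite big_nil.
rewrite (_ : (fun t => _) = (fun t => trig_factor i t * \prod_(j <- l) trig_factor j t)).
  by apply: cvgM; [exact: continuous_trig_factor|exact: ih].
by apply/funext => t; rewrite big_cons.
Qed.

Let cosM (x y : R) : cos x * cos y = 2^-1 * cos (x + y) + 2^-1 * cos (x - y).
Proof. by rewrite cosD cosB; field. Qed.

Let cP (lam mu : R) (l : seq I) :
  continuous (fun t : R => cos (lam * t + mu) * \prod_(i <- l) trig_factor i t).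
Proof.
by move=> x; apply: cvgM; [exact: continuous_cos_affine|exact: continuous_trig_prod].
Qed.

Let cZ (c : R) (f : R -> R) : continuous f -> continuous (fun t => c * f t).
Proof. by move=> cf x; apply: cvgM; [exact: cvg_cst|exact: cf]. Qed.

Let cA (f g : R -> R) : continuous f -> continuous g -> continuous (fun t => f t + g t).
Proof. by move=> cf cg x; apply: cvgD; [exact: cf|exact: cg]. Qed.

Variables (tau : R) (tau0 : 0 < tau).

Let le_normM (c C x B : R) : `|c| <= C -> `|x| <= B -> `|c * x| <= C * B.
Proof. by move=> cC xB; rewrite normrM ler_pM.
Qed.

(** Expanding the first factor gives cosines of frequencies [lam], [lam +- s i] and [lam +- 2 s i]
    with coefficients of total size at most 3, whence the power of 3. Each new frequency still
    exceeds twice the remaining sum by [tau], so the induction runs over all [lam] and [mu]. *)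
Lemma Rintegral_cos_trig_prod l (lam mu : R) :
  tau + 2 * \sum_(i <- l) `|s i| <= `|lam| ->
  `|J (fun t => cos (lam * t + mu) * \prod_(i <- l) trig_factor i t)|
     <= 3 ^+ size l * (2 / tau).
Proof.
elim: l lam mu => [|i l ih] lam mu.
  rewrite big_nil mulr0 addr0 expr0 mul1r => taul.
  under eq_Rintegral do rewrite big_nil mulr1.
  exact: Rintegral_cos_affine.
rewrite big_cons => taul.
pose P := fun t => \prod_(j <- l) trig_factor j t.
have E t : cos (lam * t + mu) * \prod_(j <- i :: l) trig_factor j t =
   al i * (cos (lam * t + mu) * P t) +
   (be i / 2 * (cos ((lam + s i) * t + (mu + th i)) * P t) +
   (be i / 2 * (cos ((lam - s i) * t + (mu - th i)) * P t) +
   (ga i / 2 * (cos ((lam + 2 * s i) * t + (mu + 2 * th i)) * P t) +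
    ga i / 2 * (cos ((lam - 2 * s i) * t + (mu - 2 * th i)) * P t)))).
  rewrite big_cons -/(P t) /trig_factor.
  have /= := cosM (lam * t + mu) (s i * t + th i).
  have /= := cosM (lam * t + mu) (2 * (s i * t + th i)).
  rewrite (_ : lam * t + mu + (s i * t + th i) = (lam + s i) * t + (mu + th i)); last by ring.
  rewrite (_ : lam * t + mu - (s i * t + th i) = (lam - s i) * t + (mu - th i)); last by ring.
  rewrite (_ : lam * t + mu + 2 * (s i * t + th i) =
    (lam + 2 * s i) * t + (mu + 2 * th i)); last by ring.
  rewrite (_ : lam * t + mu - 2 * (s i * t + th i) =
    (lam - 2 * s i) * t + (mu - 2 * th i)); last by ring.
  set x := cos _; set y := cos _; set x1 := cos _; set x2 := cos _.
  set z := cos _; set x3 := cos _; set x4 := cos _ => h1 h2.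
  by rewrite mulrA mulrDr mulrDr (mulrCA _ (be i)) (mulrCA _ (ga i)) h1 h2; field.
rewrite (_ : J _ = J (fun t => al i * (cos (lam * t + mu) * P t) +
   (be i / 2 * (cos ((lam + s i) * t + (mu + th i)) * P t) +
   (be i / 2 * (cos ((lam - s i) * t + (mu - th i)) * P t) +
   (ga i / 2 * (cos ((lam + 2 * s i) * t + (mu + 2 * th i)) * P t) +
    ga i / 2 * (cos ((lam - 2 * s i) * t + (mu - 2 * th i)) * P t)))))); last first.
  by apply: eq_Rintegral => t _; exact: E.
rewrite !Rintegral_lin//.
2-9: by do ?[apply: cA|apply: cZ|exact: cP].
rewrite (_ : J (fun t => ga i / 2 * _) = ga i / 2 * J (fun t =>
    cos ((lam - 2 * s i) * t + (mu - 2 * th i)) * P t)); last first.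
  by apply: RintegralZl => //; apply: continuous_segment_integrable; exact: cP.
set B := 3 ^+ size l * (2 / tau).
have S0 : 0 <= \sum_(j <- l) `|s j| by apply: sumr_ge0.
have b0 : `|J (fun t => cos (lam * t + mu) * P t)| <= B.
  by apply: ih; apply: le_trans taul; rewrite lerD2l ler_pM2l// lerDr.
have tri (x : R) : `|lam| <= `|lam + x| + `|x|.
  by rewrite -{1}(addrK x lam); exact: ler_normB.
have b1 : `|J (fun t => cos ((lam + s i) * t + (mu + th i)) * P t)| <= B.
  by apply: ih; have := tri (s i); have := normr_ge0 (s i); lra.
have b2 : `|J (fun t => cos ((lam - s i) * t + (mu - th i)) * P t)| <= B.
  by apply: ih; have := tri (- s i); rewrite normrN; have := normr_ge0 (s i); lra.
have n2 : `|2 * s i| = 2 * `|s i| by rewrite normrM ger0_norm.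
have b3 : `|J (fun t => cos ((lam + 2 * s i) * t + (mu + 2 * th i)) * P t)| <= B.
  by apply: ih; have := tri (2 * s i); rewrite n2; lra.
have b4 : `|J (fun t => cos ((lam - 2 * s i) * t + (mu - 2 * th i)) * P t)| <= B.
  by apply: ih; have := tri (- (2 * s i)); rewrite normrN n2; lra.
have B0 : 0 <= B by rewrite mulr_ge0 ?exprn_ge0// divr_ge0// ltW.
have half (c : R) : `|c| <= 1 -> `|c / 2| <= 2^-1.
  by move=> c1; have h : `|2^-1| = 2^-1 :> R; [exact: ger0_norm|rewrite normrM h; lra].
move: (le_normM (al1 i) b0) (le_normM (half _ (be1 i)) b1)
  (le_normM (half _ (be1 i)) b2) (le_normM (half _ (ga1 i)) b3)
  (le_normM (half _ (ga1 i)) b4) => e0 e1 e2 e3 e4.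
have -> : 3 ^+ size (i :: l) * (2 / tau) = 3 * B by rewrite /= exprS -mulrA.
do 4 (apply: le_trans (ler_normD _ _) _; rewrite -?lerBrDl).
lra.
Qed.

(** The constant term of the first factor leaves the shorter product; the two harmonics cost at most
    [3 ^ k * (2 / tau)] each, [k] being the length of the tail. The errors add up as
    [(3 ^ k - 1) + 2 * 3 ^ k = 3 ^ k.+1 - 1]. *)
Lemma Rintegral_trig_prod l : lacunary tau (map s l) ->
  `|J (fun t => \prod_(i <- l) trig_factor i t) - (b - a) * \prod_(i <- l) al i|
     <= (3 ^+ size l - 1) * (2 / tau).
Proof.
elim: l => [_|i l ih].
  rewrite expr0 subrr mul0r big_nil mulr1.
  under eq_Rintegral do rewrite big_nil.
  rewrite Rintegral_cst//= lebesgue_measure_itv/= lte_fin ab/= mul1r.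
  by rewrite subrr normr0.
rewrite [map _ _]/= => /andP[]; rewrite big_map => taui /ih {}ih.
pose P := fun t => \prod_(j <- l) trig_factor j t.
have E t : \prod_(j <- i :: l) trig_factor j t =
   al i * P t + (be i * (cos (s i * t + th i) * P t) +
    ga i * (cos ((2 * s i) * t + (2 * th i)) * P t)).
  by rewrite big_cons -/(P t) /trig_factor mulrDr (mulrA 2); ring.
rewrite (_ : J _ = J (fun t =>
   al i * P t + (be i * (cos (s i * t + th i) * P t) +
    ga i * (cos ((2 * s i) * t + (2 * th i)) * P t)))); last first.
  by apply: eq_Rintegral => t _; exact: E.
have cPP : continuous P by exact: continuous_trig_prod.
rewrite !Rintegral_lin//.
2-4: by do ?[apply: cA|apply: cZ|exact: cP].
rewrite (_ : J (fun t => ga i * _) = ga i * J (fun t =>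
    cos ((2 * s i) * t + (2 * th i)) * P t)); last first.
  by apply: RintegralZl => //; apply: continuous_segment_integrable; exact: cP.
have n2 : `|2 * s i| = 2 * `|s i| by rewrite normrM ger0_norm.
have b1 := Rintegral_cos_trig_prod (th i) taui.
have b2 : `|J (fun t => cos ((2 * s i) * t + (2 * th i)) * P t)| <= 3 ^+ size l * (2 / tau).
  by apply: Rintegral_cos_trig_prod; rewrite n2; have := normr_ge0 (s i); lra.
rewrite big_cons.
set A := \prod_(j <- l) _ in ih *.
set K := 2 / tau in ih b1 b2 *.
have -> : forall x y z : R, al i * x + (y + z) - (b - a) * (al i * A) =
  al i * (x - (b - a) * A) + (y + z) by move=> *; ring.
move: (le_normM (al1 i) ih) (le_normM (be1 i) b1) (le_normM (ga1 i) b2) => e0 e1 e2.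
do 2 (apply: le_trans (ler_normD _ _) _; rewrite -?lerBrDl).
rewrite /= exprS; lra.
Qed.


End factors.
End riesz_product.

(** * Lacunarity of sums of monomials *)

Section geometric.
Variables (R : realType) (q : R) (M : nat -> R).
Hypotheses (q0 : 0 < q) (q64 : 64 * q <= 1).
Hypotheses (M0 : forall i, 0 <= M i) (MS : forall i, M i.+1 <= q * M i).

Lemma geometric_decay i j : (i < j)%N -> M j <= q * M i.
Proof.
elim: j => // j ih; rewrite ltnS leq_eqVlt => /orP[/eqP->//|/ih h].
apply: le_trans (MS j) _; rewrite ler_pM2l//; apply: le_trans h _.
by rewrite ler_piMl//; have := q64; lra.
Qed.

Lemma geometric_tail i l : path ltn i l -> \sum_(j <- l) M j <= 2 * q * M i.
Proof.
elim: l i => [|j l ih] i /=.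
  by rewrite big_nil => _; rewrite !mulr_ge0// ltW.
move=> /andP[ij /ih]; rewrite big_cons => h.
have Mj := geometric_decay ij.
apply: le_trans (lerD (lexx _) h) _.
have -> : M j + 2 * q * M j = (1 + 2 * q) * M j by ring.
apply: (@le_trans _ _ (2 * M j)); first by rewrite ler_wpM2r//; have := q64; lra.
by rewrite -mulrA ler_pM2l.
Qed.

(** By geometric decay of [M], twice the sum of the later [|s j| <= 2 M j] is at most
    [8 q M i <= M i / 8]; adding [tau <= M i / 8] gives at most [M i / 4 <= |s i|]. *)
Lemma lacunary_geometric (s : nat -> R) (tau : R) l : sorted ltn l ->
  (forall i, i \in l -> [/\ M i / 4 <= `|s i| & 8 * tau <= M i]) ->
  (forall i, `|s i| <= 2 * M i) ->
  lacunary tau (map s l).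
Proof.
elim: l => // i l ih /= pl hl sM; apply/andP; split; last first.
  apply: ih => //; first exact: path_sorted pl.
  by move=> j jl; apply: hl; rewrite inE jl orbT.
have [h1 h2] := hl i (mem_head _ _).
apply: le_trans h1; rewrite big_map.
have : \sum_(j <- l) `|s j| <= 2 * \sum_(j <- l) M j.
  by rewrite big_distrr /=; apply: ler_sum.
have := geometric_tail pl; have := ler_wpM2r (M0 i) q64; nra.
Qed.
End geometric.

Section monomials.
Variables (R : realType) (P : nat) (A : 'I_P -> R) (t0 q c0 : R).
Hypotheses (t00 : 0 < t0) (t01 : t0 <= 1) (q0 : 0 < q).
Hypotheses (qP : 64 * P%:R ^+ 2 * q <= 1).
Hypotheses (c00 : 0 < c0) (Ac0 : exists p, c0 <= `|A p|).
Local Notation t i := (t0 * q ^+ i).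
Local Notation T p i := (`|A p| * (t0 * q ^+ i) ^+ p.+1).
Local Notation M i := (\sum_(p < P) `|A p| * (t0 * q ^+ i) ^+ p.+1).

Let P0 : (0 < P)%N.
Proof. by have [p _] := Ac0; apply: leq_ltn_trans (ltn_ord p). Qed.

Let P1 : 1 <= P%:R :> R. Proof. by rewrite ler1n. Qed.

Let q64 : 64 * q <= 1.
Proof.
apply: le_trans qP; rewrite -mulrA ler_pM2l// ler_peMl// ?(ltW q0)//.
by rewrite expr_ge1.
Qed.

Let tgt0 i : 0 < t i. Proof. by rewrite mulr_gt0// exprn_gt0. Qed.

Let T0 p i : 0 <= T p i.
Proof. by rewrite mulr_ge0// exprn_ge0// ltW. Qed.

Let TD p i k : T p (i + k)%N = q ^+ (p.+1 * k) * T p i.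
Proof. by rewrite exprD (mulrA t0) exprMn -exprM (mulnC k) (mulrA `|A p|) mulrC. Qed.

Let M0 i : 0 <= M i. Proof. by apply: sumr_ge0 => p _; exact: T0. Qed.

Let MS i : M i.+1 <= q * M i.
Proof.
rewrite big_distrr /=; apply: ler_sum => p _.
rewrite -addn1 TD muln1 exprS -mulrA ler_pM2l// ler_piMl//.
by rewrite exprn_ile1// ?ltW//; have := q64; lra.
Qed.

(** Some coefficient is at least [c0], but it is not known which. As [t i <= 1], the highest
    exponent [P] is the worst case. *)
Lemma monomial_sum_ge N i : (i <= N)%N -> c0 * t N ^+ P <= M i.
Proof.
move=> iN; have [p Ap] := Ac0.
apply: (@le_trans _ _ (T p i)); last first.
  by rewrite (bigD1 p)//= lerDl sumr_ge0.
have q1 : q <= 1 by have := q64; lra.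
have tNi : t N <= t i by rewrite ler_pM2l//; apply: ler_wiXn2l => //; exact: ltW.
have ti1 : t i <= 1 by rewrite mulr_ile1// ?exprn_ge0 ?exprn_ile1// ltW.
apply: ler_pM => //; [exact: ltW|by rewrite exprn_ge0// ltW|].
apply: (@le_trans _ _ (t i ^+ P)); first by apply: lerXn2r => //; rewrite nnegrE ltW.
by apply: ler_wiXn2l => //; exact: ltW.
Qed.

(** The ratio [T p' / T p] is proportional to [t ^ (p' - p)] and drops at least by the factor
    [1 / q] from [i] to [j]. It cannot stay in the window from [1 / (4 P)] to [4 P], whose endpoints
    differ by the factor [16 P^2 < 1 / q]. *)
Lemma comparable_monomials_once i j (p p' : 'I_P) : (i < j)%N -> (p < p')%N ->
  0 < T p i -> T p' i <= 4 * P%:R * T p i -> T p j <= 4 * P%:R * T p' j -> False.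
Proof.
move=> ij pp' Tp h1; rewrite -(subnKC (ltnW ij)); set k := (j - i)%N.
have k0 : (0 < k)%N by rewrite subn_gt0.
rewrite !TD => h2.
have q1 : q <= 1 by have := q64; lra.
have : q ^+ (p.+1 * k) * T p i <= (16 * P%:R ^+ 2 * q) * (q ^+ (p.+1 * k) * T p i).
  apply: le_trans h2 _.
  apply: (@le_trans _ _ (4 * P%:R * (q ^+ (p'.+1 * k) * (4 * P%:R * T p i)))).
    by rewrite ler_pM2l ?mulr_gt0// ?ltr0n// ler_pM2l// exprn_gt0.
  have -> : 4 * P%:R * (q ^+ (p'.+1 * k) * (4 * P%:R * T p i)) =
     16 * P%:R ^+ 2 * (q ^+ (p'.+1 * k) * T p i) by ring.
  rewrite -[leRHS]mulrA ler_pM2l ?mulr_gt0// ?exprn_gt0 ?ltr0n//.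
  rewrite [leRHS]mulrA ler_pM2r// -exprS; apply: ler_wiXn2l => //; first exact: ltW.
  apply: (@leq_trans (p.+2 * k)%N); last by rewrite leq_mul2r ltnS pp' orbT.
  by rewrite (mulSn p.+1) -add1n leq_add2r.
rewrite -[leLHS]mul1r ler_pM2r; last by rewrite mulr_gt0// exprn_gt0.
by have := qP; nra.
Qed.

Variables (s : nat -> R).
Hypothesis (sM : forall i, `|s i - \sum_(p < P) A p * t i ^+ p.+1| <= M i / 4).

Definition small_index i := `|s i| < M i / 4.

(** If the largest term [T p] is at least [4 P] times every other one, the others sum to at most
    [T p / 4], and together with the tolerance [M i / 4] they cannot bring [|s i|] below [M i / 4].
    So a second term is within a factor [4 P] of the largest. *)
Lemma small_index_comparable i : small_index i ->
  exists pp : 'I_P * 'I_P, [/\ (pp.1 < pp.2)%N, 0 < T pp.1 i,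
    T pp.2 i <= 4 * P%:R * T pp.1 i & T pp.1 i <= 4 * P%:R * T pp.2 i].
Proof.
rewrite /small_index => small.
have [p _ pmax0] := @arg_maxP _ _ 'I_P (Ordinal P0) xpredT (fun p => T p i) isT.
have pmax p' : T p' i <= T p i := pmax0 p' isT.
have PT : 1 <= 4 * P%:R :> R by have := P1; lra.
have Mgt0 : 0 < M i.
  by apply: lt_le_trans (monomial_sum_ge (leqnn i)); rewrite mulr_gt0// exprn_gt0.
have Tp : 0 < T p i.
  rewrite lt_neqAle T0 andbT; apply/eqP => Tp0.
  by move: Mgt0; rewrite big1 ?ltxx// => p' _; apply/eqP; rewrite eq_le T0 andbT Tp0 pmax.
have [/existsP[p' /andP[pp' hp']]|] :=
    boolP [exists p' : 'I_P, (p' != p) && (T p i <= 4 * P%:R * T p' i)].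
  have hp : T p' i <= 4 * P%:R * T p i.
    by apply: le_trans (pmax p') _; rewrite ler_peMl.
  have [lt|lt|/val_inj eq] := ltngtP p p'; last by rewrite eq eqxx in pp'.
    by exists (p, p').
  exists (p', p); split => //=.
  rewrite lt_neqAle T0 andbT; apply/eqP => Tp0; move: Tp.
  by rewrite ltNge (le_trans hp')// -Tp0 mulr0.
rewrite negb_exists => /forallP hp; exfalso.
have hp' p' : p' != p -> 4 * P%:R * T p' i <= T p i.
  by move=> pp'; move: (hp p'); rewrite pp' /= -ltNge => /ltW.
set S := \sum_(p' < P | p' != p) T p' i.
have S4 : 4 * S <= T p i.
  have : P%:R * (4 * S) <= P%:R * T p i.
    rewrite mulrA (mulrC P%:R) big_distrr /=.
    apply: (@le_trans _ _ (\sum_(p' < P | p' != p) T p i)); first exact: ler_sum.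
    rewrite sumr_const -[leLHS]mulr_natl ler_wpM2r ?T0// ler_nat.
    by apply: leq_trans (max_card _) _; rewrite card_ord.
  by rewrite ler_pM2l// ltr0n.
have ME : M i = T p i + S by rewrite (bigD1 p).
have := sM i; rewrite (bigD1 p)//= => h.
set S' := \sum_(p' < P | p' != p) A p' * _ in h.
have S'S : `|S'| <= S.
  apply: le_trans (ler_norm_sum _ _ _) _; apply: ler_sum => p' _.
  by rewrite normrM (ger0_norm (exprn_ge0 _ (ltW (tgt0 i)))).
have : `|A p * t i ^+ p.+1| <= `|s i| + `|S'| + M i / 4.
  have -> : A p * t i ^+ p.+1 = s i - S' - (s i - (A p * t i ^+ p.+1 + S')) by ring.
  apply: le_trans (ler_normB _ _) _; apply: lerD => //; exact: ler_normB.
rewrite normrM (ger0_norm (exprn_ge0 _ (ltW (tgt0 i)))).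
by move: small; rewrite ME; lra.
Qed.

(** Assigning to each small index a pair of comparable terms is injective by
    [comparable_monomials_once]; the default pair in [g] is never taken at a small index. *)
Lemma count_small_index l : uniq l -> (count small_index l <= P * P)%N.
Proof.
move=> ul.
pose good i (pp : 'I_P * 'I_P) := [&& (pp.1 < pp.2)%N, 0 < T pp.1 i,
    T pp.2 i <= 4 * P%:R * T pp.1 i & T pp.1 i <= 4 * P%:R * T pp.2 i].
pose g i := odflt (Ordinal P0, Ordinal P0) [pick pp | good i pp].
have gP i : small_index i -> good i (g i).
  move=> /small_index_comparable[pp h]; rewrite /g; case: pickP => //= /(_ pp).
  by move/negP; case: h => h1 h2 h3 h4; rewrite /good h1 h2 h3 h4.
rewrite -size_filter -(size_map g).
have <- : #|{: 'I_P * 'I_P}| = (P * P)%N by rewrite card_prod !card_ord.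
rewrite -(card_uniqP _); first exact: max_card.
rewrite map_inj_in_uniq ?filter_uniq// => i j.
rewrite !mem_filter => /andP[/gP gi _] /andP[/gP gj _] gij.
move: gi gj; rewrite /good -gij; move: (g i) => -[p p'] /= /and4P[pp' a b c] /and4P[_ a' b' c'].
by have [ij|ij|//] := ltngtP i j;
  [case: (comparable_monomials_once ij pp' a b c')
  |case: (comparable_monomials_once ij pp' a' b' c)].
Qed.

Lemma lacunary_monomials N l : sorted ltn l -> all (fun i => i <= N)%N l ->
  all (predC small_index) l ->
  lacunary (c0 / 8 * (t0 * q ^+ N) ^+ P) (map s l).
Proof.
move=> sl lN lE; apply: (@lacunary_geometric _ q (fun i => M i)) => //.
- move=> i il; split.
    by have := allP lE i il; rewrite /= /small_index -leNgt.
  apply: le_trans (monomial_sum_ge (allP lN i il)).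
  by rewrite mulrA (mulrC 8) divfK.
- move=> i; have := sM i; set S := \sum_(p < P) A p * _ => h.
  have : `|S| <= M i.
    apply: le_trans (ler_norm_sum _ _ _) _; apply: ler_sum => p' _.
    by rewrite normrM (ger0_norm (exprn_ge0 _ (ltW (tgt0 i)))).
  have -> : s i = S + (s i - S) by ring.
  move=> SM; apply: le_trans (ler_normD _ _) _; have := M0 i; lra.
Qed.
End monomials.

(** * Taylor expansion along coordinate axes *)

(** Closed sup-norm balls spelled out in coordinates: they form a neighbourhood base, have explicit
    volume, and behave well when a coordinate is deleted. *)
Definition cube (R : realType) n (y : 'rV[R]_n) (e : R) : set 'rV[R]_n :=
  [set x | forall i, `|x ord0 i - y ord0 i| <= e].

Section cubes.
Variables (R : realType) (n : nat).
Implicit Types (y z : 'rV[R]_n).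

Lemma nbhs_cubeP y (V : set 'rV[R]_n) :
  nbhs y V <-> exists2 e, 0 < e & cube y e `<=` V.
Proof.
split.
  move=> /nbhs_ballP[e /= e0 eV]; exists (e / 2); first by rewrite divr_gt0.
  move=> x xe; apply: eV; split => // i j; rewrite ord1 /ball/= distrC.
  by apply: le_lt_trans (xe j) _; rewrite ltr_pdivrMr// ltr_pMr// ltr1n.
move=> [e e0 eV]; apply/nbhs_ballP; exists e => //= x [_ xe]; apply: eV => i.
by have := xe ord0 i; rewrite /ball/= distrC => /ltW.
Qed.

Lemma cube_center y e : 0 <= e -> cube y e y.
Proof. by move=> e0 i; rewrite subrr normr0. Qed.

Lemma cubeS y e e' : e <= e' -> cube y e `<=` cube y e'.
Proof. by move=> ee' x xe i; apply: le_trans (xe i) ee'. Qed.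

Lemma cube_sub y z e e' e'' : cube y e z -> e + e' <= e'' -> cube z e' `<=` cube y e''.
Proof.
move=> yz ee x xz i; apply: le_trans ee.
by rewrite (_ : _ - _ = (z ord0 i - y ord0 i) + (x ord0 i - z ord0 i));
  [apply: le_trans (ler_normD _ _) _; exact: lerD|ring].
Qed.

Lemma basis_rVE (i j : 'I_n) : basis_rV R i ord0 j = (j == i)%:R.
Proof. by rewrite mxE eqxx. Qed.

Lemma dotv_basis (i : 'I_n) x : dotv (basis_rV R i) x = x ord0 i.
Proof.
rewrite /dotv (bigD1 i)//= big1 ?addr0; first by rewrite mxE !eqxx mul1r.
by move=> j ji; rewrite mxE (negbTE ji) andbF mul0r.
Qed.

Lemma is_derive_line (F : 'rV[R]_n -> R) x v (s : R) : derivable F (x + s *: v) v ->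
  is_derive s (1 : R) (fun s => F (x + s *: v)) ('D_v F (x + s *: v)).
Proof.
have E : (fun h : R => h^-1 *: (((fun s => F (x + s *: v)) \o shift s) (h *: (1 : R))
      - F (x + s *: v))) =
    (fun h => h^-1 *: ((F \o shift (x + s *: v)) (h *: v) - F (x + s *: v))).
  apply/funext => h /=; congr (_ *: (F _ - _)).
  by rewrite -[h *: 1]/(h * 1) mulr1 scalerDl addrCA.
by move=> dF; split; [rewrite /derivable E|rewrite /derive E].
Qed.
End cubes.

Section taylor.
Variable (R : realType).

(** The mean value theorem for [g] minus its quadratic model. With [b = 0] it gives first-order
    expansions, with [a = b = 0] Lipschitz bounds, with [e = 0] exact formulas. *)
Lemma quadratic_mvt (g g' : R -> R) (z a b e : R) :
  (forall s, `|s| <= `|z| -> is_derive s (1 : R) g (g' s)) ->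
  (forall s, `|s| <= `|z| -> `|g' s - (a + b * s)| <= e) ->
  `|g z - g 0 - (a * z + b * z ^+ 2 / 2)| <= e * `|z|.
Proof.
move=> dg ge.
pose H s := g s - (a * s + b * s ^+ 2 / 2).
have dH s : `|s| <= `|z| -> is_derive s (1 : R) H (g' s - (a + b * s)).
  move=> sz; have := dg s sz => dgs; rewrite /H; apply: is_derive_eq.
  by rewrite /GRing.scale /=; field.
have cH (s : R) : `|s| <= `|z| -> {for s, continuous H}.
  move=> /dH [dHs _]; apply: differentiable_continuous; apply/derivable1_diffP.
  exact: dHs.
have -> : g z - g 0 - (a * z + b * z ^+ 2 / 2) = H z - H 0 by rewrite /H; ring.
have [z0|z0] := leP 0 z.
  have zi s : s \in `[0, z] -> `|s| <= `|z|.
    by rewrite in_itv /= => /andP[s0 sz]; rewrite !ger0_norm.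
  have [||c cz ->] := @MVT_segment _ H (fun s => g' s - (a + b * s)) 0 z z0.
  - move=> s; rewrite in_itv /= => /andP[s0 sz]; apply: dH.
    by rewrite (gtr0_norm s0) ger0_norm// ltW.
  - by apply: continuous_in_subspaceT => s /set_mem /zi; exact: cH.
  by rewrite subr0 normrM ler_wpM2r// ge// zi.
have zi s : s \in `[z, 0] -> `|s| <= `|z|.
  by rewrite in_itv /= => /andP[s0 sz]; rewrite (ltr0_norm z0) (ler0_norm sz) lerN2.
have [||c cz] := @MVT_segment _ H (fun s => g' s - (a + b * s)) z 0 (ltW z0).
- move=> s; rewrite in_itv /= => /andP[s0 sz]; apply: dH.
  by rewrite (ltr0_norm z0) (ltr0_norm sz) lerN2 ltW.
- by apply: continuous_in_subspaceT => s /set_mem /zi; exact: cH.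
by rewrite distrC => ->; rewrite sub0r normrM normrN ler_wpM2r// ge// zi.
Qed.

Variable n : nat.
Implicit Types (y z : 'rV[R]_n).

Let subDl (u v : R) : u + v - u = v. Proof. ring. Qed.

(** The points [y + trunc m z] are the corners of a path from [y] to [y + z] along the axes, on
    which only the partial derivatives of [C2_on] enter. *)
Definition trunc m z : 'rV[R]_n := \row_i (if (i < m)%N then z ord0 i else 0).

Lemma trunc0 z : trunc 0 z = 0.
Proof. by apply/rowP => i; rewrite !mxE. Qed.

Lemma truncn z : trunc n z = z.
Proof. by apply/rowP => i; rewrite !mxE ltn_ord. Qed.

Lemma truncS (j : 'I_n) z : trunc j.+1 z = trunc j z + z ord0 j *: basis_rV R j.
Proof.
apply/rowP => i; rewrite !mxE eqxx /= ltnS leq_eqVlt -val_eqE /=.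
by case: eqP => [/val_inj ->|_]; rewrite ?ltnn ?mulr1 ?add0r ?mulr0 ?addr0.
Qed.

Lemma cube_line (y z : 'rV[R]_n) e0 (j : 'I_n) s :
  (forall i, `|z ord0 i| <= e0) -> `|s| <= e0 ->
  cube y e0 (y + trunc j z + s *: basis_rV R j).
Proof.
move=> ze se i; rewrite !mxE eqxx /=.
have [->|ij] := eqVneq i j.
  by rewrite ltnn mulr1 addr0 subDl.
by rewrite mulr0 addr0 subDl; case: ifP => // _; rewrite normr0 (le_trans _ se).
Qed.

Lemma telescope (F : 'rV[R]_n -> R) (c e : 'I_n -> R) y z m : (m <= n)%N ->
  (forall j : 'I_n, (j < m)%N ->
    `|F (y + trunc j.+1 z) - F (y + trunc j z) - c j| <= e j) ->
  `|F (y + trunc m z) - F y - \sum_(j < n | (j < m)%N) c j|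
    <= \sum_(j < n | (j < m)%N) e j.
Proof.
elim: m => [|m ih] mn h.
  by rewrite trunc0 addr0 subrr !big_pred0// subrr normr0.
have {}ih := ih (ltnW mn) (fun j jm => h j (ltnW jm)).
have hm := h (Ordinal mn) (ltnSn m).
have E (f : 'I_n -> R) : \sum_(j < n | (j < m.+1)%N) f j =
    f (Ordinal mn) + \sum_(j < n | (j < m)%N) f j.
  rewrite (bigD1 (Ordinal mn))//=; congr (_ + _); apply: eq_bigl => j.
  by rewrite -val_eqE /= ltnS [RHS]ltn_neqAle andbC.
rewrite !E; move: ih hm => /=.
set S := \sum_(j < n | _) c j; set S' := \sum_(j < n | _) e j => ih hm.
rewrite (_ : _ - _ = (F (y + trunc m.+1 z) - F (y + trunc m z) - c (Ordinal mn))
  + (F (y + trunc m z) - F y - S)); last by ring.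
by apply: le_trans (ler_normD _ _) _; exact: lerD.
Qed.

Variables (F : 'rV[R]_n -> R) (y : 'rV[R]_n) (e0 : R).


(** The truncation at [m] serves the second-order expansion, where this is applied to the derivative
    in direction [j] at points whose coordinates beyond [j] have not yet moved. *)
Lemma first_order (h : 'I_n -> R) (e : R) z m : (m <= n)%N ->
  (forall x (j : 'I_n), cube y e0 x -> (j < m)%N -> derivable F x (basis_rV R j)) ->
  (forall x (j : 'I_n), cube y e0 x -> (j < m)%N -> `|'D_(basis_rV R j) F x - h j| <= e) ->
  (forall i, `|z ord0 i| <= e0) ->
  `|F (y + trunc m z) - F y - \sum_(j < n | (j < m)%N) h j * z ord0 j|
    <= e * \sum_(j < n | (j < m)%N) `|z ord0 j|.
Proof.
move=> mn dF hF ze; rewrite big_distrr; apply: telescope => // j jm.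
have := @quadratic_mvt (fun s => F (y + trunc j z + s *: basis_rV R j))
   (fun s => 'D_(basis_rV R j) F (y + trunc j z + s *: basis_rV R j))
   (z ord0 j) (h j) 0 e.
rewrite /= scale0r addr0 mul0r mul0r addr0 -(addrA y) -truncS; apply.
- move=> s sz; apply: is_derive_line; apply: dF => //; apply: cube_line => //.
  exact: le_trans sz _.
- move=> s sz; rewrite mul0r addr0; apply: hF => //; apply: cube_line => //.
  exact: le_trans sz _.
Qed.
End taylor.

Section taylor2.
Variables (R : realType) (n : nat) (F : 'rV[R]_n -> R) (y : 'rV[R]_n) (e0 : R).
Hypotheses (e00 : 0 <= e0).
Implicit Types z : 'rV[R]_n.

(* Changing the coordinates in increasing order, only the derivatives D_i D_j
   with i <= j enter, and the symmetry of second derivatives is not needed. *)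
Definition quad_form (H : 'I_n -> 'I_n -> R) z : R :=
  \sum_(j < n) (\sum_(i < n | (i < j)%N) H j i * z ord0 i * z ord0 j
                + H j j * z ord0 j ^+ 2 / 2).

(** On the [j]-th leg of the path, [first_order] shows that the derivative in direction [j] is
    affine in the position [s] up to a small error, and [quadratic_mvt] integrates this. *)
Lemma second_order (H : 'I_n -> 'I_n -> R) e z :
  (forall x j, cube y e0 x -> derivable F x (basis_rV R j)) ->
  (forall x (i j : 'I_n), cube y e0 x -> (i <= j)%N ->
     derivable ('D_(basis_rV R j) F) x (basis_rV R i)) ->
  (forall x (i j : 'I_n), cube y e0 x -> (i <= j)%N ->
     `|'D_(basis_rV R i) ('D_(basis_rV R j) F) x - H j i| <= e) ->
  (forall i, `|z ord0 i| <= e0) ->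
  `|F (y + z) - F y - \sum_j 'D_(basis_rV R j) F y * z ord0 j - quad_form H z|
    <= e * (\sum_j `|z ord0 j|) ^+ 2.
Proof.
move=> dF ddF hF ze.
(* In dimension 0 nothing forces [0 <= e]; otherwise [hF] at some index does. *)
have [n0|/existsNP[j0 _]] := pselect (forall j : 'I_n, False).
  have -> : z = 0 by apply/rowP => j; case: (n0 j).
  rewrite addr0 subrr /quad_form !big1 ?subrr ?normr0 ?expr0n ?mulr0// => j;
  by case: (n0 j).
have e1 : 0 <= e by apply: le_trans (hF y j0 j0 (cube_center _ e00) (leqnn _)).
pose D (j : 'I_n) : 'rV[R]_n -> R := 'D_(basis_rV R j) F.
pose c (j : 'I_n) := (D j y + \sum_(i < n | (i < j)%N) H j i * z ord0 i) * z ord0 j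
                + H j j * z ord0 j ^+ 2 / 2.
have -> : F (y + z) - F y - \sum_j D j y * z ord0 j - quad_form H z =
    F (y + trunc n z) - F y - \sum_(j < n | (j < n)%N) c j.
  rewrite truncn -addrA -opprD /quad_form -big_split /=; congr (_ - _).
  apply: eq_big => [j|j _]; first by rewrite ltn_ord.
  by rewrite /c mulrDl big_distrl /= addrA.
have -> : e * (\sum_j `|z ord0 j|) ^+ 2 =
    \sum_(j < n | (j < n)%N) e * (\sum_i `|z ord0 i|) * `|z ord0 j|.
  rewrite expr2 mulrA big_distrr /=; apply: eq_bigl => j; by rewrite ltn_ord.
apply: telescope => // j _.
have := @quadratic_mvt R (fun s => F (y + trunc j z + s *: basis_rV R j))
   (fun s => D j (y + trunc j z + s *: basis_rV R j))
   (z ord0 j) (D j y + \sum_(i < n | (i < j)%N) H j i * z ord0 i) (H j j)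
   (e * \sum_i `|z ord0 i|).
rewrite /= scale0r addr0 -(addrA y) -truncS; apply => s sz.
  by apply: is_derive_line; apply: dF; apply: cube_line => //; exact: le_trans sz _.
(* The point at position [s] on the [j]-th leg is [y + trunc j.+1 z'], the form that [first_order]
   treats. *)
pose z' : 'rV[R]_n := \row_i if i == j then s else z ord0 i.
have z'j : z' ord0 j = s by rewrite mxE eqxx.
have z'i (i : 'I_n) : (i < j)%N -> z' ord0 i = z ord0 i.
  by move=> ij; rewrite mxE -val_eqE /= ltn_eqF.
have tz : trunc j z' = trunc j z.
  by apply/rowP => i; rewrite !mxE; case: ifP => // ij; rewrite -val_eqE /= ltn_eqF.
have ze' i : `|z' ord0 i| <= e0.
  by rewrite mxE; case: ifP => // _; exact: le_trans sz _.
have := @first_order R n (D j) y e0 (fun i => H j i) e z' j.+1 (ltn_ord j).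
rewrite truncS tz z'j addrA => /(_ _ _ ze') fo.
have E (f g : 'I_n -> R) : (forall i : 'I_n, (i < j)%N -> f i = g i) ->
   \sum_(i < n | (i < j.+1)%N) f i = f j + \sum_(i < n | (i < j)%N) g i.
  move=> fg; rewrite (bigD1 j)//=; congr (_ + _); apply: eq_big => i.
    by rewrite -val_eqE /= ltnS [RHS]ltn_neqAle andbC.
  by rewrite ltnS -val_eqE /= => /andP[h1 h2]; apply: fg; rewrite ltn_neqAle h2 h1.
move: fo.
rewrite (E _ (fun i => H j i * z ord0 i)); last by move=> i ij; rewrite z'i.
rewrite (E _ (fun i => `|z ord0 i|)); last by move=> i ij; rewrite z'i.
rewrite z'j => fo.
rewrite (_ : _ - _ = D j (y + trunc j z + s *: basis_rV R j) - D j y -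
   (H j j * s + \sum_(i < n | (i < j)%N) H j i * z ord0 i)); last by ring.
apply: le_trans (fo _ _) _.
- by move=> x i xy ij; exact: ddF.
- by move=> x i xy ij; exact: hF.
rewrite ler_wpM2l// [leRHS](bigD1 j)//= lerD//.
rewrite (big_mkcond (fun i : 'I_n => (i < j)%N)) (big_mkcond (fun i : 'I_n => i != j)) /=.
apply: ler_sum => i _; rewrite -val_eqE /= neq_ltn.
by case: ltngtP.
Qed.
End taylor2.

(** * Flat functions on a C^2 domain *)

Section domain.
Variables (R : realType) (n : nat).
Implicit Types (x y : 'rV[R]_n).

Lemma continuous_cube (f : 'rV[R]_n -> R) y e : {for y, continuous f} -> 0 < e ->
  exists2 dl, 0 < dl & forall x, cube y dl x -> `|f x - f y| <= e.
Proof.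
move=> cf e0; apply/nbhs_cubeP.
have /cvgrPdist_le/(_ e e0) := cf.
by apply: filterS => x /=; rewrite distrC.
Qed.

Lemma cube_move y x (i : 'I_n) (s e e' : R) : cube y e x -> `|s| <= e' ->
  cube y (e + e') (x + s *: basis_rV R i).
Proof.
move=> xe se j; rewrite !mxE eqxx /= addrAC; apply: le_trans (ler_normD _ _) _.
apply: lerD => //; apply: le_trans se; rewrite normrM ler_piMr//.
by case: eqP => _; rewrite ?normr1 ?normr0.
Qed.

Lemma quad_form0 (y : 'rV[R]_n) : quad_form (fun _ _ => 0) y = 0.
Proof.
rewrite /quad_form big1// => j _; rewrite !mul0r addr0 big1// => i _.
by rewrite !mul0r.
Qed.

Definition flat_at (phi : 'rV[R]_n -> R) y := forall i j : 'I_n, (i <= j)%N ->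
  'D_(basis_rV R i) ('D_(basis_rV R j) phi) y = 0.

Lemma flat_affine (W : set 'rV[R]_n) phi y e : 0 <= e -> C2_on W phi ->
  (forall x, cube y e x -> W x /\ flat_at phi x) ->
  forall x, cube y e x -> phi x = phi y +
    \sum_j 'D_(basis_rV R j) phi y * (x ord0 j - y ord0 j).
Proof.
move=> e0 C2 fl x xe.
have h1 (z : 'rV[R]_n) (j : 'I_n) : cube y e z -> derivable phi z (basis_rV R j).
  by move=> /fl[/C2[_ /(_ j)[]]].
have h2 (z : 'rV[R]_n) (i j : 'I_n) : cube y e z -> (i <= j)%N ->
    derivable ('D_(basis_rV R j) phi) z (basis_rV R i).
  by move=> /fl[/C2[_ /(_ j)[_ _ /(_ i)[]]]].
have h3 (z : 'rV[R]_n) (i j : 'I_n) : cube y e z -> (i <= j)%N ->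
    `|'D_(basis_rV R i) ('D_(basis_rV R j) phi) z - 0| <= 0.
  by move=> /fl[_ /(_ i j) h] ij; rewrite h// subrr normr0.
have h4 (i : 'I_n) : `|(x - y) ord0 i| <= e by rewrite !mxE; exact: xe.
have := second_order e0 h1 h2 h3 h4.
rewrite quad_form0 mul0r subr0 (addrC y) subrK.
rewrite normr_le0 subr_eq0 subr_eq => /eqP ->; rewrite addrC; congr (_ + _).
by apply: eq_bigr => j _; rewrite !mxE.
Qed.

Variables (W : set 'rV[R]_n) (h : 'rV[R]_n -> R).
Hypotheses (oW : open W) (C2h : C2_on W h).
Hypothesis regh : forall y, W y -> h y = 0 -> exists i, 'D_(basis_rV R i) h y != 0.

(* The vector [s1 *: basis_rV R i] points into the domain [0 <= h]. *)
Lemma inward_direction y0 e : W y0 -> h y0 = 0 -> 0 < e ->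
  exists (i : 'I_n) (s1 : R), [/\ 0 < `|s1|, `|s1| <= e &
    forall y t, cube y0 `|s1| y -> 0 <= h y -> 0 < t <= 2 ->
      [/\ W (y + (t * s1) *: basis_rV R i) & 0 < h (y + (t * s1) *: basis_rV R i)]].
Proof.
move=> Wy0 hy0 e0; have [i Dn0] := regh Wy0 hy0.
have [e1 e10 W1] : exists2 e, 0 < e & cube y0 e `<=` W.
  by apply/nbhs_cubeP; exact: open_nbhs_nbhs.
set D := 'D_(basis_rV R i) h y0 in Dn0.
have cD : {for y0, continuous ('D_(basis_rV R i) h)}.
  by have [_ /(_ i)[]] := C2h Wy0.
have D2 : 0 < `|D| / 2 by rewrite divr_gt0// normr_gt0.
have [e2 e20 D2y] := continuous_cube cD D2.
(* All points reached are within [r + 2 * r] of [y0], hence in both cubes. There the derivative of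
   [h] is within [|D| / 2] of [D], so moving with the sign of [D] increases [h]. *)
pose r := Num.min e (Num.min (e1 / 4) (e2 / 4)).
have r0 : 0 < r by rewrite !lt_min e0 !divr_gt0.
have re : r <= e by rewrite ge_min lexx.
have r1 : r <= e1 / 4 by rewrite !ge_min lexx orbT.
have r2 : r <= e2 / 4 by rewrite !ge_min lexx !orbT.
have sr : `|Num.sg D * r| = r by rewrite normrM normr_sg Dn0 mul1r gtr0_norm.
exists i, (Num.sg D * r); rewrite sr; split => // y t yr hy /andP[t0 t2].
set s := t * _.
have ts : `|s| = t * r by rewrite /s normrM sr gtr0_norm.
have sr2 : `|s| <= 2 * r by rewrite ts ler_wpM2r// ltW.
have yW u : `|u| <= `|s| -> cube y0 (r + 2 * r) (y + u *: basis_rV R i).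
  by move=> us; apply: cube_move yr _; exact: le_trans us _.
have inW u : `|u| <= `|s| -> W (y + u *: basis_rV R i).
  by move=> /yW yu; apply: W1; apply: cubeS yu; lra.
split; first exact: inW.
have := @quadratic_mvt R (fun u => h (y + u *: basis_rV R i))
  (fun u => 'D_(basis_rV R i) h (y + u *: basis_rV R i)) s D 0 (`|D| / 2).
rewrite /= scale0r addr0 mul0r mul0r addr0 => H.
have {}H : `|h (y + s *: basis_rV R i) - h y - D * s| <= `|D| / 2 * `|s|.
  apply: H => u us; last by rewrite mul0r addr0; apply: D2y; apply: cubeS (yW _ us); lra.
  by apply: is_derive_line; have [_ /(_ i)[]] := C2h (inW u us).
have Ds : D * s = `|D| * `|s|.
  by rewrite ts /s mulrCA [D * _]mulrA [D * Num.sg D]mulrC -normrEsg mulrCA.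
have : 0 < `|D| * `|s| by rewrite ts mulr_gt0// ?normr_gt0// mulr_gt0.
move: H; rewrite Ds ler_norml => /andP[H _]; move: H; move: hy.
by move: (`|D|) (`|s|) => a b; nra.
Qed.

(** A boundary point is pushed inwards, and continuity of [h] gives a whole cube. Such a cube
    determines a hyperplane uniquely, at boundary points too. *)
Lemma interior_near y0 e : W y0 -> 0 <= h y0 -> 0 < e ->
  exists y1, exists2 e1, 0 < e1 &
    forall y, cube y1 e1 y -> [/\ cube y0 e y, W y & 0 < h y].
Proof.
move=> Wy0 hy0 e0.
have pos y1 : W y1 -> 0 < h y1 -> cube y0 (e / 2) y1 -> exists2 e1, 0 < e1 &
    forall y, cube y1 e1 y -> [/\ cube y0 e y, W y & 0 < h y].
  move=> Wy1 hy1 y1e; have h2 : 0 < h y1 / 2 by rewrite divr_gt0.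
  have [e1 e10 h1] := continuous_cube (C2h Wy1).1 h2.
  have [e2 e20 W1] : exists2 e, 0 < e & cube y1 e `<=` W.
    by apply/nbhs_cubeP; exact: open_nbhs_nbhs.
  exists (Num.min (e / 2) (Num.min e1 e2)).
    by rewrite !lt_min e10 e20 divr_gt0.
  move=> y yy1; split.
  - by apply: cube_sub y1e _ _ yy1; rewrite [leRHS]splitr lerD2l ge_min lexx.
  - by apply: W1; apply: cubeS yy1; rewrite !ge_min lexx !orbT.
  - have /h1 : cube y1 e1 y by apply: cubeS yy1; rewrite !ge_min lexx orbT.
    by rewrite ler_norml => /andP[]; lra.
move: hy0; rewrite le_eqVlt => /orP[/eqP hy0|hy0]; last first.
  by exists y0; apply: pos => //; apply: cube_center; rewrite divr_ge0// ltW.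
have e20 : 0 < e / 2 by rewrite divr_gt0.
have [i [s1 [s10 s1e hs1]]] := inward_direction Wy0 (esym hy0) e20.
have := hs1 y0 1 (cube_center _ (ltW s10)).
rewrite -hy0 lexx ltr01 ler1n mul1r => /(_ isT isT)[W1 h1].
exists (y0 + s1 *: basis_rV R i); apply: pos => //.
by rewrite -[e / 2]add0r; apply: cube_move s1e; exact: cube_center.
Qed.

(** At an interior point this is [flat_affine]. Near a boundary point the domain need not contain a
    cube about [y0]; the affine formula then holds on a cube about the inner point [y1] and is
    carried back along direction [i]: the segment from [y + s1 e_i] to [y] stays in the domain, and
    [phi] has zero second derivative along it. *)
Lemma flat_affine_near phi y0 e : C2_on W phi -> W y0 -> 0 <= h y0 -> 0 < e ->
  (forall y, cube y0 e y -> W y -> 0 < h y -> flat_at phi y) ->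
  exists (b : R) (G : 'I_n -> R), exists2 e2, 0 < e2 &
    forall y, cube y0 e2 y -> W y -> 0 <= h y -> phi y = b + \sum_j G j * y ord0 j.
Proof.
move=> C2 Wy0 hy0 e0 fl.
have affE y1 (G : 'I_n -> R) y : phi y1 + \sum_j G j * (y ord0 j - y1 ord0 j) =
    (phi y1 - \sum_j G j * y1 ord0 j) + \sum_j G j * y ord0 j.
  rewrite -addrA; congr (_ + _); rewrite addrC -sumrB.
  by apply: eq_bigr => j _; rewrite mulrBr.
move: (hy0); rewrite le_eqVlt => /orP[/eqP hy00|hy00]; last first.
  have h2 : 0 < h y0 / 2 by rewrite divr_gt0.
  have [e1 e10 h1] := continuous_cube (C2h Wy0).1 h2.
  have [e2 e20 W1] : exists2 e, 0 < e & cube y0 e `<=` W.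
    by apply/nbhs_cubeP; exact: open_nbhs_nbhs.
  pose r := Num.min e (Num.min e1 e2).
  have r0 : 0 < r by rewrite !lt_min e0 e10 e20.
  exists (phi y0 - \sum_j 'D_(basis_rV R j) phi y0 * y0 ord0 j),
    (fun j => 'D_(basis_rV R j) phi y0), r => // y yr _ _.
  rewrite -affE; apply: (flat_affine (ltW r0) C2) => // x xr.
  have Wx : W x by apply: W1; apply: cubeS xr; rewrite !ge_min lexx !orbT.
  split => //; apply: fl => //; first by apply: cubeS xr; rewrite !ge_min lexx.
  have /h1 : cube y0 e1 x by apply: cubeS xr; rewrite !ge_min lexx orbT.
  by rewrite ler_norml => /andP[]; lra.
have e40 : 0 < e / 4 by rewrite divr_gt0.
have [i [s1 [s10 s1e hs1]]] := inward_direction Wy0 (esym hy00) e40.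
(* Flatness passes to the boundary by continuity of the second derivatives. *)
have flat_closed y : cube y0 `|s1| y -> W y -> 0 <= h y -> flat_at phi y.
  move=> ye Wy hy a b ab.
  pose F := 'D_(basis_rV R a) ('D_(basis_rV R b) phi); rewrite -/(F y).
  apply/eqP; rewrite -normr_le0; apply/ler_addgt0Pl => dl dl0; rewrite addr0.
  have cF : {for y, continuous F} by have [_ /(_ b)[_ _ /(_ a)[]]] := C2 _ Wy.
  have [r r0 Fr] := continuous_cube cF dl0.
  pose t := Num.min 1 (r / `|s1|).
  have t0 : 0 < t by rewrite lt_min ltr01 divr_gt0.
  have t1 : t <= 1 by rewrite ge_min lexx.
  have ts1 : `|t * s1| <= r.
    by rewrite normrM gtr0_norm// -ler_pdivlMr// ge_min lexx orbT.
  have := hs1 y t ye hy; rewrite t0 (le_trans t1) ?ler1n// => /(_ isT)[W2 h2].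
  have F0 : F (y + (t * s1) *: basis_rV R i) = 0.
    apply: fl => //; have : cube y0 (`|s1| + `|s1|) (y + (t * s1) *: basis_rV R i).
      by apply: cube_move ye _; rewrite normrM gtr0_norm// ler_piMl.
    by apply: cubeS; lra.
  have /Fr : cube y r (y + (t * s1) *: basis_rV R i).
    rewrite -[r]add0r; apply: cube_move ts1; exact: cube_center.
  by rewrite F0 sub0r normrN.
have := hs1 y0 1 (cube_center _ (ltW s10)).
rewrite -hy00 lexx ltr01 ler1n mul1r => /(_ isT isT)[].
set y1 := y0 + s1 *: basis_rV R i => Wy1 hy1.
have h2 : 0 < h y1 / 2 by rewrite divr_gt0.
have [e1 e10 h1] := continuous_cube (C2h Wy1).1 h2.
have [e2 e20 W1] : exists2 e, 0 < e & cube y1 e `<=` W.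
  by apply/nbhs_cubeP; exact: open_nbhs_nbhs.
pose r := Num.min `|s1| (Num.min e1 e2).
have r0 : 0 < r by rewrite !lt_min s10 e10 e20.
have rs : r <= `|s1| by rewrite ge_min lexx.
have flat1 x : cube y1 r x -> W x /\ flat_at phi x.
  move=> xr; have Wx : W x by apply: W1; apply: cubeS xr; rewrite !ge_min lexx !orbT.
  split => //; apply: fl => //.
    apply: (cubeS _ (cube_sub (e := `|s1|) (e'' := `|s1| + r) _ (lexx _) xr)).
      by lra.
    rewrite -[`|s1|]add0r; apply: cube_move => //; exact: cube_center.
  have /h1 : cube y1 e1 x by apply: cubeS xr; rewrite !ge_min lexx orbT.
  by rewrite ler_norml => /andP[]; lra.
have aff := flat_affine (ltW r0) C2 flat1.
set G := fun j => 'D_(basis_rV R j) phi y1.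
exists (phi y1 - \sum_j G j * y1 ord0 j), G, (r / 2); first by rewrite divr_gt0.
move=> y yr Wy hy.
have {}aff x : cube y1 r x -> phi x =
    (phi y1 - \sum_j G j * y1 ord0 j) + \sum_j G j * x ord0 j.
  by move=> /aff ->; rewrite affE.
set c0 := phi y1 - _ in aff *.
have y1s u : `|u| <= r / 2 -> cube y1 r (y + (s1 + u) *: basis_rV R i).
  move=> ur; rewrite scalerDl addrA [r]splitr; apply: cube_move ur.
  by move=> j; have := yr j; rewrite !mxE; congr (`|_| <= _); ring.
have sumE u : \sum_j G j * (y + u *: basis_rV R i) ord0 j =
    \sum_j G j * y ord0 j + G i * u.
  rewrite [in LHS](bigD1 i)//= [in RHS](bigD1 i)//= !mxE !eqxx mulr1 mulrDr.
  rewrite [RHS]addrAC; congr (_ + _ + _); apply: eq_bigr => j ji.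
  by rewrite !mxE (negbTE ji) andbF mulr0 addr0.
have ys1 : cube y0 `|s1| y by apply: cubeS yr; lra.
(* At [u = - s1] this is the endpoint [y]; elsewhere [s1 + u = t * s1] with [0 < t <= 2], the range
   covered by [inward_direction]. *)
have path u : `|u| <= `|s1| ->
    [/\ W (y + (s1 + u) *: basis_rV R i), 0 <= h (y + (s1 + u) *: basis_rV R i)
      & flat_at phi (y + (s1 + u) *: basis_rV R i)].
  rewrite ler_norml => /andP[u1 u2].
  pose t := 1 + u / s1.
  have s1n : s1 != 0 by rewrite -normr_gt0.
  have -> : s1 + u = t * s1 by rewrite /t mulrDl mul1r divfK.
  have us : `|u / s1| <= 1 by rewrite normrM normfV ler_pdivrMr// mul1r ler_norml u1 u2.
  have t0 : 0 <= t by move: us; rewrite /t ler_norml; lra.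
  have t2 : t <= 2 by move: us; rewrite /t ler_norml; lra.
  move: t0; rewrite le_eqVlt => /orP[/eqP <-|t0].
    by rewrite mul0r scale0r addr0; split => //; exact: flat_closed.
  have := hs1 y t ys1 hy; rewrite t0 t2 => /(_ isT)[W2 h2']; split => //; first exact: ltW.
  apply: fl => //.
  have : cube y0 (`|s1| + 2 * `|s1|) (y + (t * s1) *: basis_rV R i).
    by apply: cube_move ys1 _; rewrite normrM gtr0_norm// ler_wpM2r.
  by apply: cubeS; lra.
have mvt u : `|u| <= `|s1| -> phi (y + (s1 + u) *: basis_rV R i) =
    phi (y + s1 *: basis_rV R i) + 'D_(basis_rV R i) phi (y + s1 *: basis_rV R i) * u.
  move=> us.
  have z0 : `|0 : R| <= `|s1| by rewrite normr0.
  have [W2 _ _] := path 0 z0; move: W2; rewrite addr0.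
  set x := y + s1 *: basis_rV R i => Wx.
  have xE v : y + (s1 + v) *: basis_rV R i = x + v *: basis_rV R i.
    by rewrite scalerDl addrA.
  have H (v : R) : `|v| <= `|u| ->
      W (x + v *: basis_rV R i) /\ flat_at phi (x + v *: basis_rV R i).
    by move=> vu; have [] := path v (le_trans vu us); rewrite xE.
  have der v : `|v| <= `|u| -> 'D_(basis_rV R i) phi (x + v *: basis_rV R i) =
      'D_(basis_rV R i) phi x.
    move=> vu; have := @quadratic_mvt R
      (fun v => 'D_(basis_rV R i) phi (x + v *: basis_rV R i))
      (fun v => 'D_(basis_rV R i) ('D_(basis_rV R i) phi) (x + v *: basis_rV R i)) v 0 0 0.
    rewrite /= scale0r addr0 !mul0r addr0 subr0 => T.
    apply/eqP; rewrite -subr_eq0 -normr_le0; apply: T => r' rv.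
      have [Wr _] := H _ (le_trans rv vu).
      by apply: is_derive_line; have [_ /(_ i)[_ _ /(_ i)[]]] := C2 _ Wr.
    by have [_ fr] := H _ (le_trans rv vu); rewrite fr// mul0r addr0 subrr normr0.
  have := @quadratic_mvt R (fun v => phi (x + v *: basis_rV R i))
      (fun v => 'D_(basis_rV R i) phi (x + v *: basis_rV R i)) u
      ('D_(basis_rV R i) phi x) 0 0.
  rewrite /= scale0r addr0 !mul0r addr0 xE => T.
  apply/eqP; rewrite -subr_eq0 opprD addrA -normr_le0; apply: T => v vu.
    have [Wr _] := H _ vu.
    by apply: is_derive_line; have [_ /(_ i)[]] := C2 _ Wr.
  by rewrite der// mul0r addr0 subrr normr0.
(* The points [u = 0] and [u = r / 2] of the segment both lie in the cube about [y1] and identify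
   the slope. *)
have Gi : 'D_(basis_rV R i) phi (y + s1 *: basis_rV R i) = G i.
  have r2 : 0 < r / 2 by rewrite divr_gt0.
  have r2s : `|r / 2| <= `|s1| by rewrite gtr0_norm//; lra.
  have := mvt _ r2s.
  rewrite aff; last by apply: y1s; rewrite gtr0_norm.
  rewrite -[s1 in X in _ = X]addr0 aff; last by apply: y1s; rewrite normr0 ltW.
  rewrite !sumE addr0 mulrDr => H.
  by apply: (mulIf (lt0r_neq0 r2)); move: H; lra.
have := mvt (- s1); rewrite normrN lexx subrr scale0r addr0 => /(_ isT) ->.
rewrite Gi -{1}[s1]addr0 aff; last by apply: y1s; rewrite normr0 divr_ge0// ltW.
by rewrite sumE addr0; ring.
Qed.
End domain.

(** * Existence of a curved point *)

Section graph_points.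
Variables (R : realType) (n : nat) (k : 'I_n.+1).
Implicit Types (y : 'rV[R]_n) (x z : 'rV[R]_n.+1).

Definition graph_pt y (t : R) : 'rV[R]_n.+1 :=
  \row_j (if unlift k j is Some i then y ord0 i else t).

Lemma graph_pt_k y t : graph_pt y t ord0 k = t.
Proof. by rewrite mxE unlift_none. Qed.

Lemma graph_pt_lift y t i : graph_pt y t ord0 (lift k i) = y ord0 i.
Proof. by rewrite mxE liftK. Qed.

Lemma col'_graph_pt y t : col' k (graph_pt y t) = y.
Proof. by apply/rowP => i; rewrite mxE graph_pt_lift. Qed.

Lemma cube_graph_pt x y t e : cube (col' k x) e y -> `|t - x ord0 k| <= e ->
  cube x e (graph_pt y t).
Proof.
move=> xy te j; case: (unliftP k j) => [i|] ->; last by rewrite graph_pt_k.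
by rewrite graph_pt_lift; have := xy i; rewrite mxE.
Qed.

Lemma cube_col' x z e : cube x e z -> cube (col' k x) e (col' k z).
Proof. by move=> xz i; rewrite !mxE. Qed.

Lemma sum_lift (f : 'I_n.+1 -> R) : \sum_j f j = f k + \sum_i f (lift k i).
Proof. by rewrite (bigD1_ord k). Qed.

Lemma dotv_graph_pt (a : 'rV[R]_n.+1) y t :
  dotv a (graph_pt y t) = a ord0 k * t + \sum_i a ord0 (lift k i) * y ord0 i.
Proof.
rewrite /dotv sum_lift graph_pt_k; congr (_ + _).
by apply: eq_bigr => i _; rewrite graph_pt_lift.
Qed.

Definition graph_hyperplane (b : R) (G : 'I_n -> R) : set 'rV[R]_n.+1 :=
  [set x | x ord0 k = b + \sum_i G i * x ord0 (lift k i)].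

Lemma hyperplane_graph b G : hyperplane (graph_hyperplane b G).
Proof.
exists (graph_pt (\row_i - G i) 1), b; split.
  by apply/eqP => /rowP /(_ k); rewrite graph_pt_k mxE => /eqP; rewrite oner_eq0.
apply/seteqP; split => x; rewrite /graph_hyperplane /= /dotv sum_lift graph_pt_k mul1r.
  move=> ->; rewrite -addrA -big_split /= big1 ?addr0// => i _.
  by rewrite graph_pt_lift mxE mulNr subrr.
move=> <-; rewrite -addrA -big_split /= big1 ?addr0// => i _.
by rewrite graph_pt_lift mxE mulNr addNr.
Qed.

(** Comparing the equation of [H] at the centre and at its shift by [e] along each axis fixes the
    coefficients up to the factor [a_k], and [a_k = 0] would make [a] vanish. *)
Lemma hyperplane_unique H b G y1 e : hyperplane H -> 0 < e ->
  (forall y, cube y1 e y -> H (graph_pt y (b + \sum_i G i * y ord0 i))) ->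
  H = graph_hyperplane b G.
Proof.
move=> [a [c [a0 ->]]] e0 /= Hy.
have E y : cube y1 e y -> a ord0 k * b +
    \sum_i (a ord0 k * G i + a ord0 (lift k i)) * y ord0 i = c.
  move=> /Hy <-; rewrite dotv_graph_pt mulrDr -addrA; congr (_ + _).
  rewrite big_distrr /= -big_split /=; apply: eq_bigr => i _.
  by rewrite mulrDl mulrA.
have G0 i : a ord0 (lift k i) = - (a ord0 k * G i).
  have h1 := E y1 (cube_center _ (ltW e0)).
  have /E : cube y1 e (y1 + e *: basis_rV R i).
    by rewrite -[e in cube _ e]add0r; apply: cube_move; [exact: cube_center|rewrite gtr0_norm].
  rewrite -h1 => /addrI; rewrite (bigD1 i)//= [in RHS](bigD1 i)//=.
  rewrite !mxE !eqxx mulr1 (eq_bigr (fun j => (a ord0 k * G j + a ord0 (lift k j)) * y1 ord0 j)).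
    move=> /addIr; rewrite mulrDr -[RHS]addr0 => /addrI/eqP.
    by rewrite mulf_eq0 (gt_eqF e0) orbF addrC addr_eq0 => /eqP.
  by move=> j ji; rewrite !mxE (negbTE ji) andbF mulr0 addr0.
have cE : c = a ord0 k * b.
  rewrite -(E y1 (cube_center _ (ltW e0))) big1 ?addr0// => i _.
  by rewrite G0 subrr mul0r.
have ak : a ord0 k != 0.
  apply: contra_neq a0 => ak; apply/rowP => j; rewrite mxE.
  by case: (unliftP k j) => [i|] ->//; rewrite G0 ak mul0r oppr0.
have dE x : dotv a x = a ord0 k * (x ord0 k - \sum_i G i * x ord0 (lift k i)).
  rewrite /dotv sum_lift mulrBr; congr (_ + _); rewrite big_distrr -sumrN /=.
  by apply: eq_bigr => i _; rewrite G0 mulNr mulrA.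
apply/seteqP; split => x; rewrite /graph_hyperplane /= dE cE.
  by move/(mulfI ak) <-; rewrite subrK.
by move=> ->; rewrite addrK.
Qed.
End graph_points.

(** * Flat hypersurfaces and hyperplanes *)

Section flat_hypersurface.
Variables (R : realType) (n : nat) (S : set 'rV[R]_n.+1).

(** The data of [C2_hypersurface] freed from the base point, so that one chart serves all points of
    [U]. *)
Definition graph_chart k (U : set 'rV[R]_n.+1) (W : set 'rV[R]_n)
    (phi h : 'rV[R]_n -> R) :=
  [/\ open U, open W & forall x, U x -> W (col' k x)] /\
  [/\ C2_on W phi, C2_on W h,
    forall y, W y -> h y = 0 -> exists i, 'D_(basis_rV R i) h y != 0 &
    forall x, U x ->
      (S x <-> x ord0 k = phi (col' k x) /\ 0 <= h (col' k x))].

Lemma chart_nbhd k U W phi h x (V : set 'rV[R]_n.+1) : graph_chart k U W phi h ->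
  U x -> S x -> open V -> V x ->
  exists2 e, 0 < e & cube x e `<=` U `&` V /\
    forall y, cube (col' k x) e y -> W y /\ (U `&` V) (graph_pt k y (phi y)).
Proof.
move=> [[oU oW UW] [C2 _ _ US]] Ux Sx oV Vx.
have [e1 e10 eUV] : exists2 e, 0 < e & cube x e `<=` U `&` V.
  by apply/nbhs_cubeP; apply: open_nbhs_nbhs; split => //; exact: openI.
have Wx := UW _ Ux.
have [xk _] := (US _ Ux).1 Sx.
have [e2 e20 ph] := continuous_cube (C2 _ Wx).1 e10.
exists (Num.min e1 e2); first by rewrite lt_min e10 e20.
split; first by move=> z xz; apply: eUV; apply: cubeS xz; rewrite ge_min lexx.
move=> y xy; have UVy : (U `&` V) (graph_pt k y (phi y)).
  apply: eUV; apply: cube_graph_pt; first by apply: cubeS xy; rewrite ge_min lexx.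
  by rewrite xk; apply: ph; apply: cubeS xy; rewrite ge_min lexx orbT.
by split => //; have := UW _ UVy.1; rewrite col'_graph_pt.
Qed.

Definition locally_in x (H : set 'rV[R]_n.+1) :=
  hyperplane H /\ exists V, [/\ open V, V x & S `&` V `<=` H].

Hypothesis Shyp : C2_hypersurface S.
Hypothesis Sflat : forall k U W phi h x, graph_chart k U W phi h ->
  U x -> S x -> 0 < h (col' k x) -> flat_at phi (col' k x).

(** Existence comes from the affine formula for [phi]. Uniqueness holds because near [x], even on
    the boundary, [S] contains a graph over a full cube of interior points. *)
Lemma flat_locally_in x : S x -> exists2 H, locally_in x H &
  forall H', locally_in x H' -> H' = H.
Proof.
move=> Sx; have [k [U [W [phi [h ch]]]]] := Shyp Sx.
have {}ch : graph_chart k U W phi h /\ U x by case: ch => -[? ? ? ?] ?; split.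
move: ch => [ch Ux].
have [[oU oW UW] [C2 C2h reg US]] := ch.
have [xk hx] := (US _ Ux).1 Sx.
have [e e0 [eU eW]] := chart_nbhd ch Ux Sx oU Ux.
have chart_S y : (U `&` U) (graph_pt k y (phi y)) -> 0 <= h y ->
    S (graph_pt k y (phi y)).
  by move=> [Uy _] hy; apply/US => //; rewrite col'_graph_pt graph_pt_k.
have fl y : cube (col' k x) e y -> W y -> 0 < h y -> flat_at phi y.
  move=> /eW[_ Uy] _ hy; rewrite -(col'_graph_pt k y (phi y)).
  apply: (Sflat ch); rewrite ?col'_graph_pt//; first by case: Uy.
  by apply: chart_S => //; exact: ltW.
have [b [G [e2 e20 aff]]] :=
  flat_affine_near oW C2h reg C2 (UW _ Ux) hx e0 fl.
exists (graph_hyperplane k b G).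
  split; first exact: hyperplane_graph.
  exists (U `&` (cube x e2)°); split.
  - by apply: openI => //; exact: open_interior.
  - by split => //; apply/nbhs_cubeP; exists e2.
  - move=> z [Sz [Uz /interior_subset ze]]; have [zk hz] := (US _ Uz).1 Sz.
    rewrite /graph_hyperplane /= zk aff//; [|exact: cube_col'|exact: UW].
    by congr (_ + _); apply: eq_bigr => i _; rewrite mxE.
move=> H' [hH' [V [oV Vx SV]]].
have [e3 e30 [_ e3W]] := chart_nbhd ch Ux Sx oV Vx.
have e40 : 0 < Num.min e2 e3 by rewrite lt_min e20 e30.
have [y1 [e1 e10 int]] := interior_near oW C2h reg (UW _ Ux) hx e40.
apply: (hyperplane_unique (y1 := y1) (e := e1)) => // y /int[ye Wy hy].
have y2 : cube (col' k x) e2 y by apply: cubeS ye; rewrite ge_min lexx.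
have [_ [Uy Vy]] : W y /\ (U `&` V) (graph_pt k y (phi y)).
  by apply: e3W; apply: cubeS ye; rewrite ge_min lexx orbT.
rewrite -aff//; last exact: ltW.
by apply: SV; split => //; apply: chart_S => //; exact: ltW.
Qed.

(** By uniqueness the local hyperplane is locally constant: within the component, the points with
    local hyperplane [H] and those with another one form two complementary relatively open sets, and
    the first contains [p]. *)
Lemma flat_component p : S p -> exists2 H, hyperplane H &
  connected_component S p `<=` H.
Proof.
move=> Sp; have [H HpS Hp] := flat_locally_in Sp.
exists H; first by have [] := HpS.
set C := connected_component S p.
have CS : C `<=` S by exact: connected_component_sub.
have opN (P : set (set 'rV[R]_n.+1)) :
    open [set x | exists2 H', P H' & locally_in x H'].
  rewrite openE => x [H' PH' [hH' [V [oV Vx SV]]]].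
  rewrite /interior; have : nbhs x V by apply: open_nbhs_nbhs.
  apply: filterS => z Vz; exists H' => //; split => //; exists V; split => //.
pose B := [set x | C x /\ locally_in x H].
have BC : B = C.
  apply: (@component_connected _ S p).
  - by exists p; split => //; exact: connected_component_refl.
  - exists [set x | exists2 H', H' = H & locally_in x H']; first exact: (opN [set H]).
    apply/seteqP; split => x [Cx]; first by split => //; exists H.
    by move=> [H' -> ?]; split.
  - exists (~` [set x | exists2 H', H' <> H & locally_in x H']).
      by apply: open_closedC; exact: (opN [set H' | H' <> H]).
    apply/seteqP; split => x [Cx].
      move=> xH; split => // -[H' H'H xH']; apply: H'H.
      have [H2 _ u] := flat_locally_in (CS _ Cx).
      by rewrite (u _ xH') (u _ xH).
    move=> nH; split => //; have [H2 xH2 _] := flat_locally_in (CS _ Cx).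
    have [<-//|H2H] := pselect (H2 = H); exfalso; apply: nH; exists H2 => //.
move=> x Cx; have [_ [_ [V [_ Vx SV]]]] : B x by rewrite BC.
by apply: SV; split => //; exact: CS.
Qed.
End flat_hypersurface.

(** The flatness being negated concerns only points with [0 < h], so its failure occurs at such a
    point, around which [S] is a graph over a full cube. *)
Lemma nonflat_chart (R : realType) n (S : set 'rV[R]_n.+1) :
  C2_hypersurface S -> not_in_hyperplane S ->
  exists (k : 'I_n.+1) (U : set 'rV[R]_n.+1) (W : set 'rV[R]_n)
      (phi h : 'rV[R]_n -> R) (x : 'rV[R]_n.+1),
    [/\ graph_chart S k U W phi h, U x, S x, 0 < h (col' k x)
      & ~ flat_at phi (col' k x)].
Proof.
move=> Shyp [p Sp nH]; apply: contrapT => N.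
have [k U W phi h x ch Ux Sx hx|H hH] := @flat_component R n S Shyp _ p Sp.
  by apply: contrapT => nf; apply: N; exists k, U, W, phi, h, x.
exact: nH.
Qed.

(** * A curve through a curved point *)

Section local_expansion.
Variables (R : realType) (n : nat).
Implicit Types (y z u : 'rV[R]_n).

Lemma cube_forall (I : finType) (P : I -> 'rV[R]_n -> Prop) y :
  (forall i, exists2 e, 0 < e & forall x, cube y e x -> P i x) ->
  exists2 e, 0 < e & forall x, cube y e x -> forall i, P i x.
Proof.
move=> h; apply/nbhs_cubeP.
apply: (@filter_forall _ I P (nbhs y) _) => i.
by apply/nbhs_cubeP; exact: h.
Qed.

(** If [H i i] or [H j j] is nonzero, a basis vector will do; otherwise the form takes the value
    [H j i] at the sum of the basis vectors [i] and [j]. *)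
Lemma quad_form_neq0 (H : 'I_n -> 'I_n -> R) (i j : 'I_n) :
  (i <= j)%N -> H j i != 0 ->
  exists2 u : 'rV[R]_n, forall l, `|u ord0 l| <= 1 & quad_form H u != 0.
Proof.
move=> ij Hji.
have Qe l : quad_form H (basis_rV R l) = H l l / 2.
  rewrite /quad_form (bigD1 l)//= [X in _ + X]big1 ?addr0; last first.
    move=> m ml; rewrite basis_rVE (negbTE ml) expr0n mulr0 mul0r addr0.
    by rewrite big1// => a _; rewrite mulr0.
  rewrite basis_rVE eqxx expr1n mulr1 big1 ?add0r// => a al.
  by rewrite basis_rVE -val_eqE /= (ltn_eqF al) mulr0 mul0r.
have e1 l m : `|(basis_rV R l : 'rV[R]_n) ord0 m| <= 1.
  by rewrite basis_rVE; case: eqP; rewrite ?normr1 ?normr0.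
have [Hii|Hii] := eqVneq (H i i) 0; last first.
  by exists (basis_rV R i) => //; rewrite Qe mulf_neq0// invr_neq0.
have [Hjj|Hjj] := eqVneq (H j j) 0; last first.
  by exists (basis_rV R j) => //; rewrite Qe mulf_neq0// invr_neq0.
have {ij}ij : (i < j)%N.
  by rewrite ltn_neqAle ij andbT; apply: contra_neq Hji => /val_inj ->.
have inej : i != j by rewrite -val_eqE ltn_eqF.
pose u : 'rV[R]_n := \row_l ((l == i) || (l == j))%:R.
exists u; first by move=> l; rewrite mxE; case: (_ || _); rewrite ?normr1 ?normr0.
rewrite /quad_form (bigD1 j)//= [X in _ + X](bigD1 i)//= [X in _ + (_ + X)]big1 ?addr0; last first.
  move=> l /andP[lj li]; rewrite !mxE (negbTE lj) (negbTE li) expr0n mulr0 mul0r addr0.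
  by rewrite big1// => a _; rewrite mulr0.
have -> : \sum_(a < n | (a < i)%N) H i a * u ord0 a * u ord0 i = 0.
  apply: big1 => a ai.
  by rewrite !mxE -!val_eqE /= (ltn_eqF ai) (ltn_eqF (ltn_trans ai ij)) mulr0 mul0r.
have -> : \sum_(a < n | (a < j)%N) H j a * u ord0 a * u ord0 j = H j i.
  rewrite (bigD1 i)//= big1 ?addr0.
    by rewrite !mxE !eqxx orbT !mulr1.
  move=> a /andP[aj ai].
  by rewrite !mxE (negbTE ai) -val_eqE /= (ltn_eqF aj) mulr0 mul0r.
by rewrite Hii Hjj !mul0r !addr0.
Qed.

(** As [j] starts from 0, the added exponents are 3, 4, ...: distinct, different from the 1 and 2
    contributed by [t * u] and by the quadratic term of [phi], and too high to alter the [t ^ 2]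
    coefficient of the latter. *)
Definition curve u (t : R) : 'rV[R]_n := \row_j (t * u ord0 j + t ^+ (j.+3)).

Lemma curve_le u t j : (forall l, `|u ord0 l| <= 1) -> 0 <= t -> t <= 1 ->
  `|curve u t ord0 j| <= 2 * t.
Proof.
move=> u1 t0 t1; rewrite mxE; apply: le_trans (ler_normD _ _) _.
rewrite (_ : 2 * t = t + t); last by ring.
rewrite normrM (ger0_norm t0) (ger0_norm (exprn_ge0 _ t0)) lerD//.
  by rewrite ler_piMr.
by rewrite exprS ler_piMr// exprn_ile1.
Qed.

Lemma quad_form_curve (H : 'I_n -> 'I_n -> R) u :
  (forall l, `|u ord0 l| <= 1) ->
  exists2 C, 0 <= C & forall t, 0 <= t -> t <= 1 ->
    `|quad_form H (curve u t) - t ^+ 2 * quad_form H u| <= C * t ^+ 3.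
Proof.
move=> u1.
pose C := \sum_(j < n) (\sum_(i < n | (i < j)%N) `|H j i| * 3 + `|H j j| * 3).
exists C.
  by apply: sumr_ge0 => j _; apply: addr_ge0; [apply: sumr_ge0 => i _|];
    rewrite mulr_ge0.
move=> t t0 t1.
have prod i j : `|curve u t ord0 i * curve u t ord0 j
    - t ^+ 2 * (u ord0 i * u ord0 j)| <= 3 * t ^+ 3.
  rewrite !mxE !(exprS t) !expr0 !mulr1.
  set a := u ord0 i; set b := u ord0 j.
  set p := t ^+ i; set r := t ^+ j.
  have p0 : 0 <= p by rewrite exprn_ge0.
  have p1 : p <= 1 by rewrite exprn_ile1.
  have r0 : 0 <= r by rewrite exprn_ge0.
  have r1 : r <= 1 by rewrite exprn_ile1.
  have -> : (t * a + t * (t * (t * p))) * (t * b + t * (t * (t * r))) - t * t * (a * b)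
     = t * (t * t) * ((t * r) * a + (t * p) * b + (t * t * t * p * r)) by ring.
  rewrite normrM ger0_norm ?mulr_ge0// mulrC ler_wpM2r ?mulr_ge0//.
  have t3 : 0 <= t * t * t * p * r by rewrite !mulr_ge0.
  have t31 : t * t * t * p * r <= 1 by rewrite !(mulr_ile1, mulr_ge0).
  have -> : 3 = 1 + 1 + 1 :> R by ring.
  apply: le_trans (ler_normD _ _) _; rewrite (ger0_norm t3) lerD//.
  apply: le_trans (ler_normD _ _) _; rewrite lerD// normrM.
    by rewrite mulr_ile1// ?u1// ger0_norm ?mulr_ge0// mulr_ile1.
  by rewrite mulr_ile1// ?u1// ger0_norm ?mulr_ge0// mulr_ile1.
rewrite /quad_form big_distrr -sumrB /= big_distrl /=.
apply: le_trans (ler_norm_sum _ _ _) _; apply: ler_sum => j _.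
rewrite mulrDr opprD addrACA mulrDl; apply: le_trans (ler_normD _ _) _; apply: lerD.
  rewrite big_distrr -sumrB /= big_distrl /=.
  apply: le_trans (ler_norm_sum _ _ _) _; apply: ler_sum => i _.
  have -> : H j i * curve u t ord0 i * curve u t ord0 j -
    t ^+ 2 * (H j i * u ord0 i * u ord0 j) = H j i *
    (curve u t ord0 i * curve u t ord0 j - t ^+ 2 * (u ord0 i * u ord0 j)) by ring.
  by rewrite normrM -[leRHS]mulrA ler_wpM2l.
have -> : H j j * curve u t ord0 j ^+ 2 / 2 - t ^+ 2 * (H j j * u ord0 j ^+ 2 / 2) =
    H j j * ((curve u t ord0 j * curve u t ord0 j
      - t ^+ 2 * (u ord0 j * u ord0 j)) / 2) by field.
rewrite normrM -[leRHS]mulrA ler_wpM2l// normrM (@ger0_norm _ 2^-1)//.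
by have := prod j j; have := normr_ge0 (curve u t ord0 j * curve u t ord0 j
      - t ^+ 2 * (u ord0 j * u ord0 j)); lra.
Qed.

Variables (W : set 'rV[R]_n) (phi : 'rV[R]_n -> R) (y0 : 'rV[R]_n).
Hypotheses (oW : open W) (C2 : C2_on W phi) (Wy0 : W y0).
Local Notation D j := ('D_(basis_rV R j) phi).

Let cubeW : exists2 e, 0 < e & forall x, cube y0 e x -> W x.
Proof. by apply/nbhs_cubeP; exact: open_nbhs_nbhs. Qed.

Lemma locally_lipschitz : exists2 e, 0 < e & exists2 L, 0 < L &
  forall y y', cube y0 e y -> cube y0 e y' ->
    `|phi y' - phi y| <= L * \sum_j `|y' ord0 j - y ord0 j|.
Proof.
have [e1 e10 W1] := cubeW.
have [e2 e20 h2] : exists2 e, 0 < e & forall x, cube y0 e x ->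
    forall j : 'I_n, `|D j x - D j y0| <= 1.
  apply: (@cube_forall _ (fun j x => `|D j x - D j y0| <= 1)) => j.
  by apply: continuous_cube => //; have [_ /(_ j)[]] := C2 Wy0.
pose r := Num.min e1 e2.
have r0 : 0 < r by rewrite lt_min e10 e20.
(* Two points of this cube differ by at most [2 * (r / 3)] in each coordinate, so the path between
   them stays in the cube of radius [r]. *)
exists (r / 3); first by rewrite divr_gt0.
pose L := 1 + \sum_j `|D j y0|.
exists L; first by rewrite ltr_pwDl// sumr_ge0.
move=> y y' yr y'r.
have sub : cube y (2 * (r / 3)) `<=` cube y0 r by apply: (cube_sub yr); lra.
have z4 i : `|(y' - y) ord0 i| <= 2 * (r / 3).
  rewrite !mxE -(subrKA (y0 ord0 i)) (_ : 2 * (r / 3) = r / 3 + r / 3); last by ring.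
  apply: le_trans (ler_normD _ _) _; apply: lerD; first exact: y'r.
  by rewrite distrC; exact: yr.
have der x (j : 'I_n) : cube y (2 * (r / 3)) x -> (j < n)%N -> derivable phi x (basis_rV R j).
  move=> /sub xr _; have Wx : W x by apply: W1; apply: cubeS xr; rewrite ge_min lexx.
  by have [_ /(_ j)[]] := C2 Wx.
have bd x (j : 'I_n) : cube y (2 * (r / 3)) x -> (j < n)%N -> `|D j x - D j y0| <= 1.
  by move=> /sub xr _; apply: h2; apply: cubeS xr; rewrite ge_min lexx orbT.
have := first_order (leqnn n) der bd z4.
rewrite truncn (addrC y) subrK.
have full (f : 'I_n -> R) : \sum_(j < n | (j < n)%N) f j = \sum_j f j.
  by apply: eq_bigl => j; rewrite ltn_ord.
rewrite !full mul1r; set T := \sum_j `|y' ord0 j - _|.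
have -> : \sum_j `|(y' - y) ord0 j| = T by apply: eq_bigr => j _; rewrite !mxE.
move=> H.
have : `|\sum_j D j y0 * (y' - y) ord0 j| <= (\sum_j `|D j y0|) * T.
  rewrite big_distrl /=; apply: le_trans (ler_norm_sum _ _ _) _; apply: ler_sum => j _.
  by rewrite normrM ler_wpM2l// !mxE /T (bigD1 j)//= lerDl sumr_ge0.
move: H; set X := \sum_j _ => H1 H2.
rewrite -[phi y' - phi y](subrK X) /L mulrDl mul1r.
by apply: le_trans (ler_normD _ _) _; exact: lerD.
Qed.

Hypothesis nflat : ~ flat_at phi y0.

(** The variation of the second derivatives and the cubic error of [quad_form_curve] are each held
    to [|ka| t^2 / 8]. The total, a quarter of the monomial [ka t^2], is the tolerance allowed in
    counting small indices. *)
Lemma curve_expansion : exists (u : 'rV[R]_n) (ka : R),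
  [/\ forall l, `|u ord0 l| <= 1, ka != 0 &
    exists2 t0, 0 < t0 & forall t, 0 <= t -> t <= t0 ->
    `|phi (y0 + curve u t) - phi y0 - \sum_j D j y0 * curve u t ord0 j - ka * t ^+ 2|
      <= `|ka| * t ^+ 2 / 4].
Proof.
pose H (j i : 'I_n) := 'D_(basis_rV R i) (D j) y0.
have [i [j [ij Hji]]] : exists i j : 'I_n, (i <= j)%N /\ H j i != 0.
  apply: contrapT => N; apply: nflat => i j ij; apply/eqP; apply: contraT => Hn0.
  by exfalso; apply: N; exists i, j.
have [u u1 Qu] := quad_form_neq0 ij Hji.
set ka := quad_form H u in Qu.
exists u, ka; split => //.
have [C C0 QC] := quad_form_curve H u1.
pose N : R := n%:R.
have N0 : 0 <= N by rewrite ler0n.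
(* The squared coordinate sum of the curve is at most [4 N^2 t^2], and [4 N^2 dl <= |ka| / 8]. *)
pose dl := `|ka| / (32 * (N ^+ 2 + 1)).
have den : 0 < 32 * (N ^+ 2 + 1) by rewrite mulr_gt0// ltr_wpDl// sqr_ge0.
have ka0 : 0 < `|ka| by rewrite normr_gt0.
have dl0 : 0 < dl by rewrite divr_gt0.
have [e1 e10 W1] := cubeW.
have [e2 e20 h2] : exists2 e, 0 < e & forall x, cube y0 e x ->
    forall ij : 'I_n * 'I_n, `|'D_(basis_rV R ij.1) (D ij.2) x - H ij.2 ij.1| <= dl.
  apply: (@cube_forall _ (fun ij x => `|'D_(basis_rV R ij.1) (D ij.2) x - H ij.2 ij.1| <= dl)) => ab.
  by apply: continuous_cube => //; have [_ /(_ ab.2)[_ _ /(_ ab.1)[]]] := C2 Wy0.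
pose r := Num.min e1 e2.
have r0 : 0 < r by rewrite lt_min e10 e20.
have Cp : 0 < 8 * (C + 1) by rewrite mulr_gt0// ltr_wpDl.
exists (Num.min 1 (Num.min (r / 2) (`|ka| / (8 * (C + 1))))).
  by rewrite !lt_min ltr01 !divr_gt0.
move=> t t0; rewrite !le_min => /and3P[t1 tr tC].
have zr l : `|curve u t ord0 l| <= r.
  by apply: le_trans (curve_le l u1 t0 t1) _; rewrite mulrC -ler_pdivlMr.
have s1 (x : 'rV[R]_n) (a : 'I_n) : cube y0 r x -> derivable phi x (basis_rV R a).
  move=> xr; have Wx : W x by apply: W1; apply: cubeS xr; rewrite ge_min lexx.
  by have [_ /(_ a)[]] := C2 Wx.
have s2 (x : 'rV[R]_n) (a b : 'I_n) : cube y0 r x -> (a <= b)%N ->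
    derivable (D b) x (basis_rV R a).
  move=> xr _; have Wx : W x by apply: W1; apply: cubeS xr; rewrite ge_min lexx.
  by have [_ /(_ b)[_ _ /(_ a)[]]] := C2 Wx.
have s3 (x : 'rV[R]_n) (a b : 'I_n) : cube y0 r x -> (a <= b)%N ->
    `|'D_(basis_rV R a) (D b) x - H b a| <= dl.
  by move=> xr _; apply: (h2 x _ (a, b)); apply: cubeS xr; rewrite ge_min lexx orbT.
have := second_order (ltW r0) s1 s2 s3 zr.
set X := phi _ - phi y0 - _ => HX.
have sq : (\sum_l `|curve u t ord0 l|) ^+ 2 <= 4 * N ^+ 2 * t ^+ 2.
  have -> : 4 * N ^+ 2 * t ^+ 2 = (N * (2 * t)) ^+ 2 by ring.
  apply: lerXn2r; rewrite ?nnegrE ?mulr_ge0//; first exact: sumr_ge0.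
  apply: (@le_trans _ _ (\sum_(l < n) 2 * t)).
    by apply: ler_sum => l _; exact: curve_le.
  by rewrite sumr_const card_ord -[leLHS]mulr_natl.
have b1 : dl * (\sum_l `|curve u t ord0 l|) ^+ 2 <= `|ka| * t ^+ 2 / 8.
  apply: (@le_trans _ _ (dl * (4 * N ^+ 2 * t ^+ 2))); first by rewrite ler_pM2l.
  have -> : `|ka| * t ^+ 2 / 8 = dl * (4 * (N ^+ 2 + 1) * t ^+ 2).
    by rewrite /dl; field; apply: lt0r_neq0; rewrite ltr_wpDl// sqr_ge0.
  by rewrite ler_pM2l// ler_wpM2r ?sqr_ge0// ler_wpM2l// lerDl.
have b2 : C * t ^+ 3 <= `|ka| * t ^+ 2 / 8.
  have h : (C + 1) * t <= `|ka| / 8.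
    by move: tC; rewrite ler_pdivlMr//; lra.
  have := ler_wpM2r (sqr_ge0 t) h; rewrite (exprS t 2).
  have := mulr_ge0 t0 (sqr_ge0 t); move: (t ^+ 2) => T; nra.
have := QC t t0 t1; rewrite -/ka => HQ.
have -> : X - ka * t ^+ 2 = (X - quad_form H (curve u t)) +
  (quad_form H (curve u t) - t ^+ 2 * ka) by ring.
apply: le_trans (ler_normD _ _) _; lra.
Qed.
End local_expansion.

(** * Lacunary points on the hypersurface *)

Lemma enorm1_coord (R : realType) n (v : 'rV[R]_n.+1) : enorm v = 1 ->
  exists j, n.+1%:R^-1 <= `|v ord0 j|.
Proof.
move=> v1; apply: contrapT => N.
have small j : `|v ord0 j| < n.+1%:R^-1.
  by rewrite ltNge; apply/negP => h; apply: N; exists j.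
have : dotv v v = 1.
  have : 0 <= dotv v v by apply: sumr_ge0 => j _; rewrite -expr2 sqr_ge0.
  by move=> /sqr_sqrtr; rewrite -/(enorm v) v1 expr1n.
apply/eqP; rewrite lt_eqF// /dotv.
have n1 : n.+1%:R^-1 <= 1 :> R by rewrite invf_le1 ?ltr0n// ler1n.
apply: (@lt_le_trans _ _ (\sum_(j < n.+1) n.+1%:R^-1)); last first.
  by rewrite sumr_const card_ord -[leLHS]mulr_natr mulVf// pnatr_eq0.
apply: ltr_sum; first by apply/hasP; exists ord0 => //; rewrite mem_index_enum.
move=> j _; rewrite -expr2 -real_normK ?num_real// expr2.
apply: le_lt_trans (small j); rewrite ler_piMr//.
by apply: le_trans (ltW (small j)) _.
Qed.

(** The interface between geometry and analysis. The points lie in the half-size cube so that caps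
    of radius up to [e0 / 2] stay where [S] is a Lipschitz graph. The exceptional set [E] may depend
    on [v]; its size bound [K] and the constants of the gap do not. *)
Record lacunary_chart (R : realType) n (S : set 'rV[R]_n.+1) (k : 'I_n.+1)
    (phi : 'rV[R]_n -> R) (x0 : 'rV[R]_n.+1) (e0 L : R)
    (eta : nat -> 'rV[R]_n.+1) (K P : nat) (c0 t0 q : R) : Prop := {
  lc_e0 : 0 < e0;
  lc_L : 0 < L;
  lc_graph : forall z, cube x0 e0 z -> (S z <-> z ord0 k = phi (col' k z));
  lc_lip : forall y y', cube (col' k x0) e0 y -> cube (col' k x0) e0 y' ->
    `|phi y' - phi y| <= L * \sum_j `|y' ord0 j - y ord0 j|;
  lc_x0 : S x0;
  lc_eta : forall i, S (x0 + eta i) /\ cube x0 (e0 / 2) (x0 + eta i);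
  lc_c0 : 0 < c0;
  lc_t0 : 0 < t0 <= 1;
  lc_q : 0 < q <= 1;
  lc_lacunary : forall v, enorm v = 1 -> exists E : pred nat,
    (forall l, uniq l -> (count E l <= K)%N) /\
    forall N l, sorted ltn l -> all (fun i => i <= N)%N l -> all (predC E) l ->
      lacunary (c0 * (t0 * q ^+ N) ^+ P) (map (fun i => dotv v (eta i)) l)
}.

Lemma lacunary_chartP (R : realType) n (S : set 'rV[R]_n.+1) :
  C2_hypersurface S -> not_in_hyperplane S ->
  exists k phi x0 e0 L eta K P c0 t0 q,
    @lacunary_chart R n S k phi x0 e0 L eta K P c0 t0 q.
Proof.
move=> Shyp nH.
have [k [U [W [phi [h [x0 [ch Ux Sx hx nf]]]]]]] := nonflat_chart Shyp nH.
have [[oU oW UW] [C2 C2h reg US]] := ch.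
have Wy := UW _ Ux.
have [xk hx0] := (US _ Ux).1 Sx.
set y0 := col' k x0 in hx nf Wy xk hx0.
have [e1 e10 [e1U e1W]] := chart_nbhd ch Ux Sx oU Ux.
have h2 : 0 < h y0 / 2 by rewrite divr_gt0.
have [e2 e20 hh] := continuous_cube (C2h _ Wy).1 h2.
have [e3 e30 [L L0 lip]] := locally_lipschitz oW C2 Wy.
pose e0 := Num.min e1 (Num.min e2 e3).
have e00 : 0 < e0 by rewrite !lt_min e10 e20 e30.
have hpos y : cube y0 e0 y -> 0 < h y.
  move=> ye; have /hh : cube y0 e2 y by apply: cubeS ye; rewrite !ge_min lexx orbT.
  by rewrite ler_norml => /andP[]; lra.
have graph z : cube x0 e0 z -> (S z <-> z ord0 k = phi (col' k z)).
  move=> ze; have [Uz _] : (U `&` U) z by apply: e1U; apply: cubeS ze; rewrite ge_min lexx.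
  split; first by move=> /(US _ Uz).1[].
  by move=> zk; apply/US => //; split => //; apply: ltW; apply: hpos; exact: cube_col'.
have lip' y y' : cube y0 e0 y -> cube y0 e0 y' ->
    `|phi y' - phi y| <= L * \sum_j `|y' ord0 j - y ord0 j|.
  by move=> ye y'e; apply: lip; [apply: cubeS ye|apply: cubeS y'e];
    rewrite !ge_min lexx !orbT.
have [u [ka [u1 ka0 [t1 t10 ex]]]] := curve_expansion oW C2 Wy nf.
(* The bounds in terms of [e0] keep the curve, and by the Lipschitz estimate the graph above it,
   within [e0 / 2] of the base point. *)
pose t0 := Num.min 1 (Num.min t1 (Num.min (e0 / 4) (e0 / (4 * L * (n%:R + 1))))).
have n0 : 0 < n%:R + 1 :> R by rewrite ltr_wpDl// ler0n.
have t00 : 0 < t0 by rewrite !lt_min ltr01 t10 !divr_gt0// !mulr_gt0.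
have t01 : t0 <= 1 by rewrite ge_min lexx.
pose P := n.+2.
pose q : R := (64 * P%:R ^+ 2)^-1.
have P2 : 0 < 64 * P%:R ^+ 2 :> R by rewrite mulr_gt0// exprn_gt0// ltr0n.
have q0 : 0 < q by rewrite invr_gt0.
have qP : 64 * P%:R ^+ 2 * q <= 1 by rewrite mulfV// gt_eqF.
have q1 : q <= 1.
  rewrite invf_le1// -[leLHS]mulr1 ler_pM//; first by rewrite ler1n.
  by rewrite expr_ge1// ler1n.
pose t i := t0 * q ^+ i.
have tgt0 i : 0 < t i by rewrite mulr_gt0// exprn_gt0.
have tt0 i : t i <= t0 by rewrite ler_piMr ?(ltW t00)// exprn_ile1// ltW.
have tt1 i : t i <= 1 by apply: le_trans (tt0 i) t01.
pose eta i := graph_pt k (y0 + curve u (t i)) (phi (y0 + curve u (t i))) - x0.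
have curve_e i : cube y0 (e0 / 2) (y0 + curve u (t i)).
  move=> j; rewrite !mxE addrAC subrr add0r; have := curve_le j u1 (ltW (tgt0 i)) (tt1 i).
  rewrite mxE => /le_trans; apply.
  have := tt0 i; have : t0 <= e0 / 4 by rewrite !ge_min lexx !orbT.
  by lra.
have curve_e' i : cube y0 e0 (y0 + curve u (t i)).
  by apply: cubeS (curve_e i); lra.
have etaE i : x0 + eta i = graph_pt k (y0 + curve u (t i)) (phi (y0 + curve u (t i))).
  by rewrite addrC subrK.
have phi_e i : `|phi (y0 + curve u (t i)) - phi y0| <= e0 / 2.
  apply: le_trans (lip' _ _ (cube_center _ (ltW e00)) (curve_e' i)) _.
  apply: (@le_trans _ _ (L * \sum_(j < n) 2 * t0)).
    rewrite ler_pM2l//; apply: ler_sum => j _.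
    rewrite mxE (addrC (y0 ord0 j)) addrK.
    apply: le_trans (curve_le j u1 (ltW (tgt0 i)) (tt1 i)) _.
    by rewrite ler_pM2l.
  rewrite sumr_const card_ord -[_ *+ n]mulr_natl.
  have : t0 <= e0 / (4 * L * (n%:R + 1)) by rewrite !ge_min lexx !orbT.
  rewrite ler_pdivlMr ?mulr_gt0//.
  have := mulr_gt0 t00 L0; lra.
have cube_eta i : cube x0 (e0 / 2) (x0 + eta i).
  by rewrite etaE; apply: cube_graph_pt => //; rewrite xk.
have S_eta i : S (x0 + eta i).
  apply/graph; first by apply: cubeS (cube_eta i); lra.
  by rewrite etaE graph_pt_k col'_graph_pt.
pose G j := 'D_(basis_rV R j) phi y0.
pose al (v : 'rV[R]_n.+1) j := v ord0 (lift k j) + v ord0 k * G j.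
(* [A v p] is the coefficient of [t ^ p.+1] in [v . eta]: the component along [u] for [p = 0],
   [v_k * ka] for [p = 1], the tangential component [al v j] for [p = j + 2]. *)
pose A v (p : 'I_P) := if unlift ord0 p is Some p' then
    (if unlift ord0 p' is Some j then al v j else v ord0 k * ka)
  else \sum_j al v j * u ord0 j.
have sumA v (f : nat -> R) : \sum_(p < P) A v p * f p =
    (\sum_j al v j * u ord0 j) * f 0%N + (v ord0 k * ka) * f 1%N +
    \sum_j al v j * f (j.+2).
  rewrite /P !big_ord_recl -addrA; congr (_ + (_ + _)).
  - by rewrite /A unlift_none.
  - by rewrite /A liftK unlift_none.
  - by apply: eq_bigr => j _; rewrite /A !liftK.
(* If every [|A v p|] were below [c1], every coordinate of [v] would be below [1 / (n + 1)] in
   absolute value, contradicting [enorm1_coord]. *)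
pose c1 := n.+1%:R^-1 / (1 + `|ka|^-1 * (1 + \sum_j `|G j|)).
have nka : 0 < `|ka| by rewrite normr_gt0.
have den0 : 0 < 1 + `|ka|^-1 * (1 + \sum_j `|G j|).
  by rewrite ltr_wpDr// mulr_ge0// ?invr_ge0// addr_ge0// sumr_ge0.
have c10 : 0 < c1 by rewrite divr_gt0// invr_gt0 ltr0n.
have Ac v : enorm v = 1 -> exists p, c1 <= `|A v p|.
  move=> v1; apply: contrapT => N.
  have small p : `|A v p| < c1.
    by rewrite ltNge; apply/negP => hp; apply: N; exists p.
  have vk : `|v ord0 k| <= c1 * `|ka|^-1.
    rewrite ler_pdivlMr// -normrM ltW//.
    by have := small (lift ord0 ord0); rewrite /A liftK unlift_none.
  have vj j : `|al v j| <= c1.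
    by rewrite ltW//; have := small (lift ord0 (lift ord0 j)); rewrite /A !liftK.
  have [j] := enorm1_coord v1; rewrite leNgt => /negP; apply.
  have c1E : n.+1%:R^-1 = c1 + c1 * `|ka|^-1 * (1 + \sum_j `|G j|).
    by rewrite -mulrA -[X in X + _]mulr1 -mulrDr /c1 mulfVK// gt_eqF.
  have SG : 0 <= \sum_j `|G j| by rewrite sumr_ge0.
  have ck0 : 0 <= c1 * `|ka|^-1 by rewrite mulr_ge0 ?invr_ge0// ltW.
  rewrite c1E; case: (unliftP k j) => [i|] ->; last first.
    by apply: le_lt_trans vk _; rewrite mulrDr mulr1; have := mulr_ge0 ck0 SG; lra.
  have -> : v ord0 (lift k i) = al v i - v ord0 k * G i by rewrite /al addrK.
  apply: le_lt_trans (ler_normB _ _) _.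
  rewrite normrM.
  have : `|v ord0 k| * `|G i| <= c1 * `|ka|^-1 * \sum_j `|G j|.
    by rewrite ler_pM// (bigD1 i)//= lerDl sumr_ge0.
  have : 0 < c1 * `|ka|^-1 by rewrite mulr_gt0// invr_gt0.
  by have := vj i; lra.
(* The only error is that of [phi], multiplied by [v_k]; it is at most a quarter of the [t ^ 2] term
   on the right. *)
have sM v i : `|dotv v (eta i) - \sum_(p < P) A v p * t i ^+ p.+1| <=
    (\sum_(p < P) `|A v p| * t i ^+ p.+1) / 4.
  have -> : dotv v (eta i) = v ord0 k * (phi (y0 + curve u (t i)) - phi y0) +
     \sum_j v ord0 (lift k j) * curve u (t i) ord0 j.
    rewrite /dotv (sum_lift k); congr (_ + _).
      by rewrite /eta mxE graph_pt_k mxE xk.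
    apply: eq_bigr => j _; rewrite /eta mxE graph_pt_lift !mxE; congr (_ * _).
    by rewrite (addrC (x0 _ _)) addrK.
  rewrite (sumA v (fun p => t i ^+ p.+1)).
  set ps := phi _ - phi y0.
  have -> : (\sum_j al v j * u ord0 j) * t i ^+ 1 + v ord0 k * ka * t i ^+ 2 +
      \sum_(j < n) al v j * t i ^+ j.+3 = v ord0 k * ka * t i ^+ 2 +
      \sum_j al v j * curve u (t i) ord0 j.
    rewrite addrAC addrC; congr (_ + _); rewrite big_distrl -big_split /=.
    by apply: eq_bigr => j _; rewrite mxE expr1; ring.
  have -> : v ord0 k * ps + \sum_j v ord0 (lift k j) * curve u (t i) ord0 j -
     (v ord0 k * ka * t i ^+ 2 + \sum_j al v j * curve u (t i) ord0 j) =
     v ord0 k * (ps - \sum_j G j * curve u (t i) ord0 j - ka * t i ^+ 2).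
    have -> : \sum_j al v j * curve u (t i) ord0 j =
       \sum_j v ord0 (lift k j) * curve u (t i) ord0 j +
       v ord0 k * \sum_j G j * curve u (t i) ord0 j.
      rewrite big_distrr -big_split /=; apply: eq_bigr => j _.
      by rewrite /al mulrDl mulrA.
    by ring.
  have t1i : t i <= t1 by apply: le_trans (tt0 i) _; rewrite !ge_min lexx orbT.
  rewrite normrM; apply: le_trans (ler_wpM2l (normr_ge0 _) (ex _ (ltW (tgt0 i)) t1i)) _.
  rewrite mulrA ler_pM2r ?invr_gt0//.
  rewrite (bigD1 (lift ord0 ord0))//= {1}/A liftK unlift_none normrM -mulrA.
  rewrite lerDl sumr_ge0// => p _; rewrite mulr_ge0// exprn_ge0// ltW//.
exists k, phi, x0, e0, L, eta, (P * P)%N, P, (c1 / 8), t0, q; split => //.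
- by rewrite divr_gt0.
- by rewrite t00 t01.
- by rewrite q0 q1.
move=> v v1; exists (small_index (A v) t0 q (fun i => dotv v (eta i))); split.
  move=> l ul; exact: (count_small_index t00 t01 q0 qP c10 (Ac v v1) (sM v) ul).
move=> N l sl lN lE.
exact: (lacunary_monomials t00 t01 q0 qP c10 (Ac v v1) (sM v) sl lN lE).
Qed.

(** * Measurability and Hausdorff measure bounds *)

Section borel.
Variables (R : realType) (n : nat).
Implicit Types (x y : 'rV[R]_n).

Lemma cube_box y (e : R) : cube y e =
  [set x | forall i, (\row_j (y ord0 j - e)) ord0 i <= x ord0 i
                     <= (\row_j (y ord0 j + e)) ord0 i].
Proof.
apply/seteqP; split=> x xe i; have := xe i; rewrite !mxE ler_distl//.
Qed.

Lemma measurable_cube y (e : R) : measurable (cube y e).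
Proof. by rewrite cube_box; exact: measurable_box. Qed.

Lemma lebesgue_cube y (e : R) : 0 <= e -> lebesgue_rV R n (cube y e) = ((2 * e) ^+ n)%:E.
Proof.
move=> e0; rewrite cube_box lebesgue_rV_box; last by move=> i; rewrite !mxE; lra.
rewrite (eq_bigr (fun=> 2 * e)); last by move=> i _; rewrite !mxE; ring.
by rewrite prodr_const card_ord.
Qed.

(** The sigma-algebra is generated by the coordinates, so an open set is written as a countable
    union of cubes with rational centres and radii [1 / (m + 1)]. *)
Lemma open_measurable_rV (U : set 'rV[R]_n) : open U -> measurable U.
Proof.
move=> oU.
pose dd (m : nat) : R := m.+1%:R^-1.
pose c (p : 'rV[rat]_n * nat) := cube (map_mx ratr p.1 : 'rV[R]_n) (dd p.2).
pose F p := if `[< c p `<=` U >] then c p else set0.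
have -> : U = \bigcup_p F p.
  apply/seteqP; split=> x; last first.
    by move=> [p _]; rewrite /F; case: asboolP => // cU /cU.
  move=> Ux; have [e e0 eU] : exists2 e, 0 < e & cube x e `<=` U.
    by apply/nbhs_cubeP; exact: open_nbhs_nbhs.
  have e20 : 0 < e / 2 by rewrite divr_gt0.
  have [m] := ltr_add_invr e20; rewrite add0r -/(dd m) => me.
  have m0 : 0 < dd m by rewrite invr_gt0 ltr0n.
  have ex i : exists q : rat, x ord0 i - dd m < ratr q < x ord0 i + dd m.
    have /rat_in_itvoo[q] : x ord0 i - dd m < x ord0 i + dd m.
      by lra.
    by rewrite in_itv /= => ?; exists q.
  have [g hg] := choice ex.
  exists (\row_i g i, m) => //; rewrite /F.
  have xc : c (\row_i g i, m) x.
    move=> i; rewrite !mxE /=; have := hg i; rewrite ler_distl => /andP[h1 h2].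
    by apply/andP; split; lra.
  case: asboolP => // -[] z zc; apply: eU => i.
  have := xc i; have := zc i; rewrite /= !mxE => h1 h2.
  rewrite -(subrKA (ratr (g i))); apply: le_trans (ler_normD _ _) _.
  by rewrite (distrC (ratr _)); lra.
apply: countable_bigcupT_measurable; first exact: countableP.
by move=> p; rewrite /F; case: asboolP => // _; exact: measurable_cube.
Qed.

Lemma closed_measurable_rV (A : set 'rV[R]_n) : closed A -> measurable A.
Proof.
move=> cA; rewrite -[A]setCK; apply: measurableC; apply: open_measurable_rV.
exact: closed_openC.
Qed.

Lemma measurable_dotv (v : 'rV[R]_n) : measurable_fun setT (fun x => dotv v x).
Proof.
apply: measurable_sum => i; apply: measurable_funM; first exact: measurable_cst.
exact: measurable_coord_rV.
Qed.

Lemma enorm_le_sum x : enorm x <= \sum_i `|x ord0 i|.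
Proof.
have S0 : 0 <= \sum_i `|x ord0 i| by apply: sumr_ge0.
rewrite -(ger0_norm S0) -sqrtr_sqr ler_wsqrtr// /dotv expr2 big_distrl /=.
apply: ler_sum => i _; rewrite -expr2 -real_normK ?num_real// expr2 ler_wpM2l//.
by rewrite (bigD1 i)//= lerDl sumr_ge0.
Qed.

Lemma measurable_unit_ball : measurable [set x : 'rV[R]_n | enorm x <= 1].
Proof.
have -> : [set x : 'rV[R]_n | enorm x <= 1] = (fun x => dotv x x) @^-1` `]-oo, 1].
  have E (x : 'rV[R]_n) : (enorm x <= 1) = (dotv x x <= 1).
    by rewrite /enorm -[X in _ <= X]sqrtr1 ler_sqrt.
  by apply/seteqP; split=> x; rewrite /= in_itv /= E.
rewrite -[X in measurable X]setTI.
have : measurable_fun setT (fun x : 'rV[R]_n => dotv x x).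
  by apply: measurable_sum => i; apply: measurable_funM; exact: measurable_coord_rV.
by apply => //; exact: measurable_itv.
Qed.
End borel.

(** The ball lies between two cubes. The outer one is there because [fine] would turn an infinite
    volume into 0. *)
Lemma ball_volume_gt0 (R : realType) n : 0 < ball_volume R n.
Proof.
have n1 : 0 < n.+1%:R^-1 :> R by rewrite invr_gt0 ltr0n.
have lb : (((2 * n.+1%:R^-1) ^+ n)%:E <= lebesgue_rV R n [set x | enorm x <= 1]%R)%E.
  rewrite -(@lebesgue_cube R n 0)//.
  apply: le_measure; rewrite ?inE; [exact: measurable_cube|exact: measurable_unit_ball|].
  move=> x xe; apply: le_trans (enorm_le_sum x) _.
  apply: (@le_trans _ _ (\sum_(i < n) n.+1%:R^-1)).
    by apply: ler_sum => i _; have := xe i; rewrite mxE subr0.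
  by rewrite sumr_const card_ord -[leLHS]mulr_natr ler_pdivrMl ?ltr0n// mulr1 ler_nat.
have ub : (lebesgue_rV R n [set x | enorm x <= 1]%R <= ((2 * 1) ^+ n)%:E)%E.
  rewrite -(@lebesgue_cube R n 0)//.
  apply: le_measure; rewrite ?inE; [exact: measurable_unit_ball|exact: measurable_cube|].
  move=> x xe i; rewrite mxE subr0; exact: le_trans (enorm_coord _ _) xe.
rewrite /ball_volume fine_gt0//; apply/andP; split.
  by apply: lt_le_trans lb; rewrite lte_fin exprn_gt0// mulr_gt0.
by apply: le_lt_trans ub _; rewrite ltry.
Qed.

Section hausdorff_bounds.
Variables (R : realType) (n : nat).
Local Open Scope ereal_scope.

(* The projection along a coordinate is 1-Lipschitz, and a set of diameter D has
   volume at most (2 D)^n. *)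
Lemma hausdorff_ge_projection (k : 'I_n.+1) (A : set 'rV[R]_n.+1) y rho : (0 <= rho)%R ->
  (forall y', cube y rho y' -> exists2 z, A z & col' k z = y') ->
  (ball_volume R n / 4 ^+ n * (2 * rho) ^+ n)%:E <= hausdorff n A.
Proof.
move=> rho0 Ay.
(* Any single scale bounds the measure from below, and a finite one keeps the diameters of the
   covering sets finite. *)
apply: (@le_trans _ _ (hausdorff_pre n 1 A)); last first.
  by apply: ereal_sup_ubound; exists 1%R => /=.
have bv0 := ball_volume_gt0 R n.
have c0 : (0 <= ball_volume R n / 4 ^+ n)%R by rewrite divr_ge0 ?exprn_ge0// ltW.
apply: le_ereal_inf_tmp => _ [F [dF AF] <-].
have ex i : exists G : set 'rV[R]_n, [/\ measurable G,
    forall z, F i z -> G (col' k z) &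
    (ball_volume R n / 4 ^+ n)%:E * lebesgue_rV R n G <= hausdorff_cost n (F i)].
  have [F0|/set0P[p Fp]] := eqVneq (F i) set0.
    by exists set0; split => //; [rewrite F0|rewrite measure0 mule0 hausdorff_cost_ge0].
  have d0 : 0 <= diam (F i).
    apply: ereal_sup_ubound; exists p => //; exists p => //.
    by rewrite subrr /enorm /dotv big1 ?sqrtr0// => j _; rewrite mxE mul0r.
  have dfin : diam (F i) \is a fin_num.
    by rewrite ge0_fin_numE// (le_lt_trans (dF i))// ltry.
  set D := fine (diam (F i)).
  have D0 : (0 <= D)%R by exact: fine_ge0.
  (* Its volume [(2 D)^n] is [4^n] times the [(D / 2)^n] in the cost, whence the constant. *)
  exists (cube (col' k p) D); split; first exact: measurable_cube.
    move=> z Fz; apply: cube_col' => j.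
    have := enorm_coord (z - p) j; rewrite !mxE => /le_trans; apply.
    rewrite -lee_fin /D fineK//; apply: ereal_sup_ubound.
    by exists z => //; exists p.
  rewrite lebesgue_cube// /hausdorff_cost; case: asboolP => [F0|_].
    by move: Fp; rewrite F0.
  rewrite -EFinM lee_fin -/D le_eqVlt; apply/orP; left; apply/eqP.
  rewrite -mulrA; congr (_ * _)%R; rewrite -exprVn -exprMn; congr (_ ^+ _)%R.
  by field.
have [G hG] := choice ex.
rewrite EFinM -(@lebesgue_cube R n y)//.
have sub : cube y rho `<=` \bigcup_i G i.
  move=> y' /Ay[z Az <-]; have [i _ Fz] := AF _ Az.
  by exists i => //; have [_ h _] := hG i; exact: h.
have mG i : measurable (G i) by have [] := hG i.
have le1 : lebesgue_rV R n (cube y rho) <= \sum_(i <oo) lebesgue_rV R n (G i).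
  exact: (@measure_sigma_subadditive _ _ _ (lebesgue_rV R n) _ _ mG (measurable_cube _ _) sub).
apply: le_trans (lee_wpmul2l _ le1) _; first by rewrite lee_fin.
rewrite -nneseriesZl//; apply: lee_nneseries => i _.
  by rewrite mule_ge0 ?lee_fin.
by have [] := hG i.
Qed.

Lemma unit_segment_cover N (s : R) : (0 <= s)%R -> (s <= N.+1%:R)%R ->
  exists a : 'I_N.+1, (a%:R <= s <= a%:R + 1)%R.
Proof.
elim: N => [|N ih] s0 sN; first by exists ord0; rewrite s0 add0r.
have [sN1|Ns] := leP s N.+1%:R.
  by have [a ha] := ih s0 sN1; exists (widen_ord (leqnSn _) a).
by exists ord_max; rewrite /= (ltW Ns) natr1.
Qed.

(** Dividing the base cube into [(N + 1)^n] equal cubes cuts the graph into pieces of diameter at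
    most [D / (N + 1)], so the total cost is at most [ball_volume * (D / 2)^n] at every scale. *)
Lemma hausdorff_graph_lty (k : 'I_n.+1) (phi : 'rV[R]_n -> R) (y0 : 'rV[R]_n) rho L
    (A : set 'rV[R]_n.+1) : (0 < rho)%R -> (0 < L)%R ->
  (forall y y', cube y0 rho y -> cube y0 rho y' ->
    (`|phi y' - phi y| <= L * \sum_j `|y' ord0 j - y ord0 j|)%R) ->
  (forall z, A z -> cube y0 rho (col' k z) /\ z ord0 k = phi (col' k z)) ->
  hausdorff n A < +oo.
Proof.
move=> rho0 L0 lip gA.
pose D : R := ((L + 1) * (n%:R * (2 * rho)))%R.
have D0 : (0 <= D)%R by rewrite !mulr_ge0// ?addr_ge0// ltW.
have bv0 := ball_volume_gt0 R n.
apply: (@le_lt_trans _ _ (ball_volume R n * (D / 2) ^+ n)%:E); last by rewrite ltry.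
apply: ge_ereal_sup => _ [dl /= dl0 <-].
have [N DN] : exists N, (D / N.+1%:R <= dl)%R.
  have D1 : (0 < D + 1)%R by rewrite ltr_wpDl.
  have [N] := ltr_add_invr (divr_gt0 dl0 D1); rewrite add0r ltr_pdivlMr// mulrC => hN.
  exists N; apply: le_trans (ltW hN); rewrite ler_wpM2r//.
  by rewrite lerDl.
pose h : R := (2 * rho / N.+1%:R)%R.
have h0 : (0 < h)%R by rewrite divr_gt0 ?ltr0n// mulr_gt0.
pose T := {ffun 'I_n -> 'I_N.+1}.
pose piece (f : T) : set 'rV[R]_n.+1 := [set z | A z /\ forall i,
  (y0 ord0 i - rho + (f i)%:R * h <= col' k z ord0 i <= y0 ord0 i - rho + (f i)%:R * h + h)%R].
have piece_d f z z' : piece f z -> piece f z' -> (enorm (z - z') <= D / N.+1%:R)%R.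
  move=> [Az zf] [Az' zf'].
  have ci i : (`|col' k z ord0 i - col' k z' ord0 i| <= h)%R.
    by rewrite ler_norml; have := zf i; have := zf' i; lra.
  have sumh : (\sum_i `|col' k z ord0 i - col' k z' ord0 i| <= n%:R * h)%R.
    apply: (@le_trans _ _ (\sum_(i < n) h)%R); first exact: ler_sum.
    by rewrite sumr_const card_ord mulr_natl.
  apply: le_trans (enorm_le_sum _) _; rewrite (sum_lift k).
  have [cz zk] := gA _ Az; have [cz' z'k] := gA _ Az'.
  have : (`|(z - z') ord0 k| <= L * (n%:R * h))%R.
    rewrite !mxE zk z'k; apply: le_trans (lip _ _ cz' cz) _.
    by rewrite ler_pM2l.
  rewrite (eq_bigr (fun i => `|col' k z ord0 i - col' k z' ord0 i|%R)); last first.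
    by move=> i _; rewrite !mxE.
  have -> : (D / N.+1%:R = L * (n%:R * h) + n%:R * h)%R by rewrite /D /h; ring.
  by move=> h1; exact: lerD.
pose F m := if insub m is Some i then piece (enum_val (i : 'I_#|T|)) else set0.
apply: (@le_trans _ _ (\sum_(m <oo) hausdorff_cost n (F m))).
  apply: ereal_inf_lbound; exists F => //; split.
    move=> m; rewrite /F; case: insubP => [i _ _|_]; last by rewrite diam0 leNye.
    apply: ge_ereal_sup => _ [z Fz [z' Fz' <-]]; rewrite lee_fin.
    exact: le_trans (piece_d _ _ _ Fz Fz') _.
  move=> z Az; have [cz _] := gA _ Az.
  have ex i : exists a : 'I_N.+1,
      (y0 ord0 i - rho + a%:R * h <= col' k z ord0 i <= y0 ord0 i - rho + a%:R * h + h)%R.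
    have := cz i; rewrite ler_norml => /andP[z1 z2].
    have [||a /andP[a1 a2]] := @unit_segment_cover N ((col' k z ord0 i - y0 ord0 i + rho) / h).
    - by rewrite divr_ge0 ?(ltW h0)//; lra.
    - rewrite ler_pdivrMr// /h mulrCA divff ?pnatr_eq0// mulr1; lra.
    - exists a; move: a1 a2; rewrite ler_pdivlMr// ler_pdivrMr// mulrDl mul1r; lra.
  have [g hg] := choice ex.
  have lt : (enum_rank [ffun i => g i] < #|T|)%N by exact: ltn_ord.
  exists (enum_rank [ffun i => g i]) => //; rewrite /F insubT /=.
  rewrite (_ : Sub _ _ = enum_rank [ffun i => g i]); last by apply/val_inj.
  by rewrite enum_rankK; split => // i; rewrite ffunE.
rewrite (nneseries_split 0 #|T|); last by move=> *; exact: hausdorff_cost_ge0.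
rewrite add0n [X in _ + X]eseries0 ?adde0; last first.
  by move=> m Tm _; rewrite /F insubF ?hausdorff_cost0// ltnNge Tm.
apply: (@le_trans _ _ (\sum_(0 <= m < #|T|) (ball_volume R n * (D / N.+1%:R / 2) ^+ n)%:E)).
  apply: lee_sum => m _; rewrite /hausdorff_cost; case: asboolP => [_|/eqP/set0P[p Fp]].
    by rewrite lee_fin mulr_ge0 ?(ltW bv0)// exprn_ge0// !divr_ge0.
  rewrite lee_fin ler_pM2l// lerXn2r// ?nnegrE.
  - rewrite divr_ge0// fine_ge0//; apply: ereal_sup_ubound; exists p => //; exists p => //.
    by rewrite subrr /enorm /dotv big1 ?sqrtr0// => j _; rewrite mxE mul0r.
  - by rewrite !divr_ge0.
  - rewrite ler_pM2r ?invr_gt0//.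
    have d1 : diam (F m) <= (D / N.+1%:R)%:E.
      move: Fp; rewrite /F; case: insubP => // i _ _ _.
      by apply: ge_ereal_sup => _ [z Fz [z' Fz' <-]]; rewrite lee_fin; exact: piece_d Fz Fz'.
    have d0 : 0 <= diam (F m).
      apply: ereal_sup_ubound; exists p => //; exists p => //.
      by rewrite subrr /enorm /dotv big1 ?sqrtr0// => j _; rewrite mxE mul0r.
    rewrite -lee_fin fineK// ge0_fin_numE//; apply: le_lt_trans d1 _; exact: ltry.
rewrite sumEFin lee_fin sumr_const_nat subn0 card_ffun !card_ord.
rewrite -[leLHS]mulr_natl natrX mulrCA -exprMn ler_pM2l//.
rewrite (_ : N.+1%:R * (D / N.+1%:R / 2) = D / 2)%R//.
by rewrite mulrA (mulrCA _ D) divff ?pnatr_eq0// mulr1.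
Qed.
End hausdorff_bounds.

(** * The weight and its line integrals *)

Section nonmeasurable_monotony.
Local Open Scope ereal_scope.
Context d (T : measurableType d) (R : realType) (mu : {measure set T -> \bar R}).

(* No measurability is needed, the integral of a nonnegative function being a
   supremum over the simple functions below it. *)
Lemma ge0_le_integral_patch (D1 D2 : set T) (f g : T -> \bar R) :
  (forall x, 0 <= f x) -> (forall x, 0 <= g x) ->
  (forall x, D1 x -> D2 x /\ f x <= g x) ->
  \int[mu]_(x in D1) f x <= \int[mu]_(x in D2) g x.
Proof.
move=> f0 g0 fg.
rewrite !ge0_integralE//.
apply: ge_ereal_sup => _ [h hf <-]; apply: ereal_sup_ubound; exists h => // x.
apply: le_trans (hf x) _; rewrite !patchE; case: ifPn => [/set_mem/fg[/mem_set -> //]|_].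
by case: ifP.
Qed.
End nonmeasurable_monotony.

Section riesz.
Variables (R : realType).

Lemma lacunary_scale (c tau : R) (s : seq R) : 1 <= c -> 0 <= tau ->
  lacunary tau s -> lacunary tau (map ( *%R c) s).
Proof.
move=> c1 tau0; have c0 : 0 <= c by exact: le_trans c1.
elim: s => //= x s ih /andP[h /ih ->]; rewrite andbT big_map normrM (ger0_norm c0).
rewrite (eq_bigr (fun y => c * `|y|)); last by move=> y _; rewrite normrM (ger0_norm c0).
rewrite -big_distrr /=; move: h; have : 0 <= \sum_(y <- s) `|y| by apply: sumr_ge0.
by move: (\sum_(y <- s) _) (`|x|) => S X; nra.
Qed.

Definition riesz n (eta : nat -> 'rV[R]_n) (l : seq nat) (x : 'rV[R]_n) : R :=
  \prod_(i <- l) (1 + cos (2 * pi * dotv x (eta i))).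

Variables (n : nat) (eta : nat -> 'rV[R]_n.+1).
Implicit Types (a v x : 'rV[R]_n.+1) (l : seq nat).

Lemma dotv_line a v (t : R) (p : 'rV[R]_n.+1) : dotv (a + t *: v) p = dotv v p * t + dotv a p.
Proof.
rewrite /dotv big_distrl -big_split /=; apply: eq_bigr => i _.
by rewrite !mxE; ring.
Qed.

Lemma riesz_ge0 l x : 0 <= riesz eta l x.
Proof.
by apply: prodr_ge0 => i _; have := cos_geN1 (2 * pi * dotv x (eta i)); lra.
Qed.

Lemma riesz_filter (E : pred nat) l x :
  riesz eta l x <= 2 ^+ (count E l) * riesz eta (seq.filter (predC E) l) x.
Proof.
rewrite /riesz; elim: l => [|i l ih] /=; first by rewrite !big_nil expr0 mul1r.
have c1 := cos_le1 (2 * pi * dotv x (eta i)).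
have c2 := cos_geN1 (2 * pi * dotv x (eta i)).
rewrite big_cons; case: (E i); rewrite /= ?big_cons.
  rewrite add1n exprS -[leRHS]mulrA; move: (cos _) c1 c2 => c c1 c2.
  have c0 : 0 <= 1 + c by rewrite -lerBlDl sub0r.
  have c2' : 1 + c <= 2 by lra.
  apply: ler_pM => //; exact: riesz_ge0.
rewrite add0n [leRHS]mulrCA; move: (cos _) c1 c2 => c c1 c2.
by rewrite ler_wpM2l// -lerBlDl sub0r.
Qed.

Lemma riesz_line l a v t : riesz eta l (a + t *: v) =
  \prod_(i <- l) trig_factor (fun i => 2 * pi * dotv v (eta i))
    (fun i => 2 * pi * dotv a (eta i)) (fun=> 1) (fun=> 1) (fun=> 0) i t.
Proof.
apply: eq_bigr => i _; rewrite /trig_factor mul0r addr0 mul1r dotv_line.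
by rewrite mulrDr mulrA.
Qed.

Let pi1 : 1 <= 2 * pi :> R.
Proof. by have := pi_ge2 R; lra. Qed.

Lemma Rintegral_riesz_line (tau al be : R) l a v : 0 < tau -> al < be ->
  lacunary tau (map (fun i => dotv v (eta i)) l) ->
  `|\int[lebesgue_measure]_(t in `[al, be]) riesz eta l (a + t *: v) - (be - al)|
    <= (3 ^+ size l - 1) * (2 / tau).
Proof.
move=> tau0 ab lac.
have := @Rintegral_trig_prod R al be ab _ (fun i => 2 * pi * dotv v (eta i))
    (fun i => 2 * pi * dotv a (eta i)) (fun=> 1) (fun=> 1) (fun=> 0) _ _ _ tau tau0 l.
rewrite big1// mulr1 => H.
under eq_Rintegral do rewrite riesz_line.
apply: H => [_|_|_|]; rewrite ?normr1 ?normr0//.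
rewrite (map_comp ( *%R (2 * pi)) (fun i => dotv v (eta i))).
by apply: lacunary_scale => //; exact: ltW.
Qed.

Lemma continuous_riesz_line l a v : continuous (fun t : R => riesz eta l (a + t *: v)).
Proof.
rewrite (_ : (fun t => _) = (fun t => \prod_(i <- l) trig_factor (fun i => 2 * pi * dotv v (eta i))
    (fun i => 2 * pi * dotv a (eta i)) (fun=> 1) (fun=> 1) (fun=> 0) i t)).
  exact: continuous_trig_prod.
by apply/funext => t; exact: riesz_line.
Qed.

Lemma Rintegral_segmentE (al be : R) (f : R -> R) : continuous f ->
  (\int[lebesgue_measure]_(t in `[al, be]) (f t)%:E =
   (\int[lebesgue_measure]_(t in `[al, be]) f t)%:E)%E.
Proof.
move=> cf; rewrite /Rintegral fineK//; apply: integrable_fin_num => //.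
exact: continuous_segment_integrable.
Qed.

Definition riesz_weight (rho : R) l := riesz eta l \_ (cube 0 rho).

Lemma riesz_weight_ge0 rho l x : 0 <= riesz_weight rho l x.
Proof. by rewrite /riesz_weight patchE; case: ifP => // _; exact: riesz_ge0. Qed.

(** Some coordinate of [v] has size at least [1 / (n + 1)], so the line is in the cube only for
    parameters within [rho * (n + 1)] of the zero [c] of that coordinate. By nonnegativity the
    integral only grows when the cutoff is replaced by this interval and the exceptional factors by
    2. *)
Lemma line_integral_riesz_weight_le (rho tau : R) (K : nat) (E : pred nat) l a v :
  0 < rho -> 0 < tau -> enorm v = 1 -> (count E l <= K)%N ->
  lacunary tau (map (fun i => dotv v (eta i)) (seq.filter (predC E) l)) ->
  (line_integral (riesz_weight rho l) a v <=
    (2 ^+ K * (2 * rho * n.+1%:R + (3 ^+ size l - 1) * (2 / tau)))%:E)%E.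
Proof.
move=> rho0 tau0 v1 El lac; have [j vj] := enorm1_coord v1.
have n0 : 0 < n.+1%:R :> R by rewrite ltr0n.
have vj0 : 0 < `|v ord0 j| by apply: lt_le_trans vj; rewrite invr_gt0.
pose c := - a ord0 j / v ord0 j; pose r := rho * n.+1%:R.
have r0 : 0 < r by rewrite mulr_gt0.
pose al := c - r; pose be := c + r.
have ab : al < be by rewrite /al /be; lra.
pose D : set R := [set t | cube 0 rho (a + t *: v)].
pose wl (t : R) := riesz_weight rho l (a + t *: v).
pose g (t : R) := 2 ^+ K * riesz eta (seq.filter (predC E) l) (a + t *: v).
have cg : continuous g.
  by move=> t; apply: cvgM; [exact: cvg_cst|exact: continuous_riesz_line].
apply: (@le_trans _ _ (\int[lebesgue_measure]_(t in `[al, be]) (g t)%:E)%E).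
  rewrite /line_integral.
  rewrite [leLHS](_ : _ = \int[lebesgue_measure]_(t in D) (wl t)%:E)%E; last first.
    rewrite [RHS]integral_mkcond; apply: eq_integral => t _; rewrite [RHS]patchE /wl.
    case: ifPn => // h; rewrite /riesz_weight patchE ifN//.
  apply: ge0_le_integral_patch.
  - by move=> t; rewrite lee_fin /wl riesz_weight_ge0.
  - by move=> t; rewrite lee_fin mulr_ge0 ?exprn_ge0// riesz_ge0.
  move=> t tc; split.
    rewrite /= in_itv /= /al /be -ler_distl.
    have -> : t - c = (a + t *: v) ord0 j / v ord0 j.
      rewrite /c !mxE mulrDl mulfK; first by ring.
      by rewrite -normr_gt0.
    rewrite normrM normfV ler_pdivrMr//.
    have := tc j; rewrite [X in _ - X]mxE subr0 => /le_trans; apply.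
    rewrite /r -mulrA ler_peMr ?(ltW rho0)//.
    by rewrite mulrC -ler_pdivrMr// div1r.
  rewrite lee_fin /wl /riesz_weight patchE mem_set//.
  apply: le_trans (riesz_filter E _ _) _; rewrite ler_wpM2r ?riesz_ge0//.
  by rewrite ler_weXn2l// ler1n.
rewrite Rintegral_segmentE// lee_fin /g RintegralZl//; last first.
  apply: continuous_segment_integrable; exact: continuous_riesz_line.
rewrite ler_pM2l ?exprn_gt0//.
have := Rintegral_riesz_line a tau0 ab lac.
rewrite ler_distl => /andP[_ /le_trans]; apply.
apply: lerD; first by rewrite /al /be /r; lra.
rewrite ler_wpM2r ?divr_ge0// ?(ltW tau0)// lerD2r ler_weXn2l// ?ler1n//.
by rewrite size_filter count_size.
Qed.

(** The first coordinate axis is a witness: there the Riesz product integrates to [2 rho] up to the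
    error. *)
Lemma sup_line_integral_riesz_weight_gt0 (rho tau : R) l :
  0 < rho -> 0 < tau ->
  lacunary tau (map (fun i => eta i ord0 ord0) l) ->
  (3 ^+ size l - 1) * (2 / tau) < 2 * rho ->
  (0 < sup_line_integral (riesz_weight rho l))%E.
Proof.
move=> rho0 tau0 lac small.
pose v := basis_rV R (ord0 : 'I_n.+1).
have dv p : dotv v p = p ord0 ord0 by exact: dotv_basis.
have v1 : enorm v = 1.
  by rewrite /enorm dv mxE !eqxx sqrtr1.
have lac' : lacunary tau (map (fun i => dotv v (eta i)) l).
  by rewrite (eq_map (g := fun i => eta i ord0 ord0)).
have ab : - rho < rho by lra.
have := Rintegral_riesz_line 0 tau0 ab lac'.
set J := Rintegral _ _ _; rewrite ler_distl => /andP[h _].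
have J0 : 0 < J by lra.
apply: (@lt_le_trans _ _ (line_integral (riesz_weight rho l) 0 v)); last first.
  by apply: ereal_sup_ubound; exists 0 => //; exists v.
apply: (@lt_le_trans _ _ J%:E); first by rewrite lte_fin.
rewrite /J -Rintegral_segmentE; last exact: continuous_riesz_line.
rewrite /line_integral; apply: ge0_le_integral_patch.
- by move=> t; rewrite lee_fin riesz_ge0.
- by move=> t; rewrite lee_fin riesz_weight_ge0.
move=> t; rewrite /= in_itv /= => /andP[t1 t2]; split => //.
rewrite lee_fin /riesz_weight patchE mem_set// => i.
rewrite !mxE subr0 add0r normrM; apply: le_trans (_ : `|t| * 1 <= _).
  by rewrite ler_wpM2l//; case: (_ && _); rewrite ?normr1 ?normr0.
by rewrite mulr1 ler_norml t1.
Qed.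
End riesz.

(** * Lower bound along the first coordinate axis *)

Section riesz_lower.
Variables (R : realType) (n : nat) (eta : nat -> 'rV[R]_n.+1).
Implicit Types (a v x : 'rV[R]_n.+1) (l : seq nat).
Variables (tau al be : R) (l : seq nat) (a v : 'rV[R]_n.+1).
Hypotheses (tau0 : 0 < tau) (ab : al < be) (ul : uniq l).
Hypothesis lac : lacunary tau (map (fun i => dotv v (eta i)) l).
Local Notation J := (Rintegral (@lebesgue_measure R) `[al, be]%classic).
Local Notation err := ((3 ^+ size l - 1) * (2 / tau)).
Local Notation W t := (riesz eta l (a + t *: v)).
Local Notation C i t := (cos (2 * pi * dotv (a + t *: v) (eta i))).

Let pi1 : 1 <= 2 * pi :> R.
Proof. by have := pi_ge2 R; lra. Qed.

Lemma Rintegral_cos_riesz i : i \in l ->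
  (be - al) / 2 - err <= J (fun t : R => C i t * W t).
Proof.
move=> il.
(* cos A * (1 + cos A) = 1/2 + cos A + 1/2 * cos (2 A) *)
pose A j : R := if j == i then 2^-1 else 1.
pose G j : R := if j == i then 2^-1 else 0.
have A1 j : `|A j| <= 1 by rewrite /A; case: eqP => _; rewrite ger0_norm// invf_le1// ler1n.
have B1 (j : nat) : `|(fun=> 1) j : R| <= 1 by rewrite normr1.
have G1 j : `|G j| <= 1.
  by rewrite /G; case: eqP => _; rewrite ?normr0// ger0_norm// invf_le1// ler1n.
have lac' : lacunary tau (map (fun i => 2 * pi * dotv v (eta i)) l).
  rewrite (map_comp ( *%R (2 * pi)) (fun i => dotv v (eta i))).
  by apply: lacunary_scale => //; exact: ltW.
have := Rintegral_trig_prod ab (fun i => 2 * pi * dotv a (eta i)) A1 B1 G1 tau0 lac'.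
have -> : \prod_(j <- l) A j = 2^-1.
  rewrite (bigD1_seq i)//= {1}/A eqxx big1 ?mulr1// => j ji.
  by rewrite /A (negbTE ji).
rewrite ler_distl => /andP[h _]; apply: le_trans h _.
rewrite le_eqVlt; apply/orP; left; apply/eqP; apply: eq_Rintegral => t _.
rewrite riesz_line (bigD1_seq i)//= [in RHS](bigD1_seq i)//= mulrA; congr (_ * _).
  set u := 2 * pi * dotv (a + t *: v) (eta i).
  have uE : 2 * pi * dotv v (eta i) * t + 2 * pi * dotv a (eta i) = u.
    by rewrite /u dotv_line; ring.
  have c2 : cos (2 * u) = 2 * cos u ^+ 2 - 1.
    by rewrite mulr_natl cos_mulr2n mulr_natl.
  by rewrite /trig_factor /A /G /= eqxx uE c2; field.
by apply: eq_bigr => j ji; rewrite /trig_factor /A /G (negbTE ji).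
Qed.

Lemma continuous_dotv_cos (p : 'rV[R]_n.+1) :
  continuous (fun t : R => cos (2 * pi * dotv (a + t *: v) p)).
Proof.
rewrite (_ : (fun t => _) = (fun t => cos (2 * pi * dotv v p * t + 2 * pi * dotv a p))).
  exact: continuous_cos_affine.
by apply/funext => t; rewrite dotv_line; congr cos; ring.
Qed.

(** The linearised lower bound for [|Ef|^2 w] on the cube. The entry 0 in the list stands for the
    cap at [x0], and [dl] for the phase error of one cap. *)
Definition test_function (lam dl : R) (x : 'rV[R]_n.+1) : R :=
  (2 * lam * (\sum_(p <- 0 :: map eta l) cos (2 * pi * dotv x p)
     - (size l).+1%:R * dl) - lam ^+ 2) * riesz eta l x.

(** Against the Riesz product the cosine at [p = 0] has mean 1 and each other one about 1/2, so [b]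
    approximates the mean of their sum. With [lam = b / 2] the main term is
    [2 lam b - lam^2 = 3 b^2 / 4], and the bounds by 1/16 let the errors take away less than
    [b^2 / 2]. *)
Lemma Rintegral_test_function (dl : R) :
  let b := 1 + (size l)%:R / 2 in
  err <= (be - al) / 16 -> 0 <= dl -> dl <= 1 / 16 ->
  b ^+ 2 / 4 * (be - al) <=
    J (fun t : R => test_function (b / 2) dl (a + t *: v)).
Proof.
move=> b erri dl0 dl1.
set lam := b / 2; set I := be - al in erri *.
have I0 : 0 < I by rewrite subr_gt0.
set m : R := (size l)%:R in b lam *.
have m0 : 0 <= m by rewrite ler0n.
have cW : continuous (fun t : R => W t) by exact: continuous_riesz_line.
have cC p : continuous (fun t : R => cos (2 * pi * dotv (a + t *: v) p) * W t).
  by move=> t; apply: cvgM; [exact: continuous_dotv_cos|exact: cW].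
have cS s : continuous (fun t : R => \sum_(p <- s) (cos (2 * pi * dotv (a + t *: v) p) * W t)).
  elim: s => [|p s ih] t.
    rewrite (_ : (fun t => _) = cst 0); first exact: cvg_cst.
    by apply/funext => u; rewrite big_nil.
  rewrite (_ : (fun t => _) = (fun t => cos (2 * pi * dotv (a + t *: v) p) * W t +
     \sum_(p <- s) (cos (2 * pi * dotv (a + t *: v) p) * W t))).
    by apply: cvgD; [exact: cC|exact: ih].
  by apply/funext => u; rewrite big_cons.
have JS s : J (fun t : R => \sum_(p <- s) (cos (2 * pi * dotv (a + t *: v) p) * W t)) =
    \sum_(p <- s) J (fun t : R => cos (2 * pi * dotv (a + t *: v) p) * W t).
  elim: s => [|p s ih].
    under eq_Rintegral do rewrite big_nil; rewrite big_nil.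
    by rewrite Rintegral_cst// mul0r.
  under eq_Rintegral do rewrite big_cons -[X in X + _]mul1r.
  by rewrite Rintegral_lin// mul1r ih big_cons.
have JE : J (fun t : R => test_function lam dl (a + t *: v)) =
   2 * lam * (\sum_(p <- 0 :: map eta l) J (fun t : R => cos (2 * pi * dotv (a + t *: v) p) * W t))
   + (- (2 * lam * ((m + 1) * dl) + lam ^+ 2)) * J (fun t : R => W t).
  rewrite -JS.
  have ZE : J (fun t : R => 2 * lam * \sum_(p <- 0 :: map eta l)
        (cos (2 * pi * dotv (a + t *: v) p) * W t)) = 2 * lam *
      J (fun t : R => \sum_(p <- 0 :: map eta l) (cos (2 * pi * dotv (a + t *: v) p) * W t)).
    by apply: RintegralZl => //; apply: continuous_segment_integrable; exact: cS.
  rewrite -ZE addrC.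
  have c2 : continuous (fun t : R => 2 * lam * \sum_(p <- 0 :: map eta l)
        (cos (2 * pi * dotv (a + t *: v) p) * W t)).
    by move=> t; apply: cvgM; [exact: cvg_cst|exact: cS].
  rewrite -(Rintegral_lin al be _ cW c2).
  apply: eq_Rintegral => t _; rewrite /test_function -big_distrl /= -natr1 -/m; ring.
have J0 : J (fun t : R => cos (2 * pi * dotv (a + t *: v) 0) * W t) = J (fun t : R => W t).
  apply: eq_Rintegral => t _; rewrite /dotv big1 ?mulr0 ?cos0 ?mul1r// => i _.
  by rewrite !mxE mulr0.
have := Rintegral_riesz_line a tau0 ab lac; rewrite ler_distl -/I => /andP[W1 W2].
rewrite JE big_cons J0 big_map.
have SC : m * (I / 2 - err) <=
    \sum_(i <- l) J (fun t : R => C i t * W t).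
  have <- : \sum_(i <- l) (I / 2 - err) = m * (I / 2 - err).
    by rewrite big_const_seq count_predT GRing.iter_addr_0 /m [RHS]mulr_natl.
  by rewrite big_seq [leRHS]big_seq; apply: ler_sum => i il; exact: Rintegral_cos_riesz.
set e := err in erri W1 W2 SC *.
have e0 : 0 <= e by rewrite mulr_ge0 ?divr_ge0 ?(ltW tau0)// subr_ge0 exprn_ege1// ler1n.
set JW := J _ in W1 W2 *; set Sm := \sum_(i <- l) _ in SC *.
have lam0 : 0 <= lam by rewrite /lam /b; lra.
have b1 : 1 <= b by rewrite /b; lra.
have k0 : 0 <= 2 * lam * ((m + 1) * dl) + lam ^+ 2.
  apply: addr_ge0; last exact: sqr_ge0.
  by apply: mulr_ge0; [rewrite mulr_ge0|rewrite mulr_ge0// addr_ge0].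
have h1 : b * ((1 + m / 2) * I - (m + 1) * e) <= 2 * lam * (JW + Sm).
  have -> : 2 * lam = b by rewrite /lam; field.
  by rewrite ler_pM2l; lra.
have h2 : (2 * lam * ((m + 1) * dl) + lam ^+ 2) * JW <=
    (b * ((m + 1) * dl) + b ^+ 2 / 4) * (I + e).
  have -> : 2 * lam * ((m + 1) * dl) + lam ^+ 2 = b * ((m + 1) * dl) + b ^+ 2 / 4.
    by rewrite /lam; field.
  by rewrite ler_wpM2l//; move: k0; rewrite /lam;
    (have -> : 2 * (b / 2) * ((m + 1) * dl) + (b / 2) ^+ 2 =
       b * ((m + 1) * dl) + b ^+ 2 / 4 by field).
have h3 : (m + 1) * e <= 2 * b * (I / 16).
  by apply: ler_pM => //; rewrite /b; lra.
have h4 : (m + 1) * dl <= 2 * b / 16.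
  apply: (@le_trans _ _ (2 * b * (1 / 16))); last by lra.
  by apply: ler_pM => //; rewrite /b; lra.
have h5 : (b * ((m + 1) * dl) + b ^+ 2 / 4) * (I + e) <=
    (b * (2 * b / 16) + b ^+ 2 / 4) * (I + I / 16).
  apply: ler_pM; [| lra | | lra].
    by rewrite addr_ge0// ?mulr_ge0 ?addr_ge0 ?exprn_ge0//; lra.
  by rewrite lerD2r ler_pM2l//; lra.
have h6 : b * ((m + 1) * e) <= b * (2 * b * (I / 16)) by rewrite ler_pM2l//; lra.
have := mulr_ge0 (sqr_ge0 b) (ltW I0).
move: h1 h2 h5 h6; rewrite -/b mulNr expr2.
move: (2 * lam * _) (2 * lam * _ + _) => X Y.
lra.
Qed.
End riesz_lower.

(** * The extension of a sum of caps *)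

Lemma cos_lipschitz (R : realType) (x y : R) : `|cos x - cos y| <= `|x - y|.
Proof.
have := @quadratic_mvt R (fun s => cos (y + s)) (fun s => - sin (y + s)) (x - y) 0 0 1.
rewrite /= addr0 !mul0r addr0 subr0 mul1r (addrC y) subrK; apply.
- move=> s _; apply: is_derive_eq; rewrite /GRing.scale /=; ring.
- by move=> s _; rewrite mul0r addr0 subr0 normrN ler_norml sin_geN1 sin_le1.
Qed.

Section simple_sums.
Context d (T : measurableType d) (R : realType) (mu : {measure set T -> \bar R}).
Variables (I : eqType) (S : set T) (cap : I -> set T) (ps : seq I).
Hypotheses (mS : measurable S) (mcap : forall p, measurable (cap p)).
Hypotheses (capS : forall p, cap p `<=` S).
Hypotheses (capoo : forall p, p \in ps -> (mu (cap p) < +oo)%E).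

Definition simple_sum (c : I -> R) (z : T) : R := \sum_(p <- ps) c p * \1_(cap p) z.

Lemma measurable_simple_sum c : measurable_fun setT (simple_sum c).
Proof.
apply: measurable_sum => p; apply: measurable_funM; first exact: measurable_cst.
exact: measurable_indic.
Qed.

Let integrable_cap p : p \in ps -> mu.-integrable S (EFin \o (\1_(cap p) : T -> R)).
Proof.
move=> pp; apply/integrableP; split.
  by apply/measurable_EFinP; exact: measurable_indic.
rewrite (eq_integral (fun z => (\1_(cap p) z)%:E)); last first.
  by move=> z _; rewrite /= ger0_norm.
by rewrite integral_indic// setIidl//; exact: capoo.
Qed.

Lemma integrable_simple_sum c : mu.-integrable S (EFin \o simple_sum c).
Proof.
have -> : EFin \o simple_sum c = (fun z => \sum_(p <- ps) (if p \in ps then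
    (c p * \1_(cap p) z)%:E else 0%E))%E.
  apply/funext => z /=; rewrite /simple_sum -sumEFin.
  by apply: eq_big_seq => p ->.
apply: integrable_sum => // p _; case: (boolP (p \in ps)) => pp; last exact: integrable0.
rewrite (_ : (fun z => _) = (fun z => (c p)%:E * (EFin \o (\1_(cap p) : T -> R)) z)%E)//.
by apply: integrableZl => //; exact: integrable_cap.
Qed.

Lemma Rintegral_simple_sum c :
  \int[mu]_(z in S) simple_sum c z = \sum_(p <- ps) c p * fine (mu (cap p)).
Proof.
rewrite /Rintegral.
have -> : (\int[mu]_(z in S) (simple_sum c z)%:E =
    \sum_(p <- ps) (c p * fine (mu (cap p)))%:E)%E; last by rewrite sumEFin.
rewrite (eq_integral (fun z => \sum_(p <- ps) (if p \in ps then
    (c p * \1_(cap p) z)%:E else 0%E))%E); last first.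
  move=> z _; rewrite /simple_sum -sumEFin.
  by apply: eq_big_seq => p ->.
rewrite integral_sum//; last first.
  move=> p; case: (boolP (p \in ps)) => pp; last exact: integrable0.
  rewrite (_ : (fun z => _) = (fun z => (c p)%:E * (EFin \o (\1_(cap p) : T -> R)) z)%E)//.
  by apply: integrableZl => //; exact: integrable_cap.
apply: eq_big_seq => p pp; rewrite pp.
rewrite (_ : (fun z => _) = (fun z => (c p)%:E * (EFin \o (\1_(cap p) : T -> R)) z)%E)//.
rewrite integralZl//; last exact: integrable_cap.
rewrite EFinM; congr (_ * _)%E.
rewrite /= integral_indic// setIidl; last exact: capS.
by rewrite fineK// ge0_fin_numE// capoo.
Qed.

Lemma simple_sum_sqr c : (forall p q z, p \in ps -> q \in ps -> cap p z -> cap q z -> p = q) ->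
  uniq ps -> forall z, simple_sum c z ^+ 2 = simple_sum (fun p => c p ^+ 2) z.
Proof.
move=> disj ups z; rewrite /simple_sum.
have [[p [pp cz]]|N] := pselect (exists p, p \in ps /\ cap p z); last first.
  have rest (F : I -> R) : \sum_(q <- ps) F q * (\1_(cap q) z : R) = 0.
    rewrite big_seq big1// => q qq.
    by rewrite indicE memNset ?mulr0// => h; apply: N; exists q.
  by rewrite !rest expr0n.
have other q : q \in ps -> q != p -> (\1_(cap q) z : R) = 0.
  move=> qq qp; rewrite indicE memNset// => h.
  by move/eqP : qp; apply; exact: disj h cz.
have rest (F : I -> R) : \sum_(q <- ps | q != p) F q * (\1_(cap q) z : R) = 0.
  by rewrite big_seq_cond big1// => q /andP[qq qp]; rewrite other// mulr0.
rewrite (bigD1_seq p)//= [in RHS](bigD1_seq p)//= !rest !addr0.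
by rewrite indicE mem_set// !mulr1.
Qed.
End simple_sums.

Section extension_lower.
Variables (R : realType) (n : nat) (S : set 'rV[R]_n.+1) (x0 : 'rV[R]_n.+1) (rc : R).
Variable ps : seq 'rV[R]_n.+1.
Hypothesis mS : measurable S.
Local Notation mu := (surface_measure R n.+1).

Definition cap (p : 'rV[R]_n.+1) : set 'rV[R]_n.+1 := S `&` cube (x0 + p) rc.

Lemma measurable_cap p : measurable (cap p).
Proof. by apply: measurableI => //; exact: measurable_cube. Qed.

Lemma cap_sub p : cap p `<=` S. Proof. by move=> z []. Qed.

Local Notation m p := (fine (mu (cap p))).
Hypotheses (capoo : forall p, p \in ps -> (mu (cap p) < +oo)%E).
Hypotheses (cap0 : forall p, p \in ps -> 0 < m p).

(** With this normalisation each cap acts on the extension like a unit point mass, while for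
    disjoint caps the squared norm is the sum of the inverse areas. *)
Definition cap_function (z : 'rV[R]_n.+1) : R[i] :=
  Complex (simple_sum cap ps (fun p => (m p)^-1) z) 0.
Local Notation g := (simple_sum cap ps (fun p => (m p)^-1)).

Let Sc p := @cap_sub p.

Lemma cap_function_ge0 z : 0 <= g z.
Proof.
apply: sumr_ge0 => p _; rewrite mulr_ge0// ?invr_ge0 ?fine_ge0//.
Qed.

Lemma L2normsq_cap_function :
  (forall p q z, p \in ps -> q \in ps -> cap p z -> cap q z -> p = q) -> uniq ps ->
  L2normsq S cap_function = (\sum_(p <- ps) (m p)^-1)%:E.
Proof.
move=> disj ups; rewrite /L2normsq.
rewrite (eq_integral (fun z => (simple_sum cap ps (fun p => (m p)^-1 ^+ 2) z)%:E)); last first.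
  move=> z _; rewrite -simple_sum_sqr// /Normc.normc /= expr0n addr0.
  by rewrite sqrtr_sqr ger0_norm// cap_function_ge0.
have := Rintegral_simple_sum mS measurable_cap Sc capoo (fun p => (m p)^-1 ^+ 2).
rewrite /Rintegral => H.
rewrite -[LHS]fineK; last first.
  by apply: integrable_fin_num => //; exact: (integrable_simple_sum mS measurable_cap Sc capoo).
rewrite H; congr EFin; apply: eq_big_seq => p pp.
by rewrite expr2 -mulrA mulVf ?mulr1// gt_eqF// cap0.
Qed.

Lemma in_L2_cap_function : (L2normsq S cap_function < +oo)%E -> in_L2 S cap_function.
Proof.
move=> fin; split => //=; apply: measurable_funTS.
  by apply: measurable_simple_sum; exact: measurable_cap.
Qed.

(** Rotating by the phase of [x0] and taking the real part gives [X] with [X^2 <= |Ef|^2]. On the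
    cap at [x0 + p] the rotated phase is within [2 pi (n + 1) rho rc] of [2 pi x . p], and the
    cosine is 1-Lipschitz. *)
Lemma extension_lower (lam rho : R) x : cube 0 rho x -> 0 <= lam -> 0 <= rho ->
  2 * lam * (\sum_(p <- ps) cos (2 * pi * dotv x p)
     - (size ps)%:R * (2 * pi * (n.+1%:R * rho * rc))) - lam ^+ 2 <=
  Normc.normc (extension S cap_function x) ^+ 2.
Proof.
move=> xr lam0 rho0.
pose th z := 2 * pi * dotv x z.
have mth : measurable_fun setT th.
  by apply: measurable_funM; [exact: measurable_cst|exact: measurable_dotv].
have mcos : measurable_fun setT (fun z => cos (th z)).
  by apply: (measurableT_comp _ mth); apply: continuous_measurable_fun; exact: continuous_cos.
have msin : measurable_fun setT (fun z => sin (th z)).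
  by apply: (measurableT_comp _ mth); apply: continuous_measurable_fun; exact: continuous_sin.
have mg : measurable_fun setT g by apply: measurable_simple_sum; exact: measurable_cap.
have ig : mu.-integrable S (EFin \o g) by exact: (integrable_simple_sum mS measurable_cap Sc capoo).
have ih (h : 'rV[R]_n.+1 -> R) : measurable_fun setT h -> (forall z, `|h z| <= 1) ->
    mu.-integrable S (EFin \o (fun z => h z * g z)).
  move=> mh h1; apply: (le_integrable _ _ _ ig) => //.
    by apply/measurable_EFinP; apply: measurable_funTS; exact: measurable_funM.
  move=> z _; rewrite lee_fin /= normrM ler_piMl//.
have cb z : `|cos (th z)| <= 1 by rewrite ler_norml cos_geN1 cos_le1.
have sb z : `|sin (th z)| <= 1 by rewrite ler_norml sin_geN1 sin_le1.
pose P := \int[mu]_(z in S) (cos (th z) * g z).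
pose Q := \int[mu]_(z in S) (sin (th z) * g z).
have -> : Normc.normc (extension S cap_function x) ^+ 2 = P ^+ 2 + Q ^+ 2.
  have -> : extension S cap_function x = Complex P (- Q).
    rewrite /extension; congr Complex.
      apply: eq_Rintegral => z _; rewrite /= mulr0 subr0 cosN //.
    rewrite /Q -mulN1r -RintegralZl//; last exact: ih.
    apply: eq_Rintegral => z _; rewrite /= mulr0 add0r sinN mulN1r mulNr //.
  by rewrite /Normc.normc sqr_sqrtr ?addr_ge0 ?sqr_ge0// sqrrN.
set al := 2 * pi * dotv x x0.
pose X := \int[mu]_(z in S) (cos (th z - al) * g z).
have XE : X = cos al * P + sin al * Q.
  rewrite /P /Q -RintegralZl//; last exact: ih.
  rewrite -RintegralZl//; last exact: ih.
  have iZ (c : R) (F : 'rV[R]_n.+1 -> R) : mu.-integrable S (EFin \o F) ->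
      mu.-integrable S (EFin \o (fun z => c * F z)).
    by move=> iF; apply: (integrableZl mS c iF).
  rewrite -RintegralD//; [|by apply: iZ; exact: ih|by apply: iZ; exact: ih].
  by apply: eq_Rintegral => z _; rewrite cosB; ring.
have XPQ : X ^+ 2 <= P ^+ 2 + Q ^+ 2.
  rewrite XE.
  have -> : P ^+ 2 + Q ^+ 2 = (cos al * P + sin al * Q) ^+ 2 + (sin al * P - cos al * Q) ^+ 2.
    rewrite -[LHS]mul1r -(cos2Dsin2 al); ring.
  by rewrite lerDl sqr_ge0.
set dl := 2 * pi * _.
suff : \sum_(p <- ps) cos (2 * pi * dotv x p) - (size ps)%:R * dl <= X.
  set Y := _ - _ => YX; apply: le_trans XPQ.
  have := sqr_ge0 (X - lam); have := ler_wpM2l lam0 YX; rewrite !expr2; nra.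
have -> : \sum_(p <- ps) cos (2 * pi * dotv x p) - (size ps)%:R * dl =
    \int[mu]_(z in S) simple_sum cap ps (fun p => (cos (2 * pi * dotv x p) - dl) / m p) z.
  rewrite (Rintegral_simple_sum mS measurable_cap Sc capoo).
  rewrite [RHS](eq_big_seq (fun p => cos (2 * pi * dotv x p) - dl)); last first.
    by move=> p pp; rewrite divfK// gt_eqF// cap0.
  rewrite sumrB; congr (_ - _).
  by rewrite big_const_seq count_predT GRing.iter_addr_0 mulr_natl.
apply: le_Rintegral => //.
- exact: (integrable_simple_sum mS measurable_cap Sc capoo).
- apply: ih; last by move=> z; rewrite ler_norml cos_geN1 cos_le1.
  apply: (measurableT_comp (f := cos)).
    by apply: continuous_measurable_fun; exact: continuous_cos.
  by apply: measurable_funB => //; exact: measurable_cst.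
move=> z Sz; rewrite /simple_sum big_distrr /=; apply: ler_sum => p _.
rewrite indicE; case: (boolP (z \in cap p)) => [/set_mem[_ zp]|_]; last by rewrite !mulr0.
rewrite !mulr1 ler_wpM2r ?invr_ge0 ?fine_ge0//.
have := cos_lipschitz (2 * pi * dotv x p) (th z - al).
rewrite ler_norml => /andP[_ h].
rewrite lerBlDr addrC -lerBlDr; apply: le_trans h _.
have -> : 2 * pi * dotv x p - (th z - al) =
    - (2 * pi * \sum_i x ord0 i * (z ord0 i - (x0 + p) ord0 i)).
  rewrite /th /al -!mulrBr -mulrN; congr (_ * _).
  rewrite /dotv -sumrB -sumrB -sumrN; apply: eq_bigr => i _; rewrite !mxE; ring.
have pi0 : 0 <= 2 * pi :> R by rewrite mulr_ge0// pi_ge0.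
rewrite normrN normrM (ger0_norm pi0) ler_wpM2l//.
apply: le_trans (ler_norm_sum _ _ _) _.
apply: (@le_trans _ _ (\sum_(i < n.+1) rho * rc)); last first.
  by rewrite sumr_const card_ord -[leLHS]mulr_natl mulrA.
apply: ler_sum => i _; rewrite normrM; apply: ler_pM => //.
by have := xr i; rewrite mxE subr0.
Qed.
End extension_lower.

(** * Fubini *)

Section fubini.
Variables (R : realType) (n : nat).

Lemma integral_lebesgue_rVS (Psi : 'rV[R]_n.+1 -> \bar R) :
  measurable_fun setT Psi -> (forall x, (0 <= Psi x)%E) ->
  (\int[lebesgue_rV R n.+1]_x Psi x =
   \int[lebesgue_rV R n]_y \int[lebesgue_measure]_t Psi (rV_cons (t, y)))%E.
Proof.
move=> mPsi Psi0.
have m2 : measurable_fun setT (Psi \o @rV_cons R n).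
  by apply: measurableT_comp => //; exact: measurable_rV_cons.
rewrite -(fubini_tonelli2 (m1 := @lebesgue_measure R) (m2 := lebesgue_rV R n) _ m2)//.
by apply: (ge0_integral_pushforward (@measurable_rV_cons R n)) => // y _.
by move=> p; exact: Psi0.
Qed.

Lemma rV_cons_line (t : R) (y : 'rV[R]_n) :
  rV_cons (t, y) = rV_cons (0, y) + t *: basis_rV R (ord0 : 'I_n.+1).
Proof.
apply/rowP => i; case: (unliftP ord0 i) => [j|] ->.
  rewrite [RHS]mxE [X in _ + X]mxE basis_rVE !rV_consS eq_sym.
  by rewrite (negbTE (neq_lift _ _)) mulr0 addr0.
by rewrite [RHS]mxE [X in _ + X]mxE basis_rVE !rV_cons0 eqxx mulr1 add0r.
Qed.

Lemma cube_rV_cons rho (t : R) (y : 'rV[R]_n) :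
  cube 0 rho (rV_cons (t, y)) <-> `|t| <= rho /\ cube 0 rho y.
Proof.
split=> [h|[ht hy] i].
  split; first by have := h ord0; rewrite rV_cons0 mxE subr0.
  by move=> i; have := h (lift ord0 i); rewrite rV_consS !mxE.
case: (unliftP ord0 i) => [j|] ->; last by rewrite rV_cons0 mxE subr0.
by have := hy j; rewrite rV_consS !mxE.
Qed.

(** The positive part puts the integral within reach of Tonelli and integrates on each segment to at
    least as much as [Phi]. It is harmless later, since the function that dominates [Phi] is
    nonnegative. *)
Lemma integral_cube_ge (Phi : 'rV[R]_n.+1 -> R) (rho c : R) :
  measurable_fun setT Phi -> 0 < rho -> 0 <= c ->
  (forall a, continuous (fun t : R => Phi (a + t *: basis_rV R ord0))) ->
  (forall a, c <= \int[lebesgue_measure]_(t in `[- rho, rho])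
    Phi (a + t *: basis_rV R ord0)) ->
  ((c * (2 * rho) ^+ n)%:E <=
    \int[lebesgue_rV R n.+1]_(x in cube 0 rho) (Num.max (Phi x) 0)%:E)%E.
Proof.
move=> mPhi rho0 c0 cPhi hPhi.
pose Psi := (fun x => (Num.max (Phi x) 0)%:E) \_ (cube 0 rho).
have mPsi : measurable_fun setT Psi.
  apply: (measurable_restrictT _ (measurable_cube _ _)).1.
  apply/measurable_EFinP; apply: measurable_maxr; last exact: measurable_cst.
  exact: measurable_funTS.
have Psi0 x : (0 <= Psi x)%E.
  by rewrite /Psi patchE; case: ifP => // _; rewrite lee_fin le_max lexx orbT.
rewrite integral_mkcond -/Psi integral_lebesgue_rVS//.
rewrite EFinM -(@lebesgue_cube R n 0)//; last exact: ltW.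
rewrite -integral_cst; last exact: measurable_cube.
apply: ge0_le_integral_patch => [y|y|y yc] /=.
- by rewrite lee_fin.
- exact: integral_ge0.
split=> //.
set a := rV_cons (0, y).
apply: (@le_trans _ _ (\int[lebesgue_measure]_(t in `[(- rho)%R, rho])
    (Phi (a + t *: basis_rV R ord0)%R)%:E)%E).
  by rewrite Rintegral_segmentE// lee_fin.
apply: (@le_trans _ _ (\int[lebesgue_measure]_(t in `[(- rho)%R, rho])
    (Num.max (Phi (a + t *: basis_rV R ord0)%R) 0%R)%:E)%E).
  apply: le_integral => //.
  - by apply: continuous_segment_integrable; exact: cPhi.
  - apply: (@continuous_segment_integrable R (- rho) rho
      (fun t => Num.max (Phi (a + t *: basis_rV R ord0)) 0)) => t.
    by apply: continuous_max; [exact: cPhi|exact: cvg_cst].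
  - by move=> t _; rewrite lee_fin le_max lexx.
apply: ge0_le_integral_patch => [t|t|t] //.
  by rewrite lee_fin le_max lexx orbT.
rewrite /= in_itv /= => tr; split=> //.
rewrite /Psi patchE mem_set -?rV_cons_line//.
by apply/cube_rV_cons; split=> //; rewrite ler_norml.
Qed.

Lemma cube_eball (rho r : R) : 0 <= rho -> n.+1%:R * rho < r ->
  (cube 0 rho : set 'rV[R]_n.+1) `<=` @eball R n.+1 r.
Proof.
move=> rho0 h x xr; rewrite /eball /=; apply: le_lt_trans h.
apply: le_trans (enorm_le_sum x) _.
apply: (@le_trans _ _ (\sum_(i < n.+1) rho)).
  by apply: ler_sum => i _; have := xr i; rewrite mxE subr0.
by rewrite sumr_const card_ord mulr_natl.
Qed.

Lemma measurable_riesz (eta : nat -> 'rV[R]_n) l : measurable_fun setT (riesz eta l).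
Proof.
apply: measurable_prod => i _; apply: measurable_funD; first exact: measurable_cst.
apply: (measurableT_comp (f := cos)).
  by apply: continuous_measurable_fun; exact: continuous_cos.
apply: measurable_funM; first exact: measurable_cst.
rewrite (_ : (fun x => _) = dotv (eta i)); first exact: measurable_dotv.
by apply/funext => x; apply: eq_bigr => j _; rewrite mulrC.
Qed.

End fubini.

(** An earlier term exceeds twice the sum of the later ones by [tau], hence is at distance [tau]
    from each. Applied to first coordinates, this separates the caps. *)
Lemma lacunary_separated (R : realType) (I : eqType) (f : I -> R) (tau : R) l :
  0 <= tau -> lacunary tau (map f l) ->
  (forall i, i \in l -> tau <= `|f i|) /\
  (forall i j, i \in l -> j \in l -> i != j -> tau <= `|f i - f j|).
Proof.
move=> tau0; elim: l => [|i l ih] /=; first by [].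
rewrite big_map => /andP[h /ih[ih1 ih2]].
have S0 : 0 <= \sum_(j <- l) `|f j| by apply: sumr_ge0.
have fi : tau <= `|f i| by lra.
have fij j : j \in l -> tau <= `|f i - f j|.
  move=> jl; have : `|f j| <= \sum_(j <- l) `|f j|.
    by rewrite (big_rem j)//= lerDl sumr_ge0.
  have := ler_normD (f i - f j) (f j); rewrite subrK.
  by have := normr_ge0 (f j); lra.
split=> [j|j j']; rewrite !inE.
  by move=> /orP[/eqP->//|]; exact: ih1.
move=> /orP[/eqP->|jl] /orP[/eqP->|j'l]; rewrite ?eqxx//.
- by move=> _; exact: fij.
- by move=> _; rewrite distrC; exact: fij.
- exact: ih2.
Qed.

(** * Conclusion *)

(** Of the first [m + K] indices at most [K] are exceptional. This serves the first coordinate axis: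
    the lower bound there involves every factor of the weight, so its exceptional indices are
    discarded in advance. *)
Lemma sparse_indices (E : pred nat) K m :
  (forall l, uniq l -> (count E l <= K)%N) ->
  exists l : seq nat, [/\ size l = m, sorted ltn l,
    all (fun i => i <= m + K)%N l & all (predC E) l].
Proof.
move=> hE; pose l0 := iota 0 (m + K); pose l1 := seq.filter (predC E) l0.
have sl1 : (m <= size l1)%N.
  rewrite size_filter -(leq_add2l (count E l0)) count_predC size_iota addnC.
  by rewrite leq_add2l; apply: hE; exact: iota_uniq.
exists (take m l1); split.
- by rewrite size_takel.
- apply: take_sorted; apply: sorted_filter; [exact: ltn_trans|exact: iota_ltn_sorted].
- apply/allP => i /mem_take; rewrite mem_filter mem_iota add0n => /andP[_ /andP[_ h]].
  exact: ltnW.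
- by apply/allP => i /mem_take; rewrite mem_filter => /andP[].
Qed.

Lemma power_scale (R : realType) (C r : R) : 1 < C -> 1 <= r ->
  exists m : nat, C ^+ m <= r /\ ln r <= (m%:R + 1) * ln C.
Proof.
move=> C1 r1; have C0 : 0 < C by lra.
have r0 : 0 < r by lra.
have lC : 0 < ln C by rewrite ln_gt0.
have x0 : 0 <= ln r / ln C by rewrite divr_ge0 ?ln_ge0// ltW.
have /andP[h1 h2] := truncn_itv x0.
exists (Num.truncn (ln r / ln C)); split.
  rewrite -ler_ln ?posrE ?exprn_gt0// lnXn// -mulr_natl.
  by rewrite -ler_pdivlMr.
by rewrite natr1 -ler_pdivrMr// ltW.
Qed.

(** * Area of a single cap *)

Section caps_of_chart.
Variables (R : realType) (n : nat) (S : set 'rV[R]_n.+1) (k : 'I_n.+1)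
    (phi : 'rV[R]_n -> R) (x0 : 'rV[R]_n.+1) (e0 L : R)
    (eta : nat -> 'rV[R]_n.+1) (K P : nat) (c0 t0 q : R).
Hypothesis lc : lacunary_chart S k phi x0 e0 L eta K P c0 t0 q.
Variables (rc : R) (p : 'rV[R]_n.+1).
Hypotheses (rc0 : 0 < rc) (rce : rc <= e0 / 2).
Hypotheses (Sp : S (x0 + p)) (pe : cube x0 (e0 / 2) (x0 + p)).

Let cap_e0 z : cap S x0 rc p z -> cube x0 e0 z.
Proof.
have h : e0 / 2 + rc <= e0 by move: rce; lra.
by move=> [_ zc]; exact: (cube_sub pe h).
Qed.

Lemma cap_lty : (surface_measure R n.+1 (cap S x0 rc p) < +oo)%E.
Proof.
apply: (hausdorff_graph_lty (k := k) (lc_e0 lc) (lc_L lc) (lc_lip lc)) => z zc.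
have ze := cap_e0 zc; split; first exact: cube_col'.
by apply: (lc_graph lc ze).1; case: zc.
Qed.

(** Over a cube of radius [rc / (1 + L n)] the graph varies by at most [rc] from its centre, so it
    stays in the cap and the projection bound applies. *)
Lemma cap_ge : ball_volume R n / 4 ^+ n * (2 / (1 + L * n%:R)) ^+ n * rc ^+ n <=
  fine (surface_measure R n.+1 (cap S x0 rc p)).
Proof.
have L0 := lc_L lc; have e00 := lc_e0 lc.
have Ln : 0 < 1 + L * n%:R by rewrite ltr_pwDl// mulr_ge0// ltW.
pose rho := rc / (1 + L * n%:R).
have rho0 : 0 < rho by rewrite divr_gt0.
have rhoc : rho <= rc by rewrite ler_pdivrMr// ler_peMr ?(ltW rc0)// lerDl mulr_ge0// ltW.
have pe0 : cube x0 e0 (x0 + p) by apply: cubeS pe; lra.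
have ck := cube_col' k pe0.
have pk := (lc_graph lc pe0).1 Sp.
have h1 : e0 / 2 + rc <= e0 by move: rce; lra.
have h2 : e0 / 2 + rho <= e0 by lra.
have proj y' : cube (col' k (x0 + p)) rho y' ->
    exists2 z, cap S x0 rc p z & col' k z = y'.
  move=> y'r; exists (graph_pt k y' (phi y')); last exact: col'_graph_pt.
  have ye : cube (col' k x0) e0 y'.
    exact: (cube_sub (cube_col' k pe) h2 y'r).
  have zc : cube (x0 + p) rc (graph_pt k y' (phi y')).
    apply: cube_graph_pt; first exact: cubeS y'r.
    rewrite pk; apply: le_trans (lc_lip lc ck ye) _.
    apply: (@le_trans _ _ (L * (n%:R * rho))).
      rewrite ler_pM2l//; apply: (@le_trans _ _ (\sum_(j < n) rho)).
        by apply: ler_sum => j _; exact: y'r.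
      by rewrite sumr_const card_ord mulr_natl.
    by rewrite mulrA /rho mulrCA ler_piMr ?(ltW rc0)// ler_pdivrMr// mul1r lerDr.
  split=> //; apply/(lc_graph lc); last by rewrite graph_pt_k col'_graph_pt.
  exact: (cube_sub pe h1 zc).
have h := hausdorff_ge_projection (ltW rho0) proj.
rewrite -lee_fin fineK; last first.
  by rewrite ge0_fin_numE ?measure_ge0//; exact: cap_lty.
apply: le_trans h; rewrite lee_fin /rho -mulrA -exprMn le_eqVlt; apply/orP; left.
by apply/eqP; congr (_ * _ ^+ _); ring.
Qed.
End caps_of_chart.

(** * Estimates at a fixed scale *)

Section one_scale.
Variables (R : realType) (n : nat) (S : set 'rV[R]_n.+1) (k : 'I_n.+1)
    (phi : 'rV[R]_n -> R) (x0 : 'rV[R]_n.+1) (e0 L : R)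
    (eta : nat -> 'rV[R]_n.+1) (K P : nat) (c0 t0 q : R).
Hypothesis mS : measurable S.
Hypothesis lc : lacunary_chart S k phi x0 e0 L eta K P c0 t0 q.

Lemma separated_points (l : seq nat) (tau : R) :
  0 < tau -> uniq l -> lacunary tau (map (fun i => eta i ord0 ord0) l) ->
  uniq (0 :: map eta l) /\
  forall p p', p \in 0 :: map eta l -> p' \in 0 :: map eta l -> p != p' ->
    tau <= `|p ord0 ord0 - p' ord0 ord0|.
Proof.
move=> tau0 ul /(lacunary_separated (ltW tau0))[s1 s2]; split.
  rewrite /= map_inj_in_uniq ?ul ?andbT.
    apply/negP => /mapP[i il /esym ei].
    by have := s1 i il; rewrite ei mxE normr0 leNgt tau0.
  move=> i j il jl eij; apply/eqP; apply: contraT => ij.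
  by have := s2 i j il jl ij; rewrite eij subrr normr0 leNgt tau0.
move=> p p'; rewrite !inE => /orP[/eqP->|/mapP[i il ->]] /orP[/eqP->|/mapP[j jl ->]].
- by rewrite eqxx.
- by move=> _; rewrite [X in X - _]mxE sub0r normrN; exact: s1.
- by move=> _; rewrite [X in _ - X]mxE subr0; exact: s1.
- by move=> h; apply: s2 => //; apply: contraNneq h => ->.
Qed.

Variables (r rho rc tau : R) (m : nat) (l : seq nat).
Hypotheses (r1 : 1 <= r) (rhoE : rho = r / (2 * n.+1%:R)).
Hypotheses (rc0 : 0 < rc) (rce : rc <= e0 / 2) (rcr : rc * r <= 64^-1).
Hypotheses (tau0 : 0 < tau) (sl : size l = m) (ul : uniq l).
Hypothesis lac0 : lacunary tau (map (fun i => eta i ord0 ord0) l).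
Hypothesis lacv : forall v, enorm v = 1 -> exists E : pred nat,
  (count E l <= K)%N /\ lacunary tau (map (fun i => dotv v (eta i)) (seq.filter (predC E) l)).
Hypothesis small : (3 ^+ m - 1) * (2 / tau) <= 2 * rho / 16.
Local Notation ps := (0 :: map eta l).
Local Notation mu := (surface_measure R n.+1).
Local Notation f := (cap_function S x0 rc ps).
Local Notation w := (riesz_weight eta rho l).
Let kappa := ball_volume R n / 4 ^+ n * (2 / (1 + L * n%:R)) ^+ n * rc ^+ n.

Let n0 : 0 < n.+1%:R :> R. Proof. by rewrite ltr0n. Qed.
Let r0 : 0 < r. Proof. exact: lt_le_trans r1. Qed.
Let rho0 : 0 < rho. Proof. by rewrite rhoE divr_gt0// mulr_gt0. Qed.
Let rhor : rho * n.+1%:R = r / 2.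
Proof. by rewrite rhoE; field; rewrite ?gt_eqF. Qed.

Let point_in p : p \in ps -> S (x0 + p) /\ cube x0 (e0 / 2) (x0 + p).
Proof.
rewrite inE => /orP[/eqP->|/mapP[i _ ->]]; last exact: (lc_eta lc).
rewrite addr0; split; first exact: (lc_x0 lc).
by apply: cube_center; have := lc_e0 lc; lra.
Qed.

Let capoo p : p \in ps -> (mu (cap S x0 rc p) < +oo)%E.
Proof. by move=> /point_in[_ pe]; exact: (cap_lty lc rce pe). Qed.

Let kappa0 : 0 < kappa.
Proof.
rewrite !mulr_gt0 ?exprn_gt0 ?invr_gt0 ?ball_volume_gt0 ?exprn_gt0// divr_gt0//.
by rewrite ltr_pwDl// mulr_ge0// ltW// (lc_L lc).
Qed.

Let cap_k p : p \in ps -> kappa <= fine (mu (cap S x0 rc p)).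
Proof. by move=> /point_in[Sp pe]; exact: (cap_ge lc rc0 rce Sp pe). Qed.

Let cap0 p : p \in ps -> 0 < fine (mu (cap S x0 rc p)).
Proof. by move=> /cap_k; apply: lt_le_trans. Qed.

(** A common point of two caps would give [tau <= 2 * rc], hence [rho * tau <= rc * r <= 1 / 64];
    but two distinct points force [m > 0], and then [small] gives [rho * tau >= 32]. *)
Let cap_disjoint p p' z : p \in ps -> p' \in ps ->
  cap S x0 rc p z -> cap S x0 rc p' z -> p = p'.
Proof.
move=> pp pp' [_ zp] [_ zp']; apply/eqP; apply: contraT => pp'n.
have [_ /(_ p p' pp pp' pp'n)] := separated_points tau0 ul lac0.
have h : `|p ord0 ord0 - p' ord0 ord0| <= 2 * rc.
  have := zp ord0; have := zp' ord0; rewrite !mxE => h1 h2.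
  have -> : p ord0 ord0 - p' ord0 ord0 = (z ord0 ord0 - (x0 ord0 ord0 + p' ord0 ord0))
    - (z ord0 ord0 - (x0 ord0 ord0 + p ord0 ord0)) by ring.
  apply: le_trans (ler_normB _ _) _; lra.
move=> tauh; have tau2 : tau <= 2 * rc by exact: le_trans tauh h.
have m1 : (0 < m)%N.
  rewrite -sl; case: (l) pp pp' pp'n => // pp pp'.
  by move: pp pp'; rewrite !inE => /eqP-> /eqP->; rewrite eqxx.
have m3 : 2 <= 3 ^+ m - 1 :> R.
  have : 3 <= 3 ^+ m :> R.
    by rewrite -[X in X <= _]expr1 ler_weXn2l// ler1n.
  lra.
have t32 : 32 <= rho * tau.
  have : 2 * (2 / tau) <= 2 * rho / 16.
    by apply: le_trans small; rewrite ler_wpM2r// divr_ge0// ltW.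
  rewrite mulrA ler_pdivrMr//; lra.
have rr : rho <= r / 2.
  by rewrite -rhor ler_peMr ?(ltW rho0)// ler1n.
have : rho * tau <= r / 2 * (2 * rc) by apply: ler_pM => //; exact: ltW.
by move: rcr; lra.
Qed.

Let ups : uniq ps.
Proof. by have [] := separated_points tau0 ul lac0. Qed.

Lemma L2normsq_le : exists2 N2 : R, L2normsq S f = N2%:E &
  0 < N2 <= (m%:R + 1) / kappa.
Proof.
exists (\sum_(p <- ps) (fine (mu (cap S x0 rc p)))^-1).
  exact: (L2normsq_cap_function mS capoo cap0 cap_disjoint ups).
apply/andP; split.
  rewrite big_cons ltr_pwDl ?invr_gt0 ?cap0 ?inE ?eqxx// big_seq.
  apply: sumr_ge0 => p pp; rewrite invr_ge0 ltW// cap0//.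
  by rewrite inE pp orbT.
have -> : (m%:R + 1) / kappa = \sum_(p <- ps) kappa^-1.
  rewrite big_const_seq count_predT GRing.iter_addr_0 /= size_map sl.
  by rewrite -[RHS]mulr_natl natr1.
rewrite big_seq [leRHS]big_seq; apply: ler_sum => p pp.
by rewrite lef_pV2 ?posrE ?cap0// cap_k.
Qed.

(** A line contributes at most [2 ^ K] times the length [2 rho (n + 1) = r] plus an error of at most
    [r]. *)
Lemma sup_line_integral_le : exists2 s : R, sup_line_integral w = s%:E &
  0 < s <= 2 ^+ K.+1 * r.
Proof.
have ub : (sup_line_integral w <= (2 ^+ K.+1 * r)%:E)%E.
  apply: ge_ereal_sup => _ [a _ [v v1 <-]].
  have [E [Ek lacE]] := lacv v1.
  apply: le_trans (line_integral_riesz_weight_le a rho0 tau0 v1 Ek lacE) _.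
  rewrite lee_fin exprSr -[leRHS]mulrA ler_pM2l ?exprn_gt0//.
  rewrite sl -(mulrA 2) rhor.
  have : 2 * rho / 16 <= r.
    have : rho <= rho * n.+1%:R by rewrite ler_peMr ?(ltW rho0)// ler1n.
    by rewrite rhor; move: r0; lra.
  by move: small; lra.
have lb : (0 < sup_line_integral w)%E.
  apply: (sup_line_integral_riesz_weight_gt0 rho0 tau0 lac0).
  by rewrite sl; apply: le_lt_trans small _; move: rho0; lra.
exists (fine (sup_line_integral w)).
  by rewrite fineK// ge0_fin_numE ?ltW//; apply: le_lt_trans ub _; rewrite ltry.
have fin : sup_line_integral w \is a fin_num.
  by rewrite ge0_fin_numE ?ltW//; apply: le_lt_trans ub _; rewrite ltry.
by rewrite -!lte_fin -lee_fin fineK// lb ub.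
Qed.

Lemma weighted_extension_ge :
  (((m%:R + 1) ^+ 2 / 16 * (2 * rho) ^+ n.+1)%:E <=
    \int[lebesgue_rV R n.+1]_(x in @eball R n.+1 r)
         (Normc.normc (extension S f x) ^+ 2 * w x)%:E)%E.
Proof.
pose b : R := 1 + m%:R / 2.
pose dl : R := 2 * pi * (n.+1%:R * rho * rc).
have pi0 : 0 <= 2 * pi :> R by rewrite mulr_ge0// pi_ge0.
have dl0 : 0 <= dl by rewrite mulr_ge0// !mulr_ge0// ltW.
(* The origin of the bound [64^-1] on [rc * r], as [pi <= 4]. *)
have dl1 : dl <= 1 / 16.
  have -> : dl = pi * (rc * r) by rewrite /dl (mulrC n.+1%:R) rhor; field.
  have p4 : pi <= 4 :> R by have /andP[_ h] := pihalf_02 R; lra.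
  apply: (@le_trans _ _ (4 * 64^-1)); last by lra.
  by apply: ler_pM => //; [exact: pi_ge0|rewrite mulr_ge0 ?ltW].
have m0 : 0 <= m%:R :> R by rewrite ler0n.
have b0 : 0 <= b / 2 by rewrite /b; lra.
have lac e : lacunary tau (map (fun i => dotv (basis_rV R (ord0 : 'I_n.+1)) (eta i)) e)
   = lacunary tau (map (fun i => eta i ord0 ord0) e).
  congr lacunary; apply: eq_map => i.
  exact: dotv_basis.
have ab : - rho < rho by move: rho0; lra.
have mPhi : measurable_fun setT (test_function eta l (b / 2) dl).
  apply: measurable_funM; last exact: measurable_riesz.
  apply: measurable_funB; last exact: measurable_cst.
  apply: measurable_funM; first exact: measurable_cst.
  apply: measurable_funB; last exact: measurable_cst.
  apply: measurable_sum => p; apply: (measurableT_comp (f := cos)).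
    by apply: continuous_measurable_fun; exact: continuous_cos.
  apply: measurable_funM; first exact: measurable_cst.
  rewrite (_ : (fun x => _) = dotv p); first exact: measurable_dotv.
  by apply/funext => x; apply: eq_bigr => j _; rewrite mulrC.
have cPhi a : continuous (fun t : R => test_function eta l (b / 2) dl (a + t *: basis_rV R ord0)).
  move=> t; apply: cvgM; last exact: continuous_riesz_line.
  apply: cvgB; last exact: cvg_cst.
  apply: cvgM; first exact: cvg_cst.
  apply: cvgB; last exact: cvg_cst.
  elim: (ps) => [|p s ih].
    rewrite (_ : (fun t => _) = cst 0); first by rewrite big_nil; exact: cvg_cst.
    by apply/funext => u; rewrite big_nil.
  rewrite (_ : (fun t => _) = (fun t => cos (2 * pi * dotv (a + t *: basis_rV R ord0) p) +
     \sum_(p <- s) (cos (2 * pi * dotv (a + t *: basis_rV R ord0) p)))).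
    by rewrite big_cons; apply: cvgD; [exact: continuous_dotv_cos|exact: ih].
  by apply/funext => u; rewrite big_cons.
have c0' : 0 <= b ^+ 2 / 4 * (rho - - rho).
  by rewrite mulr_ge0 ?divr_ge0 ?sqr_ge0//; lra.
have hPhi a : b ^+ 2 / 4 * (rho - - rho) <= \int[lebesgue_measure]_(t in `[- rho, rho])
    test_function eta l (b / 2) dl (a + t *: basis_rV R ord0).
  have := @Rintegral_test_function R n eta tau (- rho) rho l a (basis_rV R ord0) tau0 ab ul.
  rewrite lac sl => /(_ lac0 dl); apply => //.
  by apply: le_trans small _; lra.
apply: (@le_trans _ _ (\int[lebesgue_rV R n.+1]_(x in cube 0 rho)
    (Num.max (test_function eta l (b / 2) dl x) 0%R)%:E)%E).
  apply: le_trans (integral_cube_ge mPhi rho0 c0' cPhi hPhi).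
  rewrite lee_fin opprK (exprS (2 * rho)) [leLHS]mulrA ler_pM2r ?exprn_gt0 ?mulr_gt0//.
  have -> : rho + rho = 2 * rho by ring.
  (* What remains is that [b = 1 + m / 2] is at least [(m + 1) / 2]. *)
  rewrite ler_pM2r ?mulr_gt0// /b.
  by rewrite !expr2; nra.
apply: ge0_le_integral_patch => [x|x|x xr].
- by rewrite lee_fin le_max lexx orbT.
- by rewrite lee_fin mulr_ge0 ?sqr_ge0// riesz_weight_ge0.
split.
  apply: cube_eball xr; first exact: ltW.
  by rewrite mulrC rhor; move: r0; lra.
rewrite lee_fin /riesz_weight patchE mem_set// ge_max.
rewrite (mulr_ge0 (sqr_ge0 _) (riesz_ge0 _ _ _)) andbT /test_function.
rewrite ler_wpM2r ?riesz_ge0//.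
have := extension_lower mS capoo cap0 xr b0 (ltW rho0).
by rewrite /= size_map.
Qed.
End one_scale.

Lemma log_loss (R : realType) n (S : set 'rV[R]_n.+1) : compact S ->
  C2_hypersurface S -> not_in_hyperplane S ->
  exists2 c : R, 0 < c & forall r : R, 1 <= r ->
    exists (f : 'rV[R]_n.+1 -> R[i]) (w : 'rV[R]_n.+1 -> R),
      [/\ in_L2 S f & (0 < L2normsq S f)%E] /\
      [/\ measurable_fun [set: 'rV[R]_n.+1] w, forall x, 0 <= w x,
          (0 < sup_line_integral w)%E & (sup_line_integral w < +oo)%E] /\
      ((c * ln r)%:E * L2normsq S f * sup_line_integral w <=
       \int[lebesgue_rV R n.+1]_(x in @eball R n.+1 r)
         (Normc.normc (extension S f x) ^+ 2 * w x)%:E)%E.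
Proof.
move=> cS Shyp nH.
have mS : measurable S.
  by apply: closed_measurable_rV; apply: compact_closed => //; exact: norm_hausdorff.
have [k [phi [x0 [e0 [L [eta [K [P [c0 [t0 [q lc]]]]]]]]]]] := lacunary_chartP Shyp nH.
have e00 := lc_e0 lc; have L0 := lc_L lc; have c00 := lc_c0 lc.
have /andP[t00 t01] := lc_t0 lc; have /andP[q0 q1] := lc_q lc.
pose N1 : R := n.+1%:R.
have N10 : 0 < N1 by rewrite ltr0n.
(* The caps will have radius [del / r]: [64^-1] controls the phase error, [e0 / 2] keeps them in the
   chart. *)
pose del := Num.min 64^-1 (e0 / 2).
have del0 : 0 < del by rewrite lt_min; apply/andP; split; [rewrite invr_gt0|exact: divr_gt0].
(* With [B] below, [3 ^ m * (2 / tau) = A * B ^ m] for the gap at index [m + K], so [small] follows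
   from [16 N1 A B^m <= r]. As [X >= 16 N1 A] and [X >= 1], this follows from [(X * B)^m <= r] when
   [m > 0]. *)
pose A := 2 / (c0 * (t0 * q ^+ K) ^+ P).
have A0 : 0 < A by rewrite divr_gt0// mulr_gt0// exprn_gt0// mulr_gt0// exprn_gt0.
pose X := 16 * N1 * A + 1.
have NA0 : 0 < 16 * N1 * A by apply: mulr_gt0 => //; apply: mulr_gt0.
have X1 : 1 <= X by rewrite /X; lra.
pose B := 3 / q ^+ P.
have qP0 : 0 < q ^+ P by rewrite exprn_gt0.
have B3 : 3 <= B by rewrite ler_pdivlMr// ler_piMr// exprn_ile1// ltW.
have C1 : 1 < X * B.
  by apply: (@lt_le_trans _ _ (1 * 3)); [lra|apply: ler_pM; lra].
have lC : 0 < ln (X * B) by rewrite ln_gt0.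
have Ln : 0 < 1 + L * n%:R by rewrite ltr_pwDl// mulr_ge0// ltW.
pose kap := ball_volume R n / 4 ^+ n * (2 / (1 + L * n%:R)) ^+ n * del ^+ n.
have kap0 : 0 < kap.
  apply: mulr_gt0; last exact: exprn_gt0.
  apply: mulr_gt0; last by rewrite exprn_gt0// divr_gt0.
  by rewrite divr_gt0 ?ball_volume_gt0// exprn_gt0.
(* In the final comparison one factor [m + 1] comes from [ln r] and one from the norm of [f],
   matching the square in the lower bound; [c] absorbs the rest with equality. *)
pose c := kap / (16 * 2 ^+ K.+1 * N1 ^+ n.+1 * ln (X * B)).
have den0 : 0 < 16 * 2 ^+ K.+1 * N1 ^+ n.+1 * ln (X * B).
  by rewrite !mulr_gt0// exprn_gt0.
have cc0 : 0 < c by exact: divr_gt0.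
exists c => //.
move=> r r1; have r0 : 0 < r by lra.
have [m [mr lnr]] := power_scale C1 r1.
pose rho := r / (2 * N1); pose rc := del / r.
pose tau := c0 * (t0 * q ^+ (m + K)) ^+ P.
have tau0 : 0 < tau by rewrite mulr_gt0// exprn_gt0// mulr_gt0// exprn_gt0.
have rc0 : 0 < rc by rewrite divr_gt0.
have delr : del / r <= del by rewrite ler_pdivrMr// ler_peMr// ltW.
have rce : rc <= e0 / 2 by apply: le_trans delr _; rewrite ge_min lexx orbT.
have rcr : rc * r <= 64^-1 by rewrite /rc divfK ?gt_eqF// ge_min lexx.
pose v0 : 'rV[R]_n.+1 := basis_rV R ord0.
have dv p : dotv v0 p = p ord0 ord0 by exact: dotv_basis.
have v01 : enorm v0 = 1 by rewrite /enorm dv mxE !eqxx sqrtr1.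
have [E0 [E0K E0lac]] := lc_lacunary lc v01.
have [l [sl sol lN lE]] := sparse_indices m E0K.
have ul : uniq l by apply: sorted_uniq sol; [exact: ltn_trans|exact: ltnn].
have lac0 : lacunary tau (map (fun i => eta i ord0 ord0) l).
  by have := E0lac _ _ sol lN lE; under eq_map do rewrite dv.
have lacv v : enorm v = 1 -> exists E : pred nat, (count E l <= K)%N /\
    lacunary tau (map (fun i => dotv v (eta i)) (seq.filter (predC E) l)).
  move=> v1; have [E [EK Elac]] := lc_lacunary lc v1.
  exists E; split; first exact: EK.
  apply: Elac; first by apply: sorted_filter => //; exact: ltn_trans.
    by apply/allP => i; rewrite mem_filter => /andP[_ /(allP lN)].
  exact: filter_all.
have small : (3 ^+ m - 1) * (2 / tau) <= 2 * rho / 16.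
  have -> : 2 * rho / 16 = r / (16 * N1) by rewrite /rho; field; rewrite gt_eqF.
  (* For [m = 0] the choice of [X * B] gives nothing, but [3 ^ m - 1] vanishes. *)
  have [->|m0] := posnP m; first by rewrite expr0 subrr mul0r divr_ge0// ?mulr_ge0// ltW.
  rewrite ler_pdivlMr ?mulr_gt0//; apply: le_trans mr.
  have AB : 3 ^+ m * (2 / tau) = A * B ^+ m.
    have -> : tau = c0 * (t0 * q ^+ K) ^+ P * (q ^+ P) ^+ m.
      rewrite /tau exprD (mulrC (q ^+ m)) (mulrA t0) (exprMn _ _ (q ^+ m)) mulrA.
      by rewrite -!exprM (mulnC m).
    rewrite /A /B expr_div_n; field.
    by rewrite !gt_eqF// ?exprn_gt0// mulr_gt0// exprn_gt0.
  apply: (@le_trans _ _ (A * B ^+ m * (16 * N1))).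
    rewrite -AB ler_pM2r ?mulr_gt0// ler_pM2r ?divr_gt0//; lra.
  have -> : A * B ^+ m * (16 * N1) = (16 * N1 * A) * B ^+ m by ring.
  rewrite (exprMn _ X B) ler_pM2r ?exprn_gt0//; last by lra.
  apply: (@le_trans _ _ X); first by rewrite /X; lra.
  by rewrite -[X in X <= _]expr1 ler_weXn2l.
have rhoE : rho = r / (2 * n.+1%:R) by [].
have [N2 N2E /andP[N20 N2le]] := L2normsq_le mS lc r1 rhoE rc0 rce rcr tau0 sl ul lac0 small.
have [s sE /andP[s0 sle]] := sup_line_integral_le r1 rhoE tau0 sl lac0 lacv small.
have main := weighted_extension_ge mS lc r1 rhoE rc0 rce rcr tau0 sl ul lac0 small.
exists (cap_function S x0 rc (0 :: map eta l)), (riesz_weight eta rho l).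
split; first split.
- by apply: in_L2_cap_function => //; rewrite N2E ltry.
- by rewrite N2E lte_fin.
split; first split.
- apply: (measurable_restrictT _ (measurable_cube _ _)).1; apply: measurable_funTS.
  exact: measurable_riesz.
- exact: riesz_weight_ge0.
- by rewrite sE lte_fin.
- by rewrite sE ltry.
apply: le_trans main; rewrite N2E sE -!EFinM lee_fin.
have lnr0 : 0 <= ln r by rewrite ln_ge0.
have m10 : 0 < m%:R + 1 :> R by rewrite ltr_wpDl.
apply: (@le_trans _ _ (c * ((m%:R + 1) * ln (X * B)) *
   ((m%:R + 1) / (kap / r ^+ n)) * (2 ^+ K.+1 * r))).
  have clnr : 0 <= c * ln r by rewrite mulr_ge0// ltW.
  apply: ler_pM => //; [by rewrite mulr_ge0// ltW|exact: ltW|].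
  apply: ler_pM => //; [exact: ltW|by rewrite ler_pM2l|].
  have -> : kap / r ^+ n = ball_volume R n / 4 ^+ n * (2 / (1 + L * n%:R)) ^+ n * rc ^+ n.
    by rewrite /kap /rc [(del / r) ^+ n]expr_div_n !mulrA.
  exact: N2le.
rewrite le_eqVlt; apply/orP; left; apply/eqP.
have -> : 2 * rho = r / N1 by rewrite /rho; field; rewrite gt_eqF.
rewrite /c expr_div_n !exprS.
field.
by rewrite !gt_eqF// ?exprn_gt0// ltr_pwDl.
Qed.

Theorem theorem1p2 (R : realType) (d : nat) (hd : (2 <= d)%N)
    (S : set 'rV[R]_d) (Scompact : compact S) (Shyp : C2_hypersurface S)
    (Snothyp : not_in_hyperplane S) :
  exists2 c : R, 0 < c & forall r : R, 1 <= r ->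
    exists (f : 'rV[R]_d -> R[i]) (w : 'rV[R]_d -> R),
      [/\ in_L2 S f & (0 < L2normsq S f)%E] /\
      [/\ measurable_fun [set: 'rV[R]_d] w, forall x, 0 <= w x,
          (0 < sup_line_integral w)%E & (sup_line_integral w < +oo)%E] /\
      ((c * ln r)%:E * L2normsq S f * sup_line_integral w <=
       \int[lebesgue_rV R d]_(x in eball r)
         (Normc.normc (extension S f x) ^+ 2 * w x)%:E)%E.
Proof.
case: d hd S Scompact Shyp Snothyp => // n _ S.
exact: log_loss.
Qed.
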